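(* Let $\Gamma$ be a locally linearly independent configuration in $\mathfrak B^0_d$ with associated tree $T$, and let $0<r<d$. Suppose $M_\Gamma\cong\bigoplus_{v\in V(T)}P_v^{d_v}$ where $\sum_vd_v=d$. Given a tuple $D=(d_{\vec e})_{\vec e\in\vec E(T)}\in\mathbb Z_{\ge0}^{\vec E(T)}$: (1) $D$ is contained in the image of $\Phi$ if and only if $$\begin{cases}0\le d_{\vec e}\le r-d_{\overleftarrow e}\le\sum_{v\in A_{\vec e}}d_v\ \text{ for all }\vec e\in\vec E(T);\\ r-\sum_{\vec e\in\vec E_v}(r-d_{\vec e})\ge0\ \text{ for all }v\in V(T).\end{cases}$$ (2) The irreducible components of $\mathrm{Gr}(\mathbf r,M_\Gamma)$ are of the form $\mathcal S^c_N$, where $N\cong\bigoplus_vP_v^{r_v}$ runs over all isomorphism classes of projective (dimension-$\mathbf r$) subrepresentations of $M_\Gamma$, which are classified by the conditions $\sum_vr_v=r$ and $$\Phi(N)=\Big(\sum_{v\in A_{\vec e}}r_v\Big)_{\vec e\in\vec E(T)}\le\Big(\sum_{v\in A_{\vec e}}d_v\Big)_{\vec e\in\vec E(T)}.$$ As a result, $\mathcal S_N^c$ is the set of subrepresentations $M=(U_v)_v$ (of dimension $\mathbf r$) such that $\dim f_{\vec e}(U_{s(\vec e)})\le\sum_{v\in A_{\vec e}}r_v$ for all $\vec e$, and $\mathrm{Gr}(\mathbf r,M_\Gamma)$ has pure dimension $r(d-r)$.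
   Context: Let $R$ be a discrete valuation ring with uniformizer $\pi$, fraction field $K$ and algebraically closed residue field $\kappa$, and $V$ a $K$-vector space of dimension $d$. $[L]$ denotes the homothety class of a lattice $L\subset V$, $\mathfrak B_d^0$ the set of classes. Two distinct classes are adjacent if they have representatives with $\pi L\subset L'\subset L$. A finite non-empty set $\Gamma=\{[L_i]\}_{i\in I}\subset\mathfrak B^0_d$ (distinct indices giving distinct classes) is convex if $[L\cap L']\in\Gamma$ whenever $[L],[L']\in\Gamma$. Fix representatives $L_i$; let $n_{i,j}$ be the minimal integer with $\pi^{n_{i,j}}L_i\subset L_j$, $\overline L_i=L_i/\pi L_i$, and $f_{i,j}\colon\overline L_i\to\overline L_j$ the map induced by multiplication by $\pi^{n_{i,j}}$. A convex $\Gamma$ is locally linearly independent if for every $[L_0]\in\Gamma$ the subspaces $f_{i,0}(\overline L_i)=\ker f_{0,i}$ of $\overline L_0$, for $[L_i]\in\Gamma$ adjacent to $[L_0]$, are linearly independent. Then the graph $T$ with vertex set $V(T)=I$ and edges joining adjacent classes is a tree, and $Q(\Gamma)$ is the quiver with vertex set $V(T)$ and arrow set the set $\vec E(T)$ of oriented edges of $T$ (both orientations of every edge). For $\vec e\in\vec E(T)$: $s(\vec e),t(\vec e)$ are source and target, $\overleftarrow e$ the reverse, $f_{\vec e}=f_{s(\vec e),t(\vec e)}$, and $A_{\vec e}$ is the set of vertices $v$ such that the minimal path in $T$ from $v$ to $s(\vec e)$ does not pass through $t(\vec e)$. $\vec E_v$ is the set of oriented edges with source $v$. $M_\Gamma$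 is the representation of $Q(\Gamma)$ with spaces $\overline L_v$ and maps $f_{\vec e}$. Subrepresentations are tuples $(U_v)_v$, $U_v\subset\overline L_v$, with $f_{\vec e}(U_{s(\vec e)})\subset U_{t(\vec e)}$; $\mathbf r=(r,\dots,r)$, and $\mathrm{Gr}(\mathbf r,M_\Gamma)$ is the quiver Grassmannian (over $\kappa$) of subrepresentations with $\dim U_v=r$ for all $v$. $P_u$ is the representation with $\kappa$ at every vertex, $f_{\vec e}=\mathrm{id}$ if $\vec e$ points outwards from $u$ and $0$ otherwise. Projective representations are the direct sums of $P_v$'s (equivalently, projective modules over the bound quiver algebra of $Q(\Gamma)$). $\mathcal S_M$ is the set of points of $\mathrm{Gr}(\mathbf r,M_\Gamma)$ isomorphic to $M$ as representations, and $\mathcal S^c_M$ is its closure. $\Phi\colon\mathrm{Gr}(\mathbf r,M_\Gamma)\to\mathbb Z_{\ge0}^{\vec E(T)}$ sends $(U_v)_v$ to $(\dim f_{\vec e}(U_{s(\vec e)}))_{\vec e}$; $\le$ is the coordinatewise order. *)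

(* Defs.v *)
From HB Require Import structures.
From mathcomp Require Import mpoly.
From mathcomp Require Import all_boot all_order all_algebra.
From mathcomp Require Import boolp classical_sets.

Set Implicit Arguments.
Unset Strict Implicit.
Unset Printing Implicit Defensive.

Import Order.TTheory GRing.Theory Num.Theory.
Local Open Scope classical_set_scope.
Local Open Scope ring_scope.

Definition is_ideal (R : idomainType) (J : set R) : Prop :=
  [/\ J 0, forall x y, J x -> J y -> J (x + y)
    & forall a x, J x -> J (a * x)].

(* A local principal ideal domain, not a field, whose maximal ideal (the set of
   non-units) is generated by [pi]. *)
Definition is_dvr (R : idomainType) (pi : R) : Prop :=
  [/\ forall J : set R, is_ideal J -> exists a, J = range (fun x => x * a),
      pi != 0
    & forall x : R, x \isn't a GRing.unit <-> exists y, x = y * pi].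

Record dvr := DVR {
  dvr_ring :> idomainType;
  unif : dvr_ring;
  dvrP : is_dvr unif }.
Arguments unif {_}.

(* [k] is the residue field of [R], with reduction map [res]. *)
Definition is_residue_map (R : dvr) (k : fieldType) (res : {rmorphism R -> k}) :
    Prop :=
  (forall c, exists a, res a = c) /\
  (forall a, res a = 0 <-> exists b, a = b * unif).

Notation fracfield R := {fraction (dvr_ring R)}.

Definition dilate (K : fieldType) (V : lmodType K) (a : K) (A : set V) : set V :=
  [set a *: x | x in A].

Definition unifK (R : dvr) : fracfield R := tofrac (unif : R).
Arguments unifK : clear implicits.

Section Lattices.
Variables (R : dvr) (V : vectType (fracfield R)).
Implicit Types (L A B : set V) (c : set (set V)).

Definition Rspan n (b : n.-tuple V) : set V :=
  range (fun a : 'I_n -> R => \sum_(i < n) tofrac (a i) *: b`_i).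

Definition is_lattice L : Prop :=
  exists2 b : (\dim {:V}).-tuple V, basis_of {:V} b & L = Rspan b.

Definition hclass L : set (set V) :=
  [set dilate a L | a in [set a : fracfield R | a != 0]].

Definition adjacent c c' : Prop :=
  c <> c' /\
  exists A B, [/\ c A, c' B, dilate (unifK R) A `<=` B & B `<=` A].

(* [red], restricted to [L], is the projection of [L] onto [L / pi L], the
   target being a vector space over the residue field. *)
Definition is_reduction (k : fieldType) (res : {rmorphism R -> k}) L
    (Lbar : vectType k) (red : V -> Lbar) : Prop :=
  [/\ forall x y, L x -> L y -> red (x + y) = red x + red y,
      forall a x, L x -> red (tofrac a *: x) = res a *: red x,
      forall u, exists2 x, L x & red x = u
    & forall x, L x -> (red x = 0 <-> dilate (unifK R) L x)].

Definition is_min_exponent A B (n : int) : Prop :=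
  dilate (unifK R ^ n) A `<=` B /\
  (forall m : int, dilate (unifK R ^ m) A `<=` B -> n <= m).

Section Configurations.
Variables (I : finType) (L : I -> set V).

Definition is_configuration : Prop :=
  [/\ (0 < #|I|)%N, forall i, is_lattice (L i)
    & injective (fun i => hclass (L i))].

Definition convex : Prop :=
  forall i j A B, hclass (L i) A -> hclass (L j) B ->
  exists k, hclass (L k) (A `&` B).

End Configurations.
End Lattices.

Record graph := Graph {
  vertex :> finType;
  adj : rel vertex;
  adj_sym : symmetric adj;
  adj_irrefl : irreflexive adj }.

Section Graphs.
Variable T : graph.

Definition arrow := {e : T * T | adj e.1 e.2}.
HB.instance Definition _ := Finite.on arrow.
Implicit Type e : arrow.

Definition src e : T := (val e).1.
Definition tgt e : T := (val e).2.

Lemma rev_arrow_subproof e : adj (tgt e, src e).1 (tgt e, src e).2.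
Proof. by rewrite /= adj_sym; exact: (valP e). Qed.

Definition rev_arrow e : arrow := exist _ (tgt e, src e) (rev_arrow_subproof e).

Definition minimal_path (x y : T) (p : seq T) : Prop :=
  [/\ path (@adj T) x p, last x p = y
    & forall q, path (@adj T) x q -> last x q = y -> (size p <= size q)%N].

(* The set [A_e]; when [T] is a tree the path [p] is unique. *)
Definition side e : {set T} :=
  [set v | `[< exists2 p, minimal_path v (src e) p & tgt e \notin v :: p >]].

End Graphs.

Section Representations.
Variables (k : fieldType) (T : graph).

Record rep := Rep {
  rsp :> T -> vectType k;
  rmap : forall e : arrow T, 'Hom(rsp (src e), rsp (tgt e)) }.

Definition rep_iso (M N : rep) : Prop :=
  exists phi : forall v, 'Hom(M v, N v),
    (forall v, bijective (phi v)) /\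
    (forall e x, phi (tgt e) (rmap M e x) = rmap N e (phi (src e) x)).

(* [e] points outwards from [u] exactly when the path from [u] to the source of
   [e] avoids the target of [e], i.e. when [u \in side e]. *)
Definition Prep (u : T) : rep :=
  @Rep (fun=> k^o : vectType k)
       (fun e => if u \in side e then \1%VF else 0).

(* The direct sum of [m v] copies of [Prep v], [v : T]: all the summands have
   the same spaces, and the maps act coordinatewise. *)
Definition Psum (m : T -> nat) : rep :=
  @Rep (fun=> {ffun {v : T & 'I_(m v)} -> k^o} : vectType k)
       (fun e => linfun (fun x : {ffun {v : T & 'I_(m v)} -> k^o} =>
          [ffun j => rmap (Prep (tag j)) e (x j)])).

Definition projective (N : rep) : Prop := exists m, rep_iso N (Psum m).

Variables (M : rep) (r : nat).

Definition subtuple := forall v, {vspace M v}.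
Implicit Type U : subtuple.

Definition subrepresentation U : Prop :=
  forall e, (rmap M e @: U (src e) <= U (tgt e))%VS.

Definition subrep U : rep :=
  @Rep (fun v => subvs_of (U v) : vectType k)
       (fun e => linfun (fun x : subvs_of (U (src e)) =>
          vsproj (U (tgt e)) (rmap M e (vsval x)))).

(* Only [k]-rational points, which are all the closed points when [k] is
   algebraically closed. *)
Definition Gr : set subtuple :=
  [set U | subrepresentation U /\ forall v, \dim (U v) = r].

Definition Phi U : arrow T -> nat :=
  fun e => \dim (rmap M e @: U (src e))%VS.

Definition stratum (N : rep) : set subtuple :=
  [set U | Gr U /\ rep_iso (subrep U) N].

(* Zariski topology: [Gr] is embedded in the product over [v] of the projective
   spaces of Pluecker coordinates of [Gr(r, M v)]; its closed subsets are the
   zero loci in it of sets of multihomogeneous polynomials.  The coordinates at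
   [v] are indexed by all [r]-tuples of columns, so they repeat up to sign. *)

Definition frame U v : 'M[k]_(r, \dim {:M v}) :=
  \matrix_(i, j) coord (vbasis {:M v}) j (vbasis (U v))`_i.

Definition pindex := {v : T & {ffun 'I_r -> 'I_(\dim {:M v})}}.
HB.instance Definition _ := Finite.on pindex.

Definition plucker U (j : pindex) : k :=
  \det (colsub (tagged j) (frame U (tag j))).

Definition multihomogeneous (p : {mpoly k[#|{: pindex}|]}) : Prop :=
  exists deg : T -> nat, forall m, m \in msupp p ->
  forall v, (\sum_(j | tag (enum_val j) == v) m j)%N = deg v.

Definition zclosed (Z : set subtuple) : Prop :=
  exists S : set {mpoly k[#|{: pindex}|]},
    (forall p, S p -> multihomogeneous p) /\
    Z = [set U | Gr U /\
           forall p, S p -> p.@[fun i => plucker U (enum_val i)] = 0].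

Definition zclosure (A : set subtuple) : set subtuple :=
  \bigcap_(Z in [set Z | zclosed Z /\ A `<=` Z]) Z.

Definition irreducible (A : set subtuple) : Prop :=
  A !=set0 /\
  (forall Z1 Z2, zclosed Z1 -> zclosed Z2 -> A `<=` Z1 `|` Z2 ->
     A `<=` Z1 \/ A `<=` Z2).

Definition irreducible_component (C : set subtuple) : Prop :=
  [/\ zclosed C, irreducible C
    & forall C', zclosed C' -> irreducible C' -> C `<=` C' -> C' = C].

Definition irreducible_chain (C : set subtuple) n (Z : nat -> set subtuple) :
    Prop :=
  (forall i, (i <= n)%N -> [/\ zclosed (Z i), irreducible (Z i) & Z i `<=` C]) /\
  (forall i, (i < n)%N -> Z i `<` Z i.+1).

Definition has_dimension (C : set subtuple) n : Prop :=
  (exists Z, irreducible_chain C n Z) /\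
  (forall m Z, irreducible_chain C m Z -> (m <= n)%N).

Definition pure_dimension n : Prop :=
  forall C, irreducible_component C -> has_dimension C n.

End Representations.

Arguments subrepresentation {k T} M U.
Arguments subrep {k T} M U.
Arguments Gr {k T} M r U.
Arguments Phi {k T} M U e.
Arguments stratum {k T} M r N U.
Arguments zclosed {k T} M r Z.
Arguments zclosure {k T} M r A U.
Arguments irreducible {k T} M r A.
Arguments irreducible_component {k T} M r C.
Arguments irreducible_chain {k T} M r C n Z.
Arguments has_dimension {k T} M r C n.
Arguments pure_dimension {k T} M r n.

Lemma adjacentC (R : dvr) (V : vectType (fracfield R)) (c c' : set (set V)) :
  (forall A a, a != 0 -> c A -> c (dilate a A)) -> adjacent c c' -> adjacent c' c.
Proof.
move=> cZ [ncc' [A [B [cA c'B AB BA]]]]; split; first by move=> /esym.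
exists B, (dilate (unifK R) A); split=> //.
  by apply: cZ => //; case: (dvrP R) => _ pi0 _; rewrite tofrac_eq0.
by move=> _ [x Bx <-]; exists x => //; exact: BA.
Qed.

Lemma hclass_dilate (R : dvr) (V : vectType (fracfield R)) (L A : set V) a :
  a != 0 -> hclass L A -> hclass L (dilate a A).
Proof.
move=> a0 [b /= b0 <-]; exists (a * b); first by rewrite /= mulf_neq0.
rewrite /dilate image_comp; apply: eq_imagel => x _ /=.
by rewrite scalerA.
Qed.

Section ConfigurationGraph.
Variables (R : dvr) (V : vectType (fracfield R)) (I : finType) (L : I -> set V).

Definition config_adj : rel I :=
  fun i j => `[< adjacent (hclass (L i)) (hclass (L j)) >].

Lemma config_adj_sym : symmetric config_adj.
Proof.
by move=> i j; apply/asboolP/asboolP; apply: adjacentC => A a; exact: hclass_dilate.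
Qed.

Lemma config_adj_irrefl : irreflexive config_adj.
Proof. by move=> i; apply/asboolP => -[]. Qed.

Definition config_graph : graph := Graph config_adj_sym config_adj_irrefl.

Section Reduction.
Variables (k : fieldType) (res : {rmorphism R -> k}).
Variables (Lbar : I -> vectType k) (red : forall i, V -> Lbar i).
Variables (f : forall i j, 'Hom(Lbar i, Lbar j)).

Definition induced_maps : Prop :=
  forall i j (n : int), is_min_exponent (L i) (L j) n ->
  forall x, L i x -> f i j (red i x) = red j (unifK R ^ n *: x).

Definition locally_linearly_independent : Prop :=
  convex L /\
  forall j, directv (\sum_(i | config_adj i j) limg (f i j)).

Definition config_rep : rep k config_graph :=
  @Rep k config_graph Lbar (fun e => f (src e) (tgt e)).

End Reduction.
End ConfigurationGraph.

(* Main.v *)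
From HB Require Import structures.
Require Import Defs.
From mathcomp Require Import mpoly.
From mathcomp Require Import all_boot all_order all_algebra.
From mathcomp Require Import perm generic_quotient.
From mathcomp Require Import boolp classical_sets.
From mathcomp Require Import zify ring.

Set Implicit Arguments.
Unset Strict Implicit.
Unset Printing Implicit Defensive.

Import Order.TTheory GRing.Theory Num.Theory.
Local Open Scope classical_set_scope.
Local Open Scope ring_scope.

(* Convexity makes the graph [T] connected, since the classes [L_i cap pi^-m L_j]
   form a walk from [L_j] to [L_i]; if some [d_v] is positive, linear
   independence of the images makes every other vertex have exactly one
   neighbour closer to [v], so [T] is a tree.

   In coordinates all spaces of [M] are [k^d] and the map along [e] is the
   projection to the coordinates attached to vertices of [A_e].  Splitting off
   the kernels of the maps out of each vertex shows that every point of [Gr] is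
   generated by [r] vectors, each placed at a vertex or at the midpoint of an
   edge, and that the rank of the map along [e] is the number of these points on
   its source side.  Moving a midpoint to an end of its edge is the generic
   member of a pencil, hence the stratum of [N] is dense in the locus
   [Phi <= Phi N].  A family of points is realized exactly when, at each vertex,
   the generators can be matched with the coordinates they may involve; the sets
   in question form a tree, so a greedy choice starting from the farthest
   generators succeeds whenever the counting conditions hold.

   A stratum of a projective contains densely the image of an affine space of
   dimension [r (d - r)] whose coordinates are ratios of minors: coordinate
   subspaces give a chain of that length.  A longer chain of irreducible closed
   sets would give too many independent forms: a form separating two successive
   members is independent of those separating the previous ones, while the
   pullbacks to the affine space are polynomials of bounded degree. *)

(** * Distances and trees *)

(** A configuration of generators at [o] is described by one matrix [w], common to all vertices, and
    [masked o w v] is linear in [w]. Density, degeneration and irreducibility therefore reduce to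
    one-parameter families: a form restricted to such a curve is a polynomial in one variable, and
    over an algebraically closed field finitely many nonzero polynomials have a common non-root.
    Vertices and midpoints are both encoded as pairs, and doubled distances turn statements on
    geodesics into linear arithmetic.

    The numbers of generators are forced by the ranks [D]: a vertex [v] carries the part of the
    space outside the sum of the kernels, of dimension [r - sum (r - D e)], and an edge the kernel
    of [e] modulo the image of the reverse map, of dimension [r - D e - D (rev_arrow e)]. The
    obstacle to existence is independence at all vertices at once; matchings are found at each
    vertex separately and merged by genericity.

    The bound on chains is a growth comparison: a chain of length [m] yields [(t+1)^m] independent
    forms whose pullbacks have degree at most [t K], while at most [(t K + 1)^N] monomials in [N]
    variables are available. *)

Section Distance.
Local Open Scope nat_scope.
Variable T : graph.
Implicit Types (x y z u v s t a b : T) (e : arrow T).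

Definition walk_length x y n : bool :=
  `[< exists p, [/\ path (@adj T) x p, last x p = y & size p = n] >].

Definition dist x y : nat :=
  if pselect (exists n, walk_length x y n) is left H then ex_minn H else 0.

Definition connected : Prop := forall x y, exists n, walk_length x y n.

Hypothesis conn : connected.

Lemma dist_path x y :
  exists p, [/\ path (@adj T) x p, last x p = y & size p = dist x y].
Proof.
rewrite /dist; case: pselect => [H|/(_ (conn x y))//].
by case: ex_minnP => n /asboolP[p [? ? <-]] _; exists p.
Qed.

Lemma dist_le x p : path (@adj T) x p -> dist x (last x p) <= size p.
Proof.
move=> xp; rewrite /dist; case: pselect => [H|//].
by case: ex_minnP => n _; apply; apply/asboolP; exists p.
Qed.

Lemma distxx x : dist x x = 0.
Proof. by have := @dist_le x [::] isT; rewrite /= leqn0 => /eqP. Qed.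

Lemma dist_eq0 x y : (dist x y == 0) = (x == y).
Proof.
apply/eqP/eqP => [|->]; last exact: distxx.
by case: (dist_path x y) => -[|z p] [] //= _ ? <-.
Qed.

Lemma distC x y : dist x y = dist y x.
Proof.
suff le u v : dist u v <= dist v u by apply/eqP; rewrite eqn_leq !le.
have [p [vp <- <-]] := dist_path v u.
have := @dist_le (last v p) (rev (belast v p)).
rewrite size_rev size_belast rev_path (eq_path (e' := @adj T)); last first.
  by move=> ? ?; exact: adj_sym.
move=> /(_ vp); case: p vp => [|z p] _ //=.
by rewrite rev_cons last_rcons.
Qed.

Lemma dist_triangle y x z : dist x z <= dist x y + dist y z.
Proof.
have [p [xp <- <-]] := dist_path x y; have [q [yq <- <-]] := dist_path (last x p) z.
by rewrite -size_cat -last_cat; apply: dist_le; rewrite cat_path xp.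
Qed.

Lemma dist_adj1 x y : adj x y -> dist x y <= 1.
Proof. by move=> xy; apply: (@dist_le x [:: y]); rewrite /= xy. Qed.

Lemma dist_adj x s t : adj s t -> dist x t <= (dist x s).+1.
Proof. by move=> /dist_adj1 st; have := dist_triangle s x t; lia. Qed.

Lemma dist_closer x y : x != y ->
  exists2 z, adj z y & dist x y = (dist x z).+1.
Proof.
rewrite eq_sym => xy; have [p []] := dist_path y x.
case: p => [_ /= yx|z p /= /andP[yz zp] lx sp]; first by rewrite yx eqxx in xy.
have zy : adj z y by rewrite adj_sym.
exists z => //; have := dist_le zp; rewrite lx.
by have := dist_adj x zy; rewrite ![dist x _]distC -sp /=; lia.
Qed.

Lemma geodesic_minimal x y p :
  path (@adj T) x p -> last x p = y -> size p = dist x y -> minimal_path x y p.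
Proof. by move=> xp l sp; split=> // q xq lq; rewrite sp -lq dist_le. Qed.

(** A shortest path to [src e] through [tgt e] would make the target strictly closer. Only
    connectedness is used, so that the lemma is available while the graph is still being shown to be
    a tree. *)
Lemma side_of_le v e : dist v (src e) <= dist v (tgt e) -> v \in side e.
Proof.
move=> le; rewrite inE; apply/asboolP.
have [p [vp l sp]] := dist_path v (src e); exists p.
  exact: geodesic_minimal.
apply/negP; rewrite inE => /orP[/eqP tv|tp].
  move: le; rewrite tv distxx leqn0 dist_eq0 => /eqP sv.
  by have := valP e; rewrite /= -/(src e) -/(tgt e) tv -sv adj_irrefl.
case/splitPr: tp => p1 p2 in vp l sp.
move: vp l sp; rewrite cat_path last_cat size_cat /=.
case/and3P => vp1 l1 p2p l2 sz.
have /dist_le : path (@adj T) v (rcons p1 (tgt e)) by rewrite rcons_path vp1.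
rewrite last_rcons size_rcons => le1.
have ne : p2 != [::].
  apply: contraTneq (valP e) => p20; move: l2; rewrite p20 /= => l2.
  by rewrite -/(src e) -/(tgt e) -l2 adj_irrefl.
by case: p2 ne {p2p l2} sz => //= ? ? _; lia.
Qed.

Definition even_from x : Prop := forall s t, adj s t -> dist x s <> dist x t.

Definition unique_parents x : Prop := forall u a b,
  adj a u -> adj b u -> dist x a < dist x u -> dist x b < dist x u -> a = b.

(** The parity of the distance to [x] is a 2-colouring, so the parity of the length of a walk
    depends only on its ends. The two ends of an edge are then at distances of different parity from
    every vertex. *)
Lemma even_from_all x y : even_from x -> even_from y.
Proof.
move=> ex s t st; have step a b : adj a b -> odd (dist x b) = ~~ odd (dist x a).
  move=> ab; have := ex a b ab; have := dist_adj x ab.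
  have := @dist_adj x b a; rewrite adj_sym => /(_ ab).
  move=> le1 le2 /eqP; rewrite neq_ltn => /orP[] lt.
    by have -> : dist x b = (dist x a).+1 by lia.
  have -> : dist x a = (dist x b).+1 by lia.
  by rewrite /= negbK.
have parity p z : path (@adj T) z p ->
    odd (size p) = odd (dist x z) (+) odd (dist x (last z p)).
  elim: p z => [z _|b p IHp z /= /andP[zb /IHp ->]] /=; first by rewrite addbb.
  by rewrite (step _ _ zb); do 2!case: odd.
move=> eqd; have [p [/parity po pl ps]] := dist_path y s.
have [q [/parity qo ql qs]] := dist_path y t.
move: po qo; rewrite ps qs eqd => ->; rewrite pl ql (step _ _ st).
by do 2!case: odd.
Qed.

(** The root is moved along one edge, which changes every distance by exactly one. The neighbours
    closer to [y] are those closer to [x], except at [x] itself, whose only neighbour closer to [y]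
    is [y]. *)
Lemma unique_parents_adj x y :
  even_from x -> adj x y -> unique_parents x -> unique_parents y.
Proof.
move=> ex xy upx; have ey := @even_from_all x y ex.
have close p q : adj p q -> dist y p < dist y q -> dist y q = (dist y p).+1.
  by move=> /(dist_adj y); lia.
have dxy z : dist x z = (dist y z).+1 \/ dist y z = (dist x z).+1.
  have := @even_from_all x z ex x y xy; have := @dist_adj z x y xy.
  have := @dist_adj z y x; rewrite adj_sym => /(_ xy).
  by rewrite ![dist z _]distC; lia.
(* An edge along which the two distances vary in opposite directions must end at [x]: otherwise the
   neighbour [c] of [a] toward [y] is, like [u], a parent of [a] seen from [x], hence equals [u],
   which is farther from [y] than [a]. *)
have side_parent a u : adj a u -> dist y a < dist y u ->
    dist x u < dist x a -> u = x.
  move=> au lt ltx; apply/eqP/negPn/negP => ux.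
  have eqx : dist x a = (dist x u).+1 by have := dist_adj x au; have := @dist_adj x u a;
    rewrite adj_sym => /(_ au); lia.
  have [] := dxy a; have [] := dxy u; have := close _ _ au lt; try lia.
  move=> e1 e2 e3.
  have [ya|nya] := eqVneq y a.
    have : dist x u == 0.
      by have := dist_adj1 xy; rewrite ya; lia.
    by rewrite dist_eq0 eq_sym (negPf ux).
  have [c ca dc] := dist_closer nya.
  have : c = u.
    apply: (upx a c u ca); [by rewrite adj_sym | | by lia].
    by have [] := dxy c; lia.
  by move=> cu; rewrite cu in dc; lia.
move=> u a b au bu lta ltb.
have [xu|nxu] := eqVneq u x.
  have dyx : dist y u <= 1 by rewrite xu distC dist_adj1.
  have [/eqP da /eqP db] : dist y a = 0 /\ dist y b = 0 by lia.
  by move: da db; rewrite !dist_eq0 => /eqP<- /eqP.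
apply: (upx u) => //.
  rewrite ltnNge leq_eqVlt; apply/negP => /orP[/eqP/esym|/side_parent xx].
    exact: ex.
  by move: nxu; rewrite xx ?eqxx.
rewrite ltnNge leq_eqVlt; apply/negP => /orP[/eqP/esym|/side_parent xx].
  exact: ex.
by move: nxu; rewrite xx ?eqxx.
Qed.

Lemma unique_parents_all x y :
  even_from x -> unique_parents x -> unique_parents y.
Proof.
move=> ex upx; have [p [xp <- _]] := dist_path x y.
elim: p x ex upx xp => //= z p IHp x ex upx /andP[xz zp].
by apply: IHp zp; [exact: even_from_all ex | exact: unique_parents_adj xz upx].
Qed.

End Distance.

Definition is_tree (T : graph) : Prop :=
  [/\ connected T, forall x : T, even_from x & forall x : T, unique_parents x].

Section Tree.
Local Open Scope nat_scope.
Variable T : graph.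
Hypothesis treeT : is_tree T.
Implicit Types (x y z u v s t a b : T) (e : arrow T) (o : T * T).

Let conn : connected T. Proof. by case: treeT. Qed.

Lemma arrow_adj e : adj (src e) (tgt e). Proof. exact: valP e. Qed.

Lemma arrow_ext e e' : src e = src e' -> tgt e = tgt e' -> e = e'.
Proof.
move=> es et; apply/val_inj; move: es et; rewrite /src /tgt.
by case: (val e) (val e') => ? ? [? ?] /= -> ->.
Qed.

Lemma rev_arrowK : involutive (@rev_arrow T).
Proof. by move=> e; apply: arrow_ext. Qed.

Lemma dist_step x s t : adj s t ->
  dist x t = (dist x s).+1 \/ dist x s = (dist x t).+1.
Proof.
move=> st; case: treeT => _ /(_ x s t st) ne _; have := dist_adj conn x st.
by rewrite adj_sym in st; have := dist_adj conn x st; lia.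
Qed.

Lemma dist_arrow x e :
  dist x (tgt e) = (dist x (src e)).+1 \/ dist x (src e) = (dist x (tgt e)).+1.
Proof. exact: dist_step (arrow_adj e). Qed.

Lemma parent_uniq x u a b :
  adj a u -> adj b u -> dist x a < dist x u -> dist x b < dist x u -> a = b.
Proof. by case: treeT => _ _; apply. Qed.

(** This trades paths for distances once and for all. If [tgt e] is closer to [v], it is the unique
    parent of [src e], so every shortest path to [src e] enters through it. *)
Lemma mem_side v e : (v \in side e) = (dist v (src e) < dist v (tgt e)).
Proof.
apply/idP/idP => [|/ltnW/side_of_le->//].
rewrite inE => /asboolP[p [vp l m]] tp.
have [->//|lt] := dist_arrow v e.
have sp : size p = dist v (src e).
  apply/eqP; rewrite eqn_leq -{2}l dist_le // andbT.
  by have [q [vq ql <-]] := dist_path conn v (src e); apply: m.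
case/lastP: p => [|p c] in vp l m tp sp *; first by rewrite /= in sp; lia.
rewrite last_rcons in l; subst c; move: vp; rewrite rcons_path => /andP[vp ap].
have le := dist_le vp; rewrite size_rcons in sp.
suff lt' : last v p = tgt e by move: tp; rewrite -lt' -rcons_cons mem_rcons in_cons
  mem_last orbT.
apply: (@parent_uniq v (src e)) => //; last by lia.
- by rewrite adj_sym arrow_adj.
- by lia.
Qed.

Lemma src_rev e : src (rev_arrow e) = tgt e. Proof. by []. Qed.
Lemma tgt_rev e : tgt (rev_arrow e) = src e. Proof. by []. Qed.

Lemma side_rev v e : (v \in side (rev_arrow e)) = (v \notin side e).
Proof. by rewrite !mem_side src_rev tgt_rev; have := dist_arrow v e; lia. Qed.

Lemma src_side e : src e \in side e.
Proof. by have := dist_arrow (src e) e; rewrite mem_side distxx //; lia. Qed.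

Lemma tgt_side e : tgt e \notin side e.
Proof. by rewrite -side_rev; exact: src_side. Qed.

(** Every edge of a tree is a bridge. If the sources differed, the neighbour of [src e'] toward
    [src e] and [tgt e'] would both be parents of [src e'] seen from [tgt e]. *)
Lemma cross_arrow e e' : src e' \in side e -> tgt e' \notin side e -> e' = e.
Proof.
rewrite -side_rev !mem_side src_rev tgt_rev => s't t't.
have := dist_arrow (src e') e; have := dist_arrow (tgt e') e.
have := dist_adj conn (src e) (arrow_adj e').
have := dist_adj conn (tgt e) (arrow_adj (rev_arrow e')).
rewrite src_rev tgt_rev ![dist (src e) _]distC // ![dist (tgt e) _]distC // => h1 h2 h3 h4.
have [n0|nz] := eqVneq (src e) (src e').
  apply: arrow_ext => //; apply/eqP; rewrite -dist_eq0 //.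
  by move: h1 h2 h3 h4 s't t't; rewrite n0 distxx //; lia.
have [c ca dc] := dist_closer conn nz.
have eqc : c = tgt e'.
  have := dist_adj conn (tgt e) ca; have := dist_triangle conn (src e) (tgt e) c.
  have := dist_adj1 (arrow_adj e); rewrite [dist (src e) (tgt e)]distC // => d1 d2 d3.
  apply: (@parent_uniq (tgt e) (src e')) => //.
  - by rewrite adj_sym arrow_adj.
  - by move: dc; rewrite ![dist _ (src e')]distC // ![dist _ c]distC // in d2 d3 *; lia.
  - by rewrite ![dist (tgt e) _]distC //; lia.
by move: dc; rewrite eqc ![dist (src e) _]distC //; lia.
Qed.

(** A shortest path from [x] to [v] must leave [side e], and by [cross_arrow] it can do so only
    along [e]. *)
Lemma gate x v e : x \in side e -> v \notin side e ->
  dist x v = dist x (src e) + (dist (tgt e) v).+1.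
Proof.
move=> xe ve; apply/eqP; rewrite eqn_leq; apply/andP; split.
  have := dist_triangle conn (src e) x v; have := dist_triangle conn (tgt e) (src e) v.
  by have := dist_adj1 (arrow_adj e); lia.
have [p [xp pv <-]] := dist_path conn x v.
elim: p x xe xp pv => [|y p IHp] x xe /=; first by move=> _ xv; rewrite -xv xe in ve.
case/andP=> xy yp pv; have [ye|ye] := boolP (y \in side e).
  have := IHp y ye yp pv; have := dist_triangle conn y x (src e).
  by have := dist_adj1 xy; lia.
have exy : exist _ (x, y) xy = e by exact: cross_arrow.
rewrite -exy /src /tgt /= distxx //.
by have := dist_le yp; rewrite pv; lia.
Qed.

(* A pair [(v, v)] stands for the vertex [v] and a pair of adjacent vertices for
   the midpoint of the edge; [del] is then twice the distance, and [mask o v x]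
   says that [o] lies on the geodesic from [x] to [v]. *)
Definition point o := (o.1 == o.2) || adj o.1 o.2.
Definition del o v := dist o.1 v + dist o.2 v.
Definition inside o e := (o.1 \in side e) && (o.2 \in side e).
Definition mask o v x := (dist x v).*2 == del o x + del o v.

Lemma del_triangle o x v : (dist x v).*2 <= del o x + del o v.
Proof.
have := dist_triangle conn o.1 x v; have := dist_triangle conn o.2 x v.
by rewrite /del ![dist x _.1]distC // ![dist x _.2]distC //; lia.
Qed.

Lemma inside_del o e : inside o e = (del o (tgt e) == (del o (src e)).+2).
Proof.
rewrite /inside /del !mem_side.
by have := dist_arrow o.1 e; have := dist_arrow o.2 e; lia.
Qed.

Lemma del_arrow o e : del o (tgt e) <= (del o (src e)).+2.
Proof.
by rewrite /del; have := dist_arrow o.1 e; have := dist_arrow o.2 e; lia.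
Qed.

(** Extending a geodesic from [x] through [o] across [e] adds two to both sides of the equation
    defining [mask]; the triangle inequality gives the converse. In matrix form this says that
    masked rows commute with the maps of the representation. *)
Lemma mask_inside o e x :
  mask o (src e) x && (x \in side e) = inside o e && mask o (tgt e) x.
Proof.
rewrite /mask inside_del mem_side; have := del_arrow o e.
by have := del_triangle o x (src e); have := del_triangle o x (tgt e);
  have := dist_arrow x e; lia.
Qed.

Lemma mask_vertex v x : mask (v, v) v x.
Proof. by rewrite /mask /del /= distxx // [dist v x]distC //; lia. Qed.

Lemma inside_vertex v e : inside (v, v) e = (v \in side e).
Proof. by rewrite /inside andbb. Qed.

Lemma outside_exists o s : o != (s, s) -> exists2 e, src e = s & ~~ inside o e.
Proof.
move=> os; have [p po ps] : exists2 p, p = o.1 \/ p = o.2 & p != s.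
  case: o os => a b /=; rewrite xpair_eqE negb_and => /orP[]; [exists a|exists b]; tauto.
have [c ca dc] := dist_closer conn ps; rewrite adj_sym in ca.
pose e : arrow T := exist _ (s, c) ca; exists e => //; rewrite /inside.
have : p \notin side e by rewrite mem_side /src /tgt /=; lia.
by case: po => <- /negPf->; rewrite ?andbF.
Qed.

(** If an end of [o] lies beyond [e], then [tgt e] is the unique parent of [src e] seen from that
    end. A midpoint has two ends, which need not lie beyond the same arrow a priori. *)
Lemma outside_uniq o e e' : point o -> src e = src e' ->
  ~~ inside o e -> ~~ inside o e' -> e = e'.
Proof.
move=> po es; have closer p (f : arrow T) : p \notin side f -> dist p (tgt f) < dist p
  (src f).
  by rewrite mem_side; have := dist_arrow p f; lia.
have key p (f f' : arrow T) : src f = src f' -> p \notin side f -> p \notin side f' -> f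
  = f'.
  move=> fs /closer lt /closer lt'; apply: arrow_ext => //.
  apply: (@parent_uniq p (src f')) => //; rewrite -?fs //.
    by rewrite adj_sym arrow_adj.
  by rewrite fs adj_sym arrow_adj.
(* Of two adjacent vertices, the one that is not nearer to the common source lies beyond both
   arrows. *)
have key2 p q (f f' : arrow T) : adj p q -> src f = src f' ->
    p \notin side f -> q \notin side f' -> f = f'.
  move=> pq fs pf qf.
  have [lt|lt] := leqP (dist p (src f)) (dist q (src f)).
    apply: (key q) => //; rewrite mem_side -leqNgt.
    have := closer _ _ pf; have := dist_triangle conn p q (tgt f).
    by have := dist_adj1 pq; rewrite (distC conn p q); lia.
  apply: (key p) => //; rewrite mem_side -leqNgt -fs.
  have := closer _ _ qf; have := dist_triangle conn q p (tgt f'); rewrite -fs.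
  by have := dist_adj1 pq; lia.
rewrite !negb_and => /orP[] o1 /orP[] o2.
- exact: key o1 o2.
- by case/orP: po => [/eqP po|po]; [rewrite -po in o2;
  exact: key o1 o2 | exact: key2 po es o1 o2].
- rewrite /point adj_sym in po; case/orP: po => [/eqP po|po].
    by rewrite po in o2; exact: key o1 o2.
  by apply: key2 po es o1 o2; rewrite adj_sym.
- exact: key o1 o2.
Qed.

Lemma outside_count o s : point o ->
  \sum_(e | src e == s) ~~ inside o e = (o != (s, s)).
Proof.
move=> po; have [->|os] := eqVneq o (s, s).
  by apply: big1 => e /eqP<-; rewrite inside_vertex src_side.
have [e es eo] := outside_exists os.
rewrite (bigD1 e) /=; last by rewrite es.
rewrite eo big1 // => e' /andP[/eqP e's]; apply: contraNeq; rewrite eqb0 negbK => eo'.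
by apply/eqP; apply: outside_uniq po _ _ eo; rewrite ?e's.
Qed.

Lemma inside_rev o e : inside o e -> ~~ inside o (rev_arrow e).
Proof. by rewrite /inside !side_rev => /andP[-> _]. Qed.

Lemma midpoint_outside o e : point o ->
  (~~ inside o e && ~~ inside o (rev_arrow e)) =
  (o == (src e, tgt e)) || (o == (tgt e, src e)).
Proof.
case: o => a b po; rewrite /inside !side_rev /=; apply/idP/idP; last first.
  by case/orP=> /eqP[-> ->]; rewrite src_side (negPf (tgt_side _)).
have [ae|ae] := boolP (a \in side e); have [be|be] := boolP (b \in side e) => // _.
  case/orP: po => [/eqP /= ab|ab]; first by rewrite -ab ae in be.
  have <- : exist _ (a, b) ab = e by exact: cross_arrow.
  by rewrite eqxx.
case/orP: po => [/eqP /= ab|]; first by rewrite ab be in ae.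
rewrite adj_sym => ab.
have <- : exist _ (b, a) ab = e by exact: cross_arrow.
by rewrite eqxx orbT.
Qed.

End Tree.

(** * Counting generators on a tree and matching them with coordinates *)

Section Fibers.
Local Open Scope nat_scope.

Lemma card_sigma_ord (G : finType) (c : G -> nat) :
  #|{: {x : G & 'I_(c x)}}| = \sum_x c x.
Proof.
by rewrite card_tagged sumnE big_map big_enum /=; apply: eq_bigr => x _; rewrite card_ord.
Qed.

Lemma exists_fibers (G : finType) (c : G -> nat) n : \sum_x c x = n ->
  exists g : 'I_n -> {x : G & 'I_(c x)}, bijective g.
Proof.
move=> cn; have cardG : n = #|{: {x : G & 'I_(c x)}}| by rewrite card_sigma_ord.
exists (fun i => enum_val (cast_ord cardG i)).
exists (fun x => cast_ord (esym cardG) (enum_rank x)) => x.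
  by rewrite enum_valK cast_ordK.
by rewrite cast_ordKV enum_rankK.
Qed.

Lemma fibers_card (G : finType) (c : G -> nat) n (g : 'I_n -> {x : G & 'I_(c x)}) :
  bijective g -> forall x, \sum_i (tag (g i) == x) = c x.
Proof.
move=> [h gK hK] x; rewrite (reindex h) /=; last by exists g => ? _; rewrite (gK, hK).
under eq_bigr do rewrite hK.
have -> : \sum_p (@tag _ (fun y => 'I_(c y)) p == x) = \sum_y \sum_(i : 'I_(c y)) (y == x).
  rewrite [RHS](@sig_big_dep _ _ _ _ (fun y => 'I_(c y)) predT (fun _ => predT) (fun y i
    => nat_of_bool (y == x))) /=.
  by [].
rewrite (bigD1 x) //= eqxx sum_nat_const card_ord muln1 big1 ?addn0 // => y /negPf yx.
by rewrite big1 // yx.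
Qed.

Lemma fibers_perm (G : finType) n (o o' : 'I_n -> G) :
  (forall x, \sum_i (o i == x) = \sum_i (o' i == x)) ->
  exists s : {perm 'I_n}, forall i, o i = o' (s i).
Proof.
move=> oo'; have : perm_eq [tuple o i | i < n] [tuple o' i | i < n].
  apply/allP => x _; rewrite /= !count_map -!sum1_count -!enumT !big_enum_cond /=.
  have fibE (f : 'I_n -> G) : \sum_(i | f i == x) 1 = \sum_i (f i == x).
    by rewrite big_mkcond; apply: eq_bigr => i _; case: eqP.
  by apply/eqP; rewrite !fibE.
case/tuple_permP => s E; exists s => i.
have := congr1 (fun t : seq G => nth (o i) t i) E.
by rewrite -!tnth_nth !tnth_mktuple.
Qed.
End Fibers.

Section Counting.
Local Open Scope nat_scope.
Variable T : graph.
Hypothesis treeT : is_tree T.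
Implicit Types (u v s t : T) (e : arrow T).

Let conn : connected T. Proof. by case: treeT. Qed.

(** An antisymmetric flow without divergence on a tree is zero: summing the divergences over
    [side e] cancels each arrow inside the side against its reverse, and [e] is the only arrow
    leaving it. *)
Lemma flow_eq0 (D : arrow T -> int) :
  (forall e, D e + D (rev_arrow e) = 0)%R ->
  (forall v, \sum_(e | src e == v) D e = 0)%R -> forall e, D e = 0%R.
Proof.
move=> Drev Ddiv e.
have : (\sum_(v in side e) \sum_(f | src f == v) D f = 0)%R by rewrite big1.
rewrite (exchange_big_dep (fun f => src f \in side e)) /=; last first.
  by move=> v f ve /eqP ->.
rewrite (eq_bigr (fun f => D f)); last first.
  move=> f fe; rewrite (big_pred1 (src f)) // => v /=; rewrite [src f == v]eq_sym.
  by case: eqP => [->|_]; rewrite ?fe ?andbF.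
rewrite (bigID (fun f => tgt f \in side e)) /= [X in (_ + X)%R](big_pred1 e); last first.
  move=> f; apply/idP/eqP => [/andP[sf tf]|->];
    last by rewrite src_side // (negPf (tgt_side _ _)).
  by apply: cross_arrow.
set S := (X in (X + _)%R); suff -> : S = 0%R by rewrite add0r.
have SN : S = (- S)%R.
  rewrite {2}/S -sumrN /S (reindex_inj (inv_inj (@rev_arrowK T))) /=.
  apply: eq_big => [f|f _]; first by rewrite src_rev tgt_rev andbC.
  by apply/eqP; rewrite -addr_eq0 addrC Drev.
by move: SN; lia.
Qed.

Definition inside_count r (o : 'I_r -> T * T) e := \sum_i inside (o i) e.

Lemma inside_count_le r (o : 'I_r -> T * T) e : inside_count o e <= r.
Proof.
rewrite -[leqRHS]card_ord -sum1_card; apply: leq_sum => i _; exact: leq_b1.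
Qed.

Lemma outside_countE r (o : 'I_r -> T * T) e :
  r - inside_count o e = \sum_i ~~ inside (o i) e.
Proof.
suff : inside_count o e + \sum_i ~~ inside (o i) e = r by lia.
rewrite -big_split /= -[RHS]card_ord -sum1_card; apply: eq_bigr => i _.
by case: inside.
Qed.

Lemma inside_count_balance r (o : 'I_r -> T * T) v : (forall i, point (o i)) ->
  \sum_(e | src e == v) (r - inside_count o e) + \sum_i (o i == (v, v)) = r.
Proof.
move=> po; under eq_bigr do rewrite outside_countE.
rewrite exchange_big /= -big_split /= -[RHS]card_ord -sum1_card.
by apply: eq_bigr => i _; rewrite outside_count //; case: eqP.
Qed.

Lemma inside_count_rev r (o : 'I_r -> T * T) e : (forall i, point (o i)) ->
  inside_count o e + inside_count o (rev_arrow e) +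
  (\sum_i (o i == (src e, tgt e)) + \sum_i (o i == (tgt e, src e))) = r.
Proof.
move=> po; rewrite -!big_split /= -[RHS]card_ord -sum1_card; apply: eq_bigr => i _.
have := midpoint_outside treeT e (po i); have := @inside_rev _ treeT (o i) e.
have : ~~ ((o i == (src e, tgt e)) && (o i == (tgt e, src e))).
  apply/negP => /andP[/eqP-> /eqP[st _]].
  by have := arrow_adj e; rewrite st adj_irrefl.
by case: (inside _ e); case: (inside _ _); case: (o i == _);
  case: (o i == _) => //= _ // /(_ isT).
Qed.

Lemma inside_count_vertices r (o : 'I_r -> T * T) rr :
  (forall i, (o i).1 = (o i).2) -> (forall v, \sum_i (o i == (v, v)) = rr v) ->
  forall e, inside_count o e = \sum_(v in side e) rr v.
Proof.
move=> ov orr e; under [RHS]eq_bigr do rewrite -orr.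
rewrite exchange_big; apply: eq_bigr => i _ /=.
have -> : o i = ((o i).1, (o i).1) by rewrite {2}ov -surjective_pairing.
rewrite inside_vertex; set x := (o i).1.
have [xe|xe] := boolP (x \in side e); last first.
  by rewrite big1 // => v ve; rewrite xpair_eqE andbb; case: eqP => // xv;
    rewrite xv ve in xe.
rewrite (bigD1 x) //= eqxx big1 // => v /andP[_ /negPf vx].
by rewrite xpair_eqE andbb eq_sym vx.
Qed.

(** For a fixed [v], every other vertex has exactly one arrow leading toward [v], and reversal
    matches these arrows with those leading away. *)
Lemma card_arrow : #|{: arrow T}| + 2 = 2 * #|T| \/ #|T| = 0.
Proof.
have [v _|T0] := pickP (predT : pred T); last by right; apply: eq_card0.
left.
have E : \sum_e (v \notin side e) + 1 = #|T|.
  rewrite (partition_big (@src T) predT) //=.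
  under eq_bigr => s _.
    under eq_bigr do rewrite -inside_vertex.
    rewrite outside_count //; last by rewrite /point eqxx.
    rewrite xpair_eqE andbb; over.
  rewrite -sum1_card [RHS](bigD1 v) //= addnC; congr (_ + _).
  rewrite (bigD1 v) //= eqxx add0n; apply: eq_bigr => s /negPf vs.
  by rewrite eq_sym vs.
have E' : \sum_(e : arrow T) (v \in side e) = \sum_(e : arrow T) (v \notin side e).
  rewrite (reindex_inj (inv_inj (@rev_arrowK T))) /=; apply: eq_bigr => e _.
  by rewrite side_rev.
have : \sum_(e : arrow T) (v \in side e) + \sum_(e : arrow T) (v \notin side e) = #|{:
  arrow T}|.
  rewrite -big_split -sum1_card; apply: eq_bigr => e _ /=; by case: (_ \in _).
by move=> <-; rewrite -E E' mulnDr mul2n -addnn.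
Qed.

Section Multiplicities.
Variables (r : nat) (D : arrow T -> nat).
Hypothesis Drev : forall e, D e + D (rev_arrow e) <= r.
Hypothesis Ddiv : forall v, \sum_(e | src e == v) (r - D e) <= r.

Definition canonical_arrow e := (enum_rank (src e) < enum_rank (tgt e))%N.

Lemma canonical_rev e : canonical_arrow (rev_arrow e) = ~~ canonical_arrow e.
Proof.
rewrite /canonical_arrow src_rev tgt_rev; case: ltngtP => // /ord_inj/enum_rank_inj st.
by have := arrow_adj e; rewrite st adj_irrefl.
Qed.

(* An edge with slack is recorded at its canonical orientation only. *)
Definition multiplicity (o : T * T) : nat :=
  if o.1 == o.2 then r - \sum_(e | src e == o.1) (r - D e)
  else if [pick e : arrow T | val e == o] is Some e then
    if canonical_arrow e then r - D e - D (rev_arrow e) else 0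
  else 0.

Lemma multiplicity_vertex v :
  multiplicity (v, v) = r - \sum_(e | src e == v) (r - D e).
Proof. by rewrite /multiplicity eqxx. Qed.

Lemma multiplicity_arrow e : multiplicity (src e, tgt e) =
  if canonical_arrow e then r - D e - D (rev_arrow e) else 0.
Proof.
rewrite /multiplicity /=; case: eqP => [st|_].
  by have := arrow_adj e; rewrite st adj_irrefl.
case: pickP => [f /eqP ef|/(_ e)/eqP[]]; last exact: surjective_pairing.
have -> // : f = e by apply/val_inj; move: ef => /= ->; rewrite -surjective_pairing.
Qed.

Lemma multiplicity_point o : multiplicity o != 0 -> point o.
Proof.
rewrite /multiplicity /point; case: ifP => //= _; case: pickP => // e /eqP <- _.
exact: arrow_adj.
Qed.

(** An Euler characteristic. With [V] vertices and [E] edges, the vertices contribute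
    [r V - 2 r E + sum D] and the edges [r E - sum D]; what remains is [r (V - E) = r]. *)
Lemma sum_multiplicity : 0 < #|T| -> \sum_o multiplicity o = r.
Proof.
move=> T0; have Dle e : D e <= r by have := Drev e; lia.
have -> : \sum_o multiplicity o =
    \sum_v multiplicity (v, v) + \sum_e multiplicity (src e, tgt e).
  rewrite (bigID (fun o : T * T => o.1 == o.2)) /=; congr (_ + _).
    rewrite (reindex_onto (fun v => (v, v)) (@fst T T)) /=; last by case=> a b /eqP /= ->.
    by apply: eq_bigl => v; rewrite !eqxx.
  rewrite (bigID (fun o : T * T => adj o.1 o.2)) /= addnC big1 ?add0n; last first.
    case=> a b /= /andP[ab nab]; apply/eqP; apply: contraNT nab => /multiplicity_point.
    by rewrite /point /= (negPf ab).
  rewrite (eq_bigl (fun o : T * T => adj o.1 o.2)); last first.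
    case=> a b /=; case: eqP => [->|//]; by rewrite adj_irrefl.
  rewrite (reindex_omap (val : arrow T -> T * T) insub) /=; last first.
    by move=> p ap; rewrite insubT.
  apply: eq_big => [e|e _]; last by congr multiplicity; exact: surjective_pairing.
  by case: e => p ap; rewrite /= insubT ap /= eqxx.
have half : 2 * \sum_e multiplicity (src e, tgt e) = \sum_e (r - D e - D (rev_arrow e)).
  rewrite mul2n -addnn {2}(reindex_inj (inv_inj (@rev_arrowK T))) /= -big_split /=.
  apply: eq_bigr => e _; rewrite !multiplicity_arrow canonical_rev rev_arrowK.
  by case: canonical_arrow => /=; rewrite ?addn0 ?add0n // subnAC.
have sA : \sum_v multiplicity (v, v) + \sum_e (r - D e) = r * #|T|.
  rewrite [X in _ + X](partition_big (@src T) predT) //= -big_split /= mulnC -sum_nat_const.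
  by apply: eq_bigr => v _; rewrite multiplicity_vertex subnK.
have sB : \sum_e (r - D e) + \sum_e D e = r * #|{: arrow T}|.
  rewrite -big_split /= mulnC -sum_nat_const.
  by apply: eq_bigr => e _; rewrite subnK.
have sC : \sum_e (r - D e - D (rev_arrow e)) + (\sum_e D e + \sum_e D e) = r * #|{: arrow
  T}|.
  rewrite [X in _ + (_ + X)](reindex_inj (inv_inj (@rev_arrowK T))) -!big_split /= mulnC
    -sum_nat_const.
  by apply: eq_bigr => e _; have := Drev e; lia.
have [cA|] := card_arrow; last by lia.
have : r * (#|{: arrow T}| + 2) = r * (2 * #|T|) by rewrite cA.
by rewrite mulnDr mulnCA; lia.
Qed.

(** The difference between the two counts is a flow: the multiplicities of the midpoints make it
    antisymmetric, those of the vertices make it divergence-free, and [flow_eq0] applies. *)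
Lemma inside_count_multiplicity (o : 'I_r -> T * T) : (forall i, point (o i)) ->
  (forall p, \sum_i (o i == p) = multiplicity p) -> forall e, inside_count o e = D e.
Proof.
move=> po oc; have Dle e : D e <= r by have := Drev e; lia.
suff H : forall e, ((inside_count o e)%:Z - (D e)%:Z = 0)%R by move=> e; have := H e; lia.
apply: flow_eq0 => [e|v].
  have := inside_count_rev e po; rewrite !oc -[(tgt e, src e)]/(src (rev_arrow e), tgt
    (rev_arrow e)).
  rewrite !multiplicity_arrow canonical_rev rev_arrowK; have := Drev e.
  by case: canonical_arrow => /=; lia.
have := inside_count_balance v po; rewrite oc multiplicity_vertex => E.
have {}E : \sum_(e | src e == v) (r - inside_count o e) = \sum_(e | src e == v) (r - D e).
  by have := Ddiv v; lia.
have -> : (\sum_(e | src e == v) ((inside_count o e)%:Z - (D e)%:Z) =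
    \sum_(e | src e == v) (r - D e)%N%:Z - \sum_(e | src e == v) (r - inside_count o
      e)%N%:Z)%R.
  rewrite -sumrB; apply: eq_bigr => e _.
  by have := Dle e; have := inside_count_le o e; lia.
by rewrite -!(big_morph Posz PoszD (erefl 0%Z)) E subrr.
Qed.

End Multiplicities.

Section EdgePoints.
Variables (e : arrow T) (a b v : T).
Hypotheses (ae : (a == src e) || (a == tgt e)) (be : (b == src e) || (b == tgt e)).
Hypotheses (ab : (a == src e) || (b == src e)) (ve : v \notin side e).

Let ne : (tgt e == src e) = false.
Proof. by apply: contraTF (arrow_adj e) => /eqP->; rewrite adj_irrefl. Qed.

Let gv : dist (src e) v = (dist (tgt e) v).+1.
Proof. by rewrite (gate treeT (src_side treeT e) ve) distxx add0n. Qed.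

Lemma edge_del : (dist (tgt e) v).*2 < del (a, b) v.
Proof.
move: ae be ab; rewrite /del /=.
by case/orP=> /eqP-> /orP[] /eqP->; rewrite ?gv ?ne //; lia.
Qed.

(** The admissible pairs are the vertex [src e] and the midpoint of [e] in either order. Seen from
    beyond [e] they have the same mask, which is what allows a midpoint to be moved to the
    source. *)
Lemma edge_mask x : mask (a, b) v x = (x \in side e).
Proof.
rewrite /mask /del /=.
have : (if x \in side e then dist x v = dist x (src e) + (dist (tgt e) v).+1
       else dist x v <= dist x (tgt e) + dist (tgt e) v).
  by case: ifP => xe; [exact: gate | exact: dist_triangle].
have := dist_arrow treeT x e; rewrite (mem_side treeT).
move: ae be ab; rewrite !(distC conn _ x).
by case/orP=> /eqP-> /orP[] /eqP->; rewrite ?gv ?ne //; case: ifP; lia.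
Qed.

Lemma edge_outside : ~~ inside (a, b) (rev_arrow e).
Proof.
rewrite /inside !side_rev // -negb_or negbK /=.
by case/orP: ab => /eqP->; rewrite src_side ?orbT.
Qed.

End EdgePoints.

Lemma mask_midpoint o e v x : (o == (src e, tgt e)) || (o == (tgt e, src e)) ->
  mask o v x = ((v \in side e) != (x \in side e)).
Proof.
move=> oe; case: (boolP (v \in side e)) => ve.
  rewrite -[RHS](side_rev treeT); case/orP: oe => /eqP->;
    by apply: edge_mask; rewrite ?src_rev ?tgt_rev ?eqxx ?orbT // side_rev // ve.
by rewrite eq_sym eqbF_neg negbK; case/orP: oe => /eqP->;
  apply: edge_mask; rewrite ?eqxx ?orbT.
Qed.

Lemma mask_src e v x : v \notin side e ->
  mask (src e, src e) v x = (x \in side e).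
Proof. by move=> ve; apply: edge_mask; rewrite ?eqxx. Qed.

Lemma maskC v u x : mask (u, u) v x = mask (u, u) x v.
Proof. by rewrite /mask /del /= (distC conn x v); congr (_ == _); lia. Qed.

(** The arrow is the first one on the way from a vertex [o] to [v], or the edge of a midpoint
    oriented toward [v]. The strict inequality on distances is what [mask_laminar] consumes. *)
Lemma mask_side o v : point o -> o != (v, v) ->
  exists e, [/\ v \notin side e, ~~ inside o (rev_arrow e),
    (dist (tgt e) v).*2 < del o v & forall x, mask o v x = (x \in side e)].
Proof.
have edge e a b : (a == src e) || (a == tgt e) -> (b == src e) || (b == tgt e) ->
    (a == src e) || (b == src e) -> v \notin side e ->
    exists e, [/\ v \notin side e, ~~ inside (a, b) (rev_arrow e),
    (dist (tgt e) v).*2 < del (a, b) v & forall x, mask (a, b) v x = (x \in side e)].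
  move=> ae be ab ve; exists e.
  by split=> // [||x]; [exact: edge_outside | exact: edge_del | exact: edge_mask].
move=> po ov; case: o po ov => a b /orP[/= /eqP<-|/= ab ov].
  rewrite xpair_eqE andbb eq_sym => av; have [z za dz] := dist_closer conn av.
  rewrite adj_sym in za; pose e : arrow T := exist _ (a, z) za.
  by apply: (edge e); rewrite ?eqxx // mem_side // /src /tgt /= dz; lia.
pose e : arrow T := exist _ (a, b) ab.
have [ve|ve] := boolP (v \in side e).
  by apply: (edge (rev_arrow e)); rewrite ?src_rev ?tgt_rev ?side_rev ?negbK ?eqxx ?orbT.
by apply: (edge e); rewrite ?eqxx ?orbT.
Qed.

(** If both ends of [o] were beyond [e], a geodesic from [x] to [v] would cross [e] before meeting
    [o], and [o] could not be farther from [v] than [tgt e] is. *)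
Lemma mask_laminar o e v x : v \notin side e -> (dist (tgt e) v).*2 < del o v ->
  mask o v x -> x \in side e -> ~~ inside o (rev_arrow e).
Proof.
move=> ve lt /eqP mx xe; apply/negP; rewrite /inside !side_rev // => /andP[o1 o2].
have := gate treeT xe ve; have := gate treeT xe o1; have := gate treeT xe o2.
by move: mx lt; rewrite /del !(distC conn _ x) !(distC conn (tgt e)); lia.
Qed.

(** The generator [i0] nearest to [v] is matched last. If its mask [B], the coordinates of some
    [side e], were exhausted, laminarity would place all the users of [B] among the generators
    having an end in [side e]. There are at most as many of these as elements of [B], and [i0] is
    one of them, so a coordinate is left. *)
Lemma hall_mask r d (o : 'I_r -> T * T) (tg : 'I_d -> T) v :
  (forall i, point (o i)) -> r <= d ->
  (forall e, r - inside_count o (rev_arrow e) <= \sum_j (tg j \in side e)) ->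
  exists2 f : 'I_r -> 'I_d, injective f & forall i, mask (o i) v (tg (f i)).
Proof.
move=> po rd cap.
suff H n (S : {set 'I_r}) : #|S| = n -> exists2 f : 'I_r -> 'I_d,
    {in S &, injective f} & {in S, forall i, mask (o i) v (tg (f i))}.
  have [f fi fm] := H _ finset.setT erefl; exists f => [i j|i]; first exact: fi.
  exact: fm.
elim: n S => [|n IHn] S Sn.
  have S0 : S = finset.set0 by apply/eqP; rewrite -cards_eq0 Sn.
  have [i0 _|r0] := pickP (predT : pred 'I_r); last first.
    have r00 : r = 0 by have := eq_card0 r0; rewrite card_ord.
    by exists (fun i => widen_ord rd i) => i; rewrite S0 inE.
  by exists (fun i => widen_ord rd i) => i; rewrite S0 inE.
have [i1 i1S] : exists i, i \in S by apply/card_gt0P; rewrite Sn.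
case: (arg_minnP (fun i => del (o i) v) i1S) => i0 i0M min0; have i0S : i0 \in S := i0M.
have [|f fi fm] := IHn (S :\ i0); first by have := cardsD1 i0 S; rewrite i0S Sn => -[].
pose B := [set j | mask (o i0) v (tg j)]%SET.
suff [j jB jf] : exists2 j, j \in B & j \notin f @: (S :\ i0).
  exists (fun i => if i == i0 then j else f i).
    move=> a b aS bS /=; case: eqP => [->|/eqP ai]; case: eqP => [->|/eqP bi] // E.
    - by case/negP: jf; rewrite E imset_f // !inE bi.
    - by case/negP: jf; rewrite -E imset_f // !inE ai.
    - by apply: fi; rewrite // !inE ?ai ?bi.
  move=> a aS /=; case: eqP => [->|/eqP ai]; first by rewrite inE in jB.
  by apply: fm; rewrite !inE ai.
suff : ~~ (B \subset f @: (S :\ i0)) by case/subsetPn=> j; exists j.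
apply/negP => BS; have [oi|oi] := eqVneq (o i0) (v, v).
  have : #|B| <= #|S :\ i0| by apply: leq_trans (subset_leq_card BS) (leq_imset_card _ _).
  have -> : B = finset.setT by apply/setP => j; rewrite !inE oi mask_vertex.
  have cS : n < r by rewrite -Sn -[leqRHS]card_ord max_card.
  have := cardsD1 i0 S; rewrite i0S cardsT card_ord Sn add1n => -[<-].
  by move: rd cS; lia.
(* Away from [v] the mask is a side; at [v] itself, treated above, it consists of all [d]
   coordinates, of which fewer than [r] have been used. *)
have [e [ve oe de me]] := mask_side (po i0) oi.
pose W := [set i | ~~ inside (o i) (rev_arrow e)]%SET.
have : #|B| <= #|W :\ i0|.
  apply: leq_trans (leq_imset_card f _); apply: subset_leq_card.
  apply/fintype.subsetP => j jB; have /imsetP[i iS ji] := fintype.subsetP BS _ jB.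
  rewrite ji imset_f // !inE; move: (iS); rewrite !inE => /andP[-> iS'] /=.
  apply: (mask_laminar ve) (fm _ iS) _; first exact: leq_trans de (min0 _ iS').
  by rewrite -me -ji; rewrite inE in jB.
have := cardsD1 i0 W; rewrite inE oe add1n => cW.
suff : #|W| <= #|B| by lia.
have <- : r - inside_count o (rev_arrow e) = #|W|.
  by rewrite outside_countE -sum1dep_card [RHS]big_mkcond.
have <- : \sum_j (tg j \in side e) = #|B|.
  by rewrite -sum1dep_card [RHS]big_mkcond; apply: eq_bigr => j _; rewrite me.
exact: cap.
Qed.

End Counting.

(** * Coordinates and minors *)

Record coordinates (k : fieldType) (T : graph) (M : rep k T) (d : nat) := Coordinates {
  to_row : forall v, 'Hom(M v, 'rV[k]_d);
  of_row : forall v, 'Hom('rV[k]_d, M v);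
  to_rowK : forall v, cancel (to_row v) (of_row v);
  of_rowK : forall v, cancel (of_row v) (to_row v) }.

Section Model.
Variables (k : closedFieldType) (T : graph) (M : rep k T) (r d : nat).
Variable C : coordinates M d.
Let phi := to_row C.
Let psi := of_row C.
Let phiK v : cancel (phi v) (psi v). Proof. exact: to_rowK. Qed.
Let psiK v : cancel (psi v) (phi v). Proof. exact: of_rowK. Qed.
Implicit Types (v : T) (e : arrow T) (U : subtuple M).

Definition rowspan v m (X : 'M[k]_(m, d)) : {vspace M v} :=
  (linfun (psi v \o mulmxr X) @: fullv)%VS.

Lemma mem_rowspan v m (X : 'M_(m, d)) x :
  (x \in rowspan v X) = (to_row C v x <= X)%MS.
Proof.
apply/memv_imgP/submxP => [[u _ ->]|[u xu]]; exists u.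
- by rewrite lfunE /= psiK.
- exact: memvf.
- by rewrite lfunE /= -xu phiK.
Qed.

Lemma rowspan_sub v m1 m2 (X : 'M_(m1, d)) (Y : 'M_(m2, d)) :
  (rowspan v X <= rowspan v Y)%VS = (X <= Y)%MS.
Proof.
apply/subvP/row_subP => [XY i|XY x]; rewrite ?mem_rowspan.
  by have := XY (psi v (row i X)); rewrite !mem_rowspan psiK; apply; exact: row_sub.
by move=> xX; apply: submx_trans xX _; apply/row_subP.
Qed.

Lemma rowspan_eq v m1 m2 (X : 'M_(m1, d)) (Y : 'M_(m2, d)) :
  (X == Y)%MS -> rowspan v X = rowspan v Y.
Proof.
by case/andP => XY YX; apply/eqP; rewrite eqEsubv !rowspan_sub XY.
Qed.

Lemma dim_rowspan v m (X : 'M_(m, d)) : \dim (rowspan v X) = \rank X.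
Proof.
have -> : rowspan v X = rowspan v (row_base X).
  by apply: rowspan_eq; apply/eqmxP; apply: eqmx_sym; exact: eq_row_base.
rewrite limg_dim_eq ?dimvf /dim /= ?mul1n //.
apply/eqP; rewrite -subv0; apply/subvP => u; rewrite memv_cap memv_ker lfunE /= => /andP[_].
rewrite memv0 => /eqP/(congr1 (phi v)); rewrite psiK linear0 => uX.
by apply/eqP; apply: (row_free_inj (row_base_free X)); rewrite uX mul0mx.
Qed.

Definition rows_of U v : 'M[k]_(r, d) := \matrix_i phi v (vbasis (U v))`_i.

Lemma rowspan_rows_of U v : \dim (U v) = r -> rowspan v (rows_of U v) = U v.
Proof.
move=> Ur; apply/eqP; rewrite eqEsubv; apply/andP; split.
  apply/subvP => x; rewrite mem_rowspan => /submxP[u xu].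
  have -> : x = \sum_i u 0 i *: (vbasis (U v))`_i.
    apply: (can_inj (@phiK v)); rewrite xu mulmx_sum_row linear_sum.
    by apply: eq_bigr => i _; rewrite rowK linearZ.
  apply: memv_suml => i _; apply: memvZ; apply: vbasis_mem; apply: mem_nth.
  by rewrite size_tuple Ur.
rewrite -{1}(span_basis (vbasisP (U v))); apply/span_subvP => x.
case/(nthP 0) => i; rewrite size_tuple => ir <-; have ir' : (i < r)%N by rewrite -Ur.
rewrite mem_rowspan; have := row_sub (Ordinal ir') (rows_of U v).
by rewrite rowK.
Qed.

Lemma rows_of_free U v : \dim (U v) = r -> row_free (rows_of U v).
Proof. by move=> Ur; rewrite /row_free -(dim_rowspan v) rowspan_rows_of // Ur. Qed.

(* Change of coordinates at [v] from the model to the basis used by [frame]. *)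
Definition coord_mx v : 'M[k]_(d, \dim {:M v}) :=
  \matrix_(i, j) coord (vbasis {:M v}) j (psi v (delta_mx 0 i)).

Definition spans (X : T -> 'M[k]_(r, d)) U : Prop :=
  forall v, row_free (X v) /\ U v = rowspan v (X v).

Lemma spans_dim X U v : spans X U -> \dim (U v) = r.
Proof. by move=> /(_ v)[/eqP Xr ->]; rewrite dim_rowspan. Qed.

Lemma spans_rows_of U : (forall v, \dim (U v) = r) -> spans (rows_of U) U.
Proof. by move=> Ur v; rewrite rows_of_free // rowspan_rows_of. Qed.

(** The basis chosen by [vbasis] is not under control; it differs from the rows of [X v] by an
    invertible matrix, whose determinant only rescales the Pluecker coordinates at [v]. *)
Lemma frameE X U v : spans X U ->
  exists2 B, B \in unitmx & @frame k T M r U v = B *m X v *m coord_mx v.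
Proof.
move=> XU; have Ur := spans_dim v XU; have [Xf UX] := XU v.
have sub : (rows_of U v <= X v)%MS by rewrite -(rowspan_sub v) rowspan_rows_of // UX.
exists (rows_of U v *m pinvmx (X v)).
  rewrite -row_free_unit /row_free eqn_leq rank_leq_row /=.
  have /eqP {1}<- := rows_of_free Ur.
  by rewrite -{1}(mulmxKpV sub) mulmxA mxrankM_maxl.
rewrite mulmxKpV //; apply/matrixP => i j; rewrite !mxE.
rewrite -{1}(phiK (vbasis (U v))`_i) [X in psi v X]row_sum_delta !linear_sum /=.
by apply: eq_bigr => l _; rewrite !linearZ /= !mxE.
Qed.

Definition minors (X : T -> 'M[k]_(r, d)) (j : pindex M r) : k :=
  \det (colsub (tagged j) (X (tag j) *m coord_mx (tag j))).

Lemma pluckerE X U : spans X U ->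
  exists2 c : T -> k, forall v, c v != 0 &
  forall j : pindex M r, plucker U j = c (tag j) * minors X j.
Proof.
move=> XU; have /choice[B HB] v : exists B, B \in unitmx /\
    @frame k T M r U v = B *m X v *m coord_mx v.
  by have [B] := frameE v XU; exists B.
exists (fun v => \det (B v)) => [v|j].
  by have [Bu _] := HB v; rewrite -unitfE -[_ \is a _]/(_ \in unitmx).
have [_ E] := HB (tag j); rewrite /plucker E /minors -det_mulmx; congr (\det _).
by rewrite -mulmxA; apply/matrixP => a b; rewrite !mxE; apply: eq_bigr => l _; rewrite !mxE.
Qed.

Definition minor_eval (p : {mpoly k[#|{: pindex M r}|]}) X : k :=
  p.@[fun i => minors X (enum_val i)].

Lemma multihomogeneous_scale p (c : T -> k) (x : 'I_(#|{: pindex M r}|) -> k) :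
  multihomogeneous p -> exists m : T -> nat,
  p.@[fun i => c (tag (enum_val i)) * x i] = (\prod_v c v ^+ m v) * p.@[x].
Proof.
case=> deg pd; exists deg; rewrite !mevalE mulr_sumr.
rewrite big_seq [RHS]big_seq; apply: eq_bigr => m /pd md.
rewrite mulrCA; congr (_ * _).
under eq_bigr do rewrite exprMn.
rewrite big_split /=; congr (_ * _).
rewrite (partition_big (fun i => tag (enum_val i)) predT) //=.
apply: eq_bigr => v _; rewrite -(md v) expr_sum.
by apply: eq_bigr => i /eqP ->.
Qed.

(** Rescaling the coordinates at each vertex multiplies a multihomogeneous form by a nonzero factor,
    so its vanishing may be tested on any matrices spanning [U]. *)
Lemma plucker_vanish p X U : multihomogeneous p -> spans X U ->
  (p.@[fun i => plucker U (enum_val i)] = 0) <-> (minor_eval p X = 0).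
Proof.
move=> ph XU; have [c c0 pc] := pluckerE XU.
have [m E] := multihomogeneous_scale c (fun i => minors X (enum_val i)) ph.
have -> : p.@[fun i => plucker U (enum_val i)] =
          p.@[fun i => c (tag (enum_val i)) * minors X (enum_val i)].
  by apply: meval_eq => i; rewrite pc.
rewrite E /minor_eval; split=> [/eqP|->]; last by rewrite mulr0.
rewrite mulf_eq0 => /orP[|/eqP//].
by move/prodf_eq0 => [v _]; rewrite expf_eq0 (negPf (c0 v)) andbF.
Qed.

End Model.

(** * The Zariski topology *)

(** The Cauchy-Binet formula before its terms are grouped: the sum runs over all functions rather
    than over increasing ones, in agreement with the redundant indexing by [pindex]. *)
Lemma det_mulmx_sum (R : comNzRingType) m n (A : 'M[R]_(m, n)) (Q : 'M_(n, m)) :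
  \det (A *m Q) =
  \sum_(f : {ffun 'I_m -> 'I_n}) (\prod_i Q (f i) i) * \det (colsub f A).
Proof.
rewrite -[LHS]det_tr [LHS]/determinant.
under eq_bigr => s _.
  under eq_bigr do rewrite !mxE.
  rewrite bigA_distr_bigA mulr_sumr /=; over.
rewrite exchange_big; apply: eq_bigr => f _ /=.
rewrite -det_tr /determinant mulr_sumr; apply: eq_bigr => s _.
rewrite mulrCA; congr (_ * _); rewrite -big_split; apply: eq_bigr => i _ /=.
by rewrite !mxE mulrC.
Qed.

Lemma poly_vanish_eq0 (k : closedFieldType) (p : {poly k}) :
  (forall s, p.[s] = 0) -> p = 0.
Proof.
by move=> p0; apply/eqP/negPn/negP => /closed_nonrootP[s]; rewrite rootE p0 eqxx.
Qed.

Section Zariski.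
Variables (k : closedFieldType) (T : graph) (M : rep k T) (r d : nat).
Variable C : coordinates M d.
Implicit Types (v : T) (U : subtuple M) (A Z : set (subtuple M)).

Let pls := {mpoly k[#|{: pindex M r}|]}.
Implicit Types p q : pls.

Definition multidegree (deg : T -> nat) p : Prop := forall m, m \in msupp p ->
  forall v, (\sum_(j | tag (enum_val j) == v) m j)%N = deg v.

Lemma multidegree_homogeneous deg p : multidegree deg p -> multihomogeneous p.
Proof. by exists deg. Qed.

Lemma multidegree1 : multidegree (fun=> 0%N) 1.
Proof. by move=> m; rewrite msupp1 inE => /eqP-> v; apply: big1 => j _; rewrite mnm0E. Qed.

Lemma multidegree0 deg : multidegree deg 0.
Proof. by move=> m; rewrite msupp0. Qed.

Lemma multidegreeM deg deg' p q : multidegree deg p -> multidegree deg' q ->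
  multidegree (fun v => deg v + deg' v)%N (p * q).
Proof.
move=> dp dq m /msuppM_le/allpairsP[[m1 m2] /= [/dp d1 /dq d2 ->]] v.
by rewrite -(d1 v) -(d2 v) -big_split; apply: eq_bigr => j _; rewrite mnmDE.
Qed.

Lemma multidegreeZ deg c p : multidegree deg p -> multidegree deg (c *: p).
Proof. by move=> dp m /msuppZ_le/dp. Qed.

Lemma multidegreeD deg p q :
  multidegree deg p -> multidegree deg q -> multidegree deg (p + q).
Proof. by move=> dp dq m /msuppD_le; rewrite mem_cat => /orP[/dp|/dq]. Qed.

Lemma multidegree_sum deg (I : Type) (s : seq I) (F : I -> pls) :
  (forall i, multidegree deg (F i)) -> multidegree deg (\sum_(i <- s) F i).
Proof.
move=> dF; elim/big_ind: _ => // [|p q]; first exact: multidegree0.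
exact: multidegreeD.
Qed.

Lemma multidegreeX deg p n : multidegree deg p ->
  multidegree (fun v => n * deg v)%N (p ^+ n).
Proof.
move=> dp; elim: n => [|n IHn]; first by rewrite expr0; exact: multidegree1.
by rewrite exprS => m /(multidegreeM dp IHn) E v; rewrite E mulSn.
Qed.

Lemma multidegree_var (j : pindex M r) :
  multidegree (fun v => tag j == v) 'X_(enum_rank j).
Proof.
move=> m; rewrite msuppX inE => /eqP-> v.
under eq_bigr do rewrite mnm1E.
rewrite big_mkcond (bigD1 (enum_rank j)) //= eqxx enum_rankK big1 ?addn0.
  by case: eqP.
by move=> i; rewrite eq_sym => /negPf->; case: ifP.
Qed.

Lemma multidegree_prod_var (f : forall v, pindex M r) (deg : T -> nat) :
  (forall v, tag (f v) = v) -> multidegree deg (\prod_v 'X_(enum_rank (f v)) ^+ deg v).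
Proof.
move=> tf; suff H s : multidegree (fun v => \sum_(u <- s) (u == v) * deg u)%N
    (\prod_(u <- s) 'X_(enum_rank (f u)) ^+ deg u).
  move=> m /H E v; rewrite E (bigD1 v) //= eqxx mul1n big1 ?addn0 // => u /negPf->.
  by rewrite mul0n.
elim: s => [|u s IHs]; first by rewrite big_nil => m /multidegree1 E v; rewrite E big_nil.
have := multidegreeM (@multidegreeX _ _ (deg u) (@multidegree_var (f u))) IHs.
by rewrite big_cons => H m /H E v; rewrite E big_cons tf mulnC.
Qed.

Definition plucker_eval p U : k := p.@[fun i => plucker U (enum_val i)].

Lemma plucker_evalM p q U : plucker_eval (p * q) U = plucker_eval p U * plucker_eval q U.
Proof. exact: mevalM. Qed.

Lemma plucker_eval_minors p X U : multihomogeneous p -> spans C X U ->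
  plucker_eval p U = 0 <-> minor_eval C p X = 0.
Proof. exact: plucker_vanish. Qed.

Lemma plucker_eval_prod_var (f : forall v, pindex M r) (deg : T -> nat) U :
  plucker_eval (\prod_v 'X_(enum_rank (f v)) ^+ deg v) U = \prod_v plucker U (f v) ^+ deg v.
Proof.
rewrite /plucker_eval rmorph_prod; apply: eq_bigr => v _.
by rewrite rmorphXn /= mevalXU enum_rankK.
Qed.

Definition coord_back v : 'M[k]_(\dim {:M v}, d) :=
  \matrix_(i, j) (to_row C v (vbasis {:M v})`_i) 0 j.

Lemma coord_mxK v : coord_mx C v *m coord_back v = 1%:M.
Proof.
apply/matrixP => i j; rewrite !mxE.
have := coord_vbasis (memvf (of_row C v (delta_mx 0 i))).
move=> /(congr1 (fun x => to_row C v x 0 j)); rewrite of_rowK linear_sum /= summxE !mxE /=.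
rewrite eq_sym => ->; apply: eq_bigr => l _; rewrite linearZ /= !mxE; congr (_ * _).
Qed.

(** The linear form in the Pluecker coordinates at [v] which Cauchy-Binet attaches to
    [X |-> det (X v *m Q)]; [coord_back] undoes the change of basis. The rank conditions and the
    slice coordinates are both expressed by such forms. *)
Definition det_form v (Q : 'M[k]_(d, r)) : pls :=
  \sum_(f : {ffun 'I_r -> 'I_(\dim {:M v})})
    (\prod_i (coord_back v *m Q) (f i) i) *:
    'X_(enum_rank (Tagged (fun v => {ffun 'I_r -> 'I_(\dim {:M v})}) f : pindex M r)).

Lemma det_form_degree v Q : multidegree (fun u => v == u) (det_form v Q).
Proof.
by apply: multidegree_sum => f; apply: multidegreeZ; exact: multidegree_var.
Qed.

Lemma det_form_eval v Q X : minor_eval C (det_form v Q) X = \det (X v *m Q).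
Proof.
rewrite -[X v *m Q]mulmx1.
have -> : X v *m Q *m 1%:M = X v *m coord_mx C v *m (coord_back v *m Q).
  by rewrite mulmx1 mulmxA -(mulmxA (X v)) coord_mxK mulmx1.
rewrite det_mulmx_sum /minor_eval /det_form linear_sum /=; apply: eq_bigr => f _.
by rewrite mevalZ mevalXU enum_rankK.
Qed.

Lemma zclosed_zero_locus p : multihomogeneous p ->
  zclosed M r [set U | Gr M r U /\ plucker_eval p U = 0].
Proof.
move=> ph; exists [set p]; split=> [q ->//|].
by apply/seteqP; split=> U [GU pU]; split=> //; [move=> q -> | exact: pU].
Qed.

Lemma zclosed_Gr : zclosed M r (Gr M r).
Proof. by exists set0; split=> //; apply/seteqP; split=> // U []. Qed.

Lemma zclosureP A U : A `<=` Gr M r -> zclosure M r A U <-> Gr M r U /\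
  forall p, multihomogeneous p -> (forall W, A W -> plucker_eval p W = 0) ->
  plucker_eval p U = 0.
Proof.
move=> AG; split=> [UA|[GU pU] Z [[S [Sh ->]] AS]].
  split; first by apply: (UA (Gr M r)); split=> //; exact: zclosed_Gr.
  move=> p ph pA; suff [] : [set U | Gr M r U /\ plucker_eval p U = 0] U by [].
  by apply: UA; split=> [|W AW]; [exact: zclosed_zero_locus | split;
    [exact: AG | exact: pA]].
by split=> // p Sp; apply: pU; [exact: Sh | move=> W /AS[_]; exact].
Qed.

Lemma sub_zclosure A : A `<=` zclosure M r A.
Proof. by move=> U AU Z [_]; exact. Qed.

Lemma zclosure_min A Z : zclosed M r Z -> A `<=` Z -> zclosure M r A `<=` Z.
Proof. by move=> cZ AZ U; apply. Qed.

Lemma zclosure_mono A B : A `<=` B -> zclosure M r A `<=` zclosure M r B.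
Proof. by move=> AB U UA Z [cZ BZ]; apply: UA; split=> //; exact: subset_trans BZ. Qed.

Lemma zclosed_sub_Gr Z : zclosed M r Z -> Z `<=` Gr M r.
Proof. by case=> S [_ ->] U []. Qed.

Lemma zclosed_zclosure A : A `<=` Gr M r -> zclosed M r (zclosure M r A).
Proof.
move=> AG; exists [set p | multihomogeneous p /\ forall W, A W -> plucker_eval p W = 0].
split=> [p []//|]; apply/seteqP; split=> U.
  by move/(zclosureP _ AG) => [GU pU]; split=> // p [ph pA]; exact: pU.
by case=> GU pU; apply/zclosureP => //; split=> // p ph pA; exact: pU.
Qed.

Lemma irreducible_zclosure A : A `<=` Gr M r -> irreducible M r A ->
  irreducible M r (zclosure M r A).
Proof.
move=> AG [[U AU] irr]; split; first by exists U; exact: sub_zclosure.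
move=> Z1 Z2 c1 c2 cov; have [AZ|AZ] := irr Z1 Z2 c1 c2 (subset_trans (@sub_zclosure A)
  cov).
  by left; exact: zclosure_min.
by right; exact: zclosure_min.
Qed.

Lemma irreducible_mul A p q : A `<=` Gr M r -> irreducible M r A ->
  multihomogeneous p -> multihomogeneous q ->
  (forall U, A U -> plucker_eval (p * q) U = 0) ->
  (forall U, A U -> plucker_eval p U = 0) \/ (forall U, A U -> plucker_eval q U = 0).
Proof.
move=> AG [_ irr] ph qh pq.
have [|||sub|sub] := irr [set U | Gr M r U /\ plucker_eval p U = 0]
  [set U | Gr M r U /\ plucker_eval q U = 0]; try exact: zclosed_zero_locus.
- move=> U AU; have /eqP := pq U AU; rewrite plucker_evalM mulf_eq0 => /orP[]/eqP.
    by left; split=> //; exact: AG.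
  by right; split=> //; exact: AG.
- by left=> U /sub[].
- by right=> U /sub[].
Qed.

(** * Polynomial curves of subspaces and density arguments *)

Section Curves.
Implicit Type X : T -> 'M[{poly k}]_(r, d).

Definition at_param X (s : k) v : 'M[k]_(r, d) := map_mx (horner_eval s) (X v).

Lemma minor_eval_at p X : exists q : {poly k}, forall s,
  minor_eval C p (at_param X s) = q.[s].
Proof.
pose h (i : 'I_(#|{: pindex M r}|)) := let j : pindex M r := enum_val i in
  \det (colsub (tagged j) (X (tag j) *m map_mx polyC (coord_mx C (tag j)))).
exists (mmap (@polyC k) h p) => s.
rewrite /minor_eval mevalE /mmap horner_sum; apply: eq_bigr => m _.
rewrite hornerM hornerC; congr (_ * _); rewrite /mmap1 horner_prod.
apply: eq_bigr => i _; rewrite horner_exp; congr (_ ^+ _).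
rewrite /minors /h -[RHS]/(horner_eval s _) -det_map_mx; congr (\det _).
apply/matrixP => a b; rewrite !mxE rmorph_sum; apply: eq_bigr => l _.
by rewrite rmorphM !mxE /= /horner_eval hornerC.
Qed.

(** Independence is an open condition: a right inverse [Q] at [s0] gives the polynomial
    [det (Y *m Q)], equal to 1 at [s0], and the rows are independent wherever it does not vanish. *)
Lemma row_free_generic (Y : 'M[{poly k}]_(r, d)) s0 :
  row_free (map_mx (horner_eval s0) Y) ->
  exists2 g : {poly k}, g.[s0] != 0 &
    forall s, g.[s] != 0 -> row_free (map_mx (horner_eval s) Y).
Proof.
move=> /row_freeP[Q YQ]; exists (\det (Y *m map_mx polyC Q)).
  rewrite -[_.[_]]/(horner_eval s0 _) -det_map_mx map_mxM /=.
  have -> : map_mx (horner_eval s0) (map_mx polyC Q) = Q.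
    by apply/matrixP => a b; rewrite !mxE /= /horner_eval hornerC.
  by rewrite YQ det1 oner_eq0.
move=> s; rewrite -[_.[_]]/(horner_eval s _) -det_map_mx map_mxM /= => ds.
rewrite /row_free eqn_leq rank_leq_row /=.
have /eqP {1}<- : row_free (map_mx (horner_eval s) Y *m map_mx (horner_eval s) (map_mx
  polyC Q)).
  by rewrite row_free_unit unitmxE unitfE.
exact: mxrankM_maxl.
Qed.

Definition generic_curve A X : Prop := exists2 g : {poly k}, g != 0 &
  forall s, g.[s] != 0 -> exists2 W, A W & spans C (at_param X s) W.

Lemma curve_vanish A X p : multihomogeneous p -> generic_curve A X ->
  (forall W, A W -> plucker_eval p W = 0) ->
  forall s, minor_eval C p (at_param X s) = 0.
Proof.
move=> ph [g g0 gX] pA; have [q qE] := minor_eval_at p X.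
suff q0 : q = 0 by move=> s; rewrite qE q0 horner0.
have /eqP : g * q = 0.
  apply: poly_vanish_eq0 => s; rewrite hornerM; have [->|gs] := eqVneq g.[s] 0.
    by rewrite mul0r.
  have [W AW XW] := gX s gs; rewrite -qE.
  by have -> := (plucker_eval_minors ph XW).1 (pA W AW); rewrite mulr0.
by rewrite mulf_eq0 (negPf g0) => /eqP.
Qed.

Lemma curve_zclosure A X s U : A `<=` Gr M r -> Gr M r U -> generic_curve A X ->
  spans C (at_param X s) U -> zclosure M r A U.
Proof.
move=> AG GU AX XU; apply/zclosureP => //; split=> // p ph pA.
by apply/(plucker_eval_minors ph XU); exact: curve_vanish pA _.
Qed.

(** If neither closed set contained [A], two forms nonzero at [U] and [U'] would restrict to nonzero
    polynomials on a curve through both; a parameter where neither vanishes, and where the curve is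
    in [A], gives a point outside the union. *)
Lemma curve_irreducible A : A `<=` Gr M r -> A !=set0 ->
  (forall U U', A U -> A U' -> exists X, [/\ generic_curve A X,
    exists s, spans C (at_param X s) U & exists s, spans C (at_param X s) U']) ->
  irreducible M r A.
Proof.
move=> AG A0 curves; split=> // Z1 Z2 [S1 [h1 ->]] [S2 [h2 ->]] cov.
have [|/existsNP[U /not_implyP[AU nU]]] := pselect (A `<=` [set U | Gr M r U /\ forall p,
  S1 p -> plucker_eval p U = 0]).
  by left.
right=> U' AU'; split; [exact: AG | move=> q S2q; apply: contrapT => qU'].
have [p S1p pU] : exists2 p, S1 p & plucker_eval p U <> 0.
  apply: contrapT => H; apply: nU; split; first exact: AG.
  by move=> p S1p; apply: contrapT => pU; apply: H; exists p.
have [X [[g g0 gX] [s sU] [s' sU']]] := curves U U' AU AU'.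
have [f fE] := minor_eval_at p X; have [f' fE'] := minor_eval_at q X.
have fs : f.[s] != 0.
  by apply/eqP; rewrite -fE => /(plucker_eval_minors (h1 p S1p) sU).
have fs' : f'.[s'] != 0.
  by apply/eqP; rewrite -fE' => /(plucker_eval_minors (h2 q S2q) sU').
have /closed_nonrootP[t] : g * f * f' != 0.
  by rewrite !mulf_neq0 //; [apply: contraNneq fs|apply: contraNneq fs'] => ->;
    rewrite horner0.
rewrite rootE !hornerM !mulf_eq0 !negb_or => /andP[/andP[gt ft] ft'].
have [W AW XW] := gX t gt; have [[_ pW]|[_ qW]] := cov W AW.
  have := (plucker_eval_minors (h1 p S1p) XW).1 (pW p S1p).
  by rewrite fE; apply/eqP.
have := (plucker_eval_minors (h2 q S2q) XW).1 (qW q S2q).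
by rewrite fE'; apply/eqP.
Qed.

Definition pencil (Y Y' : T -> 'M[k]_(r, d)) v : 'M[{poly k}]_(r, d) :=
  map_mx polyC (Y v) + 'X *: map_mx polyC (Y' v).

Lemma pencil_at Y Y' s v : at_param (pencil Y Y') s v = Y v + s *: Y' v.
Proof.
by apply/matrixP => i j; rewrite !mxE /horner_eval /= hornerD hornerM hornerX !hornerC.
Qed.

End Curves.
End Zariski.

(** * Strata *)

Section DiagonalProjections.
Variables (F : fieldType) (n : nat).
Implicit Type P : pred 'I_n.

Definition sel_mx P : 'M[F]_n := diag_mx (\row_i (P i)%:R).

Lemma mul_sel_mx m P (A : 'M_(n, m)) i j : (sel_mx P *m A) i j = A i j *+ P i.
Proof. by rewrite mul_diag_mx !mxE mulr_natl. Qed.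

Lemma mul_mx_sel m P (A : 'M_(m, n)) i j : (A *m sel_mx P) i j = A i j *+ P j.
Proof. by rewrite mul_mx_diag !mxE mulr_natr. Qed.

Lemma sel_mxC P : sel_mx P + sel_mx (predC P) = 1%:M.
Proof.
apply/matrixP => i j; rewrite !mxE /= -mulrnDl -natrD.
by case: (P i); rewrite /= ?addn0.
Qed.

Lemma sel_mxM P Q : sel_mx P *m sel_mx Q = sel_mx (predI P Q).
Proof.
apply/matrixP => i j; rewrite mul_sel_mx !mxE /=; case: eqP => [->|_].
  by case: (P j); case: (Q j).
by rewrite !mulr0n mul0rn.
Qed.

Lemma sel_mx0 P : P =1 pred0 -> sel_mx P = 0.
Proof. by move=> P0; apply/matrixP => i j; rewrite !mxE P0 mul0rn. Qed.

(** The upper bounds for [P] and for its complement add up to [n], the rank of the identity, so both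
    are equalities. *)
Lemma rank_sel_mx P : \rank (sel_mx P) = (\sum_i P i)%N.
Proof.
have le Q : (\rank (sel_mx Q) <= \sum_i Q i)%N.
  have -> : sel_mx Q = \sum_i delta_mx i i *+ Q i.
    apply/matrixP => a b; rewrite summxE !mxE (bigD1 a) //= big1 ?addr0.
      by rewrite mulmxnE !mxE eqxx /= eq_sym; case: (Q a); case: (b == a).
    by move=> i /negPf ia; rewrite mulmxnE mxE eq_sym ia mul0rn.
  elim/big_ind2: _ => [|A a B b Aa Bb|i _]; first by rewrite mxrank0.
    exact: leq_trans (mxrank_add _ _) (leq_add Aa Bb).
  by case: (Q i); rewrite ?mulr1n ?mulr0n ?mxrank0 // mxrank_delta.
have := mxrank_add (sel_mx P) (sel_mx (predC P)); rewrite sel_mxC mxrank1.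
have := le P; have := le (predC P).
suff : (\sum_i P i + \sum_i (predC P) i = n)%N by lia.
rewrite -big_split /= -[RHS]card_ord -sum1_card; apply: eq_bigr => i _.
by case: (P i).
Qed.

End DiagonalProjections.
Arguments sel_mx {F n} P.

Definition side_proj (k : fieldType) (T : graph) d (tg : 'I_d -> T) (e : arrow T) :
  'M[k]_d := sel_mx (fun j => tg j \in side e).

Section Strata.
Variables (k : closedFieldType) (T : graph) (M : rep k T) (r d : nat).
Hypothesis treeT : is_tree T.
Variables (C : coordinates M d) (tg : 'I_d -> T).

Local Notation side_proj := (side_proj k tg).

Hypothesis compat : forall e x,
  to_row C (tgt e) (rmap M e x) = to_row C (src e) x *m side_proj e.
Implicit Types (v : T) (e : arrow T) (U : subtuple M) (o : 'I_r -> T * T).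
Implicit Types w : 'M[k]_(r, d).

Lemma side_projC e : side_proj e + side_proj (rev_arrow e) = 1%:M.
Proof.
rewrite -[RHS](sel_mxC k (fun j => tg j \in side e)); congr (_ + sel_mx _).
by apply/funext => j; rewrite side_rev.
Qed.

Lemma side_projM0 e : side_proj (rev_arrow e) *m side_proj e = 0.
Proof.
by rewrite sel_mxM; apply: sel_mx0 => j /=; rewrite side_rev //; case: (_ \in _).
Qed.

Lemma rowspan_image e m (X : 'M_(m, d)) :
  (rmap M e @: rowspan C (src e) X)%VS = rowspan C (tgt e) (X *m side_proj e).
Proof.
apply/vspaceP => y; rewrite mem_rowspan; apply/memv_imgP/submxP.
  case=> x; rewrite mem_rowspan => /submxP[u xu] ->; exists u.
  by rewrite compat xu mulmxA.
case=> u yu; exists (of_row C (src e) (u *m X)).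
  by rewrite mem_rowspan of_rowK submxMl.
by apply: (can_inj (to_rowK C (v := tgt e))); rewrite compat of_rowK -mulmxA.
Qed.

(* Row [i] is a vector placed at the point [o i] and transported to [v]: the maps
   of [M] kill the coordinates whose geodesic to [v] avoids [o i].  A vertex [u]
   gives a copy of [P_u]; a midpoint gives the two halves of a copy of some [P_u]
   degenerated along the edge. *)
Definition masked o w v : 'M[k]_(r, d) :=
  \matrix_(i, j) (w i j *+ mask (o i) v (tg j)).

Lemma masked_compat o w e : masked o w (src e) *m side_proj e =
  sel_mx (fun i => inside (o i) e) *m masked o w (tgt e).
Proof.
apply/matrixP => i j; rewrite mul_mx_sel mul_sel_mx !mxE -!mulrnA !mulnb.
by rewrite [X in _ *+ nat_of_bool X](mask_inside treeT) andbC.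
Qed.

Lemma maskedD o w z s v : masked o (w + s *: z) v = masked o w v + s *: masked o z v.
Proof. by apply/matrixP => i j; rewrite !mxE mulrnDl mulrnAr. Qed.

Definition model_stratum o : set (subtuple M) :=
  [set U | exists w, spans C (masked o w) U].

(** By [masked_compat] the image is spanned by the rows of generators inside [e], taken from an
    independent family at the target. *)
Lemma model_stratum_Phi o U e : model_stratum o U -> Phi M U e = inside_count o e.
Proof.
case=> w wU; have [_ Us] := wU (src e); have [Xf Ut] := wU (tgt e).
rewrite /Phi Us rowspan_image dim_rowspan masked_compat mxrankMfree //.
exact: rank_sel_mx.
Qed.

Lemma model_stratum_Gr o : model_stratum o `<=` Gr M r.
Proof.
move=> U [w wU]; split=> [e|v]; last exact: spans_dim wU.
have [_ ->] := wU (src e); have [_ ->] := wU (tgt e).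
by rewrite rowspan_image rowspan_sub masked_compat submxMl.
Qed.

Lemma model_stratum_perm o (s : {perm 'I_r}) :
  model_stratum o `<=` model_stratum (o \o s).
Proof.
move=> U [w wU]; exists (row_perm s w) => v; have [Xf UX] := wU v.
have E : masked (o \o s) (row_perm s w) v = perm_mx s *m masked o w v.
  by rewrite -row_permE; apply/matrixP => i j; rewrite !mxE.
have su := unitmx_perm k s.
split; first by rewrite E /row_free mxrankMfree // mxrank_unit.
rewrite UX E; apply: rowspan_eq; apply/eqmxP/eqmx_sym.
by apply: eqmxMfull; rewrite row_full_unit.
Qed.

Lemma rows_free_generic (X : T -> 'M[{poly k}]_(r, d)) s0 :
  (forall v, row_free (at_param X s0 v)) ->
  exists2 g : {poly k}, g.[s0] != 0 &
    forall s, g.[s] != 0 -> forall v, row_free (at_param X s v).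
Proof.
move=> free; have /choice[g gP] v : exists g : {poly k}, g.[s0] != 0 /\
    forall s, g.[s] != 0 -> row_free (at_param X s v).
  by have [g g0 gs] := row_free_generic (free v); exists g.
exists (\prod_v g v) => [|s]; rewrite horner_prod.
  by apply/prodf_neq0 => v _; case: (gP v).
by move/prodf_neq0 => gs v; have [_] := gP v; apply; exact: gs.
Qed.

Lemma poly_neq0_horner (g : {poly k}) s : g.[s] != 0 -> g != 0.
Proof. by apply: contraNneq => ->; rewrite horner0. Qed.

Lemma model_stratum_irreducible o : model_stratum o !=set0 ->
  irreducible M r (model_stratum o).
Proof.
move=> o0; apply: curve_irreducible o0 _; first exact: model_stratum_Gr.
move=> U U' [w wU] [w' wU']; pose X := pencil (masked o w) (masked o (w' - w)).
have XE s v : at_param X s v = masked o (w + s *: (w' - w)) v.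
  by rewrite pencil_at maskedD.
have X0 v : at_param X 0 v = masked o w v by rewrite XE scale0r addr0.
have X1 v : at_param X 1 v = masked o w' v by rewrite XE scale1r addrC subrK.
exists X; split.
- have [|g g0 gs] := @rows_free_generic X 0; first by move=> v; rewrite X0; case: (wU v).
  exists g; first exact: poly_neq0_horner g0.
  move=> s /gs free; exists (fun v => rowspan C v (at_param X s v)) => //.
  by exists (w + s *: (w' - w)) => v; rewrite -XE.
- by exists 0 => v; rewrite X0.
- by exists 1 => v; rewrite X1.
Qed.

(** The matching depends on the vertex, so vertices are added one at a time. The 0-1 matrix [z] of a
    matching at [u] is independent at [u], the matrix [w] at the earlier vertices, and a generic
    point of the line through them at all of these. *)
Lemma model_stratum_neq0 o : (forall i, point (o i)) -> (r <= d)%N ->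
  (forall e, r - inside_count o (rev_arrow e) <= \sum_j (tg j \in side e))%N ->
  model_stratum o !=set0.
Proof.
move=> po rd cap.
suff [w wf] : exists w, forall v, row_free (masked o w v).
  by exists (fun v => rowspan C v (masked o w v)); exists w.
suff H (s : seq T) : exists w, {in s, forall v, row_free (masked o w v)}.
  by have [w wf] := H (enum T); exists w => v; apply: wf; rewrite mem_enum.
elim: s => [|u s [w wf]]; first by exists 0.
have [f fi fm] := hall_mask treeT u po rd cap.
pose z : 'M[k]_(r, d) := \matrix_(i, j) (j == f i)%:R.
have zf : row_free (masked o z u).
  apply/row_freeP; exists (masked o z u)^T; apply/matrixP => i j; rewrite !mxE.
  rewrite (bigD1 (f i)) //= big1 ?addr0 => [|l /negPf lf]; last first.
    by rewrite !mxE lf mul0rn mul0r.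
  rewrite !mxE eqxx fm mulr1n mul1r (inj_eq fi); case: eqP => [->|]; first by rewrite fm.
  by rewrite mul0rn.
pose X := pencil (masked o w) (masked o (z - w)).
have XE t v : at_param X t v = masked o (w + t *: (z - w)) v.
  by rewrite pencil_at maskedD.
have /choice[g gP] v : exists g : {poly k}, v \in u :: s -> g != 0 /\
    forall t, g.[t] != 0 -> row_free (at_param X t v).
  have [vs|] := boolP (v \in u :: s); last by exists 0.
  have [t tf] : exists t, row_free (at_param X t v).
    move: vs; rewrite inE => /orP[/eqP->|/wf vs]; [exists 1|exists 0]; rewrite XE.
      by rewrite scale1r addrC subrK.
    by rewrite scale0r addr0.
  have [g g0 gs] := row_free_generic tf.
  by exists g => _; split=> //; exact: poly_neq0_horner g0.
have /closed_nonrootP[t] : \prod_(v <- u :: s) g v != 0.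
  by rewrite prodf_seq_neq0; apply/allP => v vs; have [] := gP v vs.
rewrite rootE horner_prod prodf_seq_neq0 => /allP gt.
by exists (w + t *: (z - w)) => v vs; rewrite -XE; apply: (gP v vs).2; exact: gt.
Qed.

(** A generator at the midpoint of [e] shows its coordinates from [side e] beyond [e], and the
    others on [side e]. Place it at [src e] and multiply the former coordinates by [t]. On [side e]
    the row becomes the old one plus the term [t Y]; beyond [e] it is [t] times the old one, a
    factor recorded in [D t v] that does not change the span. At [t = 0] the midpoint is
    recovered. *)
Lemma model_stratum_degeneration o i0 e U :
  (o i0 == (src e, tgt e)) || (o i0 == (tgt e, src e)) -> model_stratum o U ->
  zclosure M r (model_stratum (fun i => if i == i0 then (src e, src e) else o i)) U.
Proof.
set o' := fun i => _; move=> oe oU; have [w wU] := oU.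
pose Y v : 'M[k]_(r, d) := \matrix_(i, j)
  (w i j *+ [&& i == i0, v \in side e, tg j \in side e & mask (src e, src e) v (tg j)]).
pose w' t : 'M[k]_(r, d) := \matrix_(i, j)
  (if (i == i0) && (tg j \in side e) then t * w i j else w i j).
pose D t v : 'rV[k]_r := \row_i (if (i == i0) && (v \notin side e) then t else 1).
have XE t v : masked o' (w' t) v = diag_mx (D t v) *m (masked o w v + t *: Y v).
  apply/matrixP => i j; rewrite mul_diag_mx !mxE /o'; case: eqP => [->|_] /=; last first.
    by rewrite mulr0n mulr0 addr0 mul1r.
  rewrite (mask_midpoint treeT v (tg j) oe); have [ve|ve] /= := boolP (v \in side e).
    rewrite mul1r; have [je|je] /= := boolP (tg j \in side e).
      by rewrite add0r mulrnAr.
    rewrite mulr0n mulr0 addr0 (maskC treeT) (_ : mask _ _ _) //.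
    by rewrite (mask_src treeT).
  rewrite mulr0n mulr0 addr0 (mask_src treeT) //.
  by case: (tg j \in side e); rewrite ?mulr0n ?mulr0.
have X0 v : masked o w v + 0 *: Y v = masked o w v by rewrite scale0r addr0.
pose X := pencil (masked o w) Y.
apply: (@curve_zclosure _ _ _ _ _ C _ X 0); first exact: model_stratum_Gr.
- exact: model_stratum_Gr oU.
- have [|g g0 gs] := @rows_free_generic X 0.
    by move=> v; rewrite pencil_at X0; case: (wU v).
  exists (g * 'X); first by rewrite mulf_neq0 ?polyX_eq0 //; exact: poly_neq0_horner g0.
  move=> t; rewrite hornerM hornerX mulf_eq0 negb_or => /andP[/gs free t0].
  have Du v : diag_mx (D t v) \in unitmx.
    rewrite unitmxE det_diag unitfE; apply/prodf_neq0 => i _; rewrite mxE.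
    by case: ifP; rewrite ?oner_eq0.
  exists (fun v => rowspan C v (at_param X t v)) => //.
  exists (w' t) => v; have := free v; rewrite XE pencil_at => Xf; split.
    by rewrite /row_free mxrankMfree // mxrank_unit.
  by apply: rowspan_eq; apply/eqmxP/eqmx_sym; apply: eqmxMfull; rewrite row_full_unit.
- by move=> v; rewrite pencil_at X0.
Qed.

End Strata.

(** * Generators of an arbitrary subrepresentation *)

Section Decomposition.
Variables (k : closedFieldType) (T : graph) (M : rep k T) (r d : nat).
Hypothesis treeT : is_tree T.
Variables (C : coordinates M d) (tg : 'I_d -> T).
Local Notation side_proj := (side_proj k tg).
Hypothesis compat : forall e x,
  to_row C (tgt e) (rmap M e x) = to_row C (src e) x *m side_proj e.
Variable U : subtuple M.
Hypothesis UG : Gr M r U.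
Implicit Types (v : T) (e f : arrow T).

Let X v : 'M[k]_(r, d) := rows_of r C U v.

Let U_X v : U v = rowspan C v (X v).
Proof. by rewrite rowspan_rows_of //; case: UG. Qed.

Let rank_X v : \rank (X v) = r.
Proof. by apply/eqP; apply: rows_of_free; case: UG. Qed.

Let X_sub e : (X (src e) *m side_proj e <= X (tgt e))%MS.
Proof.
have [/(_ e)] := UG; rewrite (U_X (src e)) (U_X (tgt e)).
by rewrite (rowspan_image compat) rowspan_sub.
Qed.

Lemma Phi_rank e : Phi M U e = \rank (X (src e) *m side_proj e).
Proof. by rewrite /Phi (U_X (src e)) (rowspan_image compat) dim_rowspan. Qed.

Let K e : 'M[k]_d := (X (src e) :&: kermx (side_proj e))%MS.

Let K0 e : K e *m side_proj e = 0.
Proof. by apply/sub_kermxP; exact: capmxSr. Qed.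

Let Kid e : K e *m side_proj (rev_arrow e) = K e.
Proof.
by rewrite -[RHS]mulmx1 -(side_projC k treeT tg e) mulmxDr K0 add0r.
Qed.

Let rank_K e : (\rank (K e) + Phi M U e)%N = r.
Proof. by rewrite Phi_rank addnC mxrank_mul_ker rank_X. Qed.

Let image_K e : (X (tgt e) *m side_proj (rev_arrow e) <= K e)%MS.
Proof.
rewrite sub_capmx; apply/andP; split; first exact: (X_sub (rev_arrow e)).
by apply/sub_kermxP; rewrite -mulmxA side_projM0 // mulmx0.
Qed.

Let Phi_rank_rev e :
  Phi M U (rev_arrow e) = \rank (X (tgt e) *m side_proj (rev_arrow e)).
Proof. exact: Phi_rank. Qed.

Lemma Phi_rev e : (Phi M U e + Phi M U (rev_arrow e) <= r)%N.
Proof.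
have := mxrankS (image_K e); rewrite -Phi_rank_rev.
by have := rank_K e; lia.
Qed.

(** The left side is the dimension of the kernel of the reverse map, which is supported on the
    coordinates of [side e]. *)
Lemma Phi_kernel e : (r - Phi M U (rev_arrow e) <= \sum_j (tg j \in side e))%N.
Proof.
have := rank_K (rev_arrow e); have := mxrankM_maxr (K (rev_arrow e)) (side_proj e).
rewrite -{2}[e]rev_arrowK Kid rank_sel_mx; lia.
Qed.

Let Y e : 'M[k]_d := (K e :\: X (tgt e) *m side_proj (rev_arrow e))%MS.

Let K_Y e : (K e <= Y e + X (tgt e) *m side_proj (rev_arrow e))%MS.
Proof.
have /eqmxP/andP[_] := addsmx_diff_cap_eq (K e) (X (tgt e) *m side_proj (rev_arrow e)).
by move=> /submx_trans; apply; rewrite addsmxS // capmxSr.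
Qed.

Let rank_Y e : \rank (Y e) = (r - Phi M U e - Phi M U (rev_arrow e))%N.
Proof.
have := mxrank_cap_compl (K e) (X (tgt e) *m side_proj (rev_arrow e)).
rewrite (capmx_idPr (image_K e)) -/(Y e) -Phi_rank_rev.
by have := rank_K e; lia.
Qed.

Let Y_K e : (Y e <= K e)%MS. Proof. exact: diffmxSl. Qed.

Let KK0 e f : src e = src f -> e != f -> K e *m side_proj (rev_arrow f) = 0.
Proof.
move=> ef ne; rewrite -Kid -mulmxA sel_mxM sel_mx0 ?mulmx0 // => j /=.
rewrite !side_rev //; apply: contraNF ne; rewrite -!(inside_vertex _).
by case/andP => je jf; apply/eqP; apply: (outside_uniq treeT _ ef je jf);
  rewrite /point eqxx.
Qed.

(** The kernel of [e] involves only the coordinates beyond [e], and distinct arrows out of one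
    vertex have disjoint sets beyond them. *)
Let K_direct v : mxdirect (\sum_(e | src e == v) K e)%MS.
Proof.
apply/mxdirect_sumsP => e /eqP ev; apply/eqP; rewrite -submx0.
set S := (\sum_(f | _) _)%MS.
have SK : S *m side_proj (rev_arrow e) = 0.
  apply/sub_kermxP/sumsmx_subP => f /andP[/eqP fv fe]; apply/sub_kermxP.
  by apply: KK0; rewrite ?fv ?ev.
rewrite -[X in (X <= _)%MS]mulmx1.
have /submxP[a aK] : (K e :&: S <= K e)%MS := capmxSl _ _.
have /submxP[b bS] : (K e :&: S <= S)%MS := capmxSr _ _.
by rewrite mulmx1 aK -Kid mulmxA -aK bS -mulmxA SK mulmx0 submx_refl.
Qed.

Let KX v : (\sum_(e | src e == v) K e <= X v)%MS.
Proof. by apply/sumsmx_subP => e /eqP <-; exact: capmxSl. Qed.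

Let rank_KX v : \rank (\sum_(e | src e == v) K e)%MS =
  (\sum_(e | src e == v) (r - Phi M U e))%N.
Proof.
rewrite (mxdirectP (K_direct v)) /=; apply: eq_bigr => e _.
by have := rank_K e; lia.
Qed.

Lemma Phi_div v : (\sum_(e | src e == v) (r - Phi M U e) <= r)%N.
Proof. by rewrite -rank_KX; apply: leq_trans (mxrankS (KX v)) _; rewrite rank_X. Qed.

Let W v : 'M[k]_d := (X v :\: \sum_(e | src e == v) K e)%MS.

Let X_W v : (X v <= W v + \sum_(e | src e == v) K e)%MS.
Proof.
have /eqmxP/andP[_] := addsmx_diff_cap_eq (X v) (\sum_(e | src e == v) K e)%MS.
by move=> /submx_trans; apply; rewrite addsmxS // capmxSr.
Qed.

Let rank_W v : \rank (W v) = (r - \sum_(e | src e == v) (r - Phi M U e))%N.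
Proof.
have := mxrank_cap_compl (X v) (\sum_(e | src e == v) K e)%MS.
by rewrite (capmx_idPr (KX v)) -/(W v) rank_KX rank_X; lia.
Qed.

Let nth_row m (A : 'M[k]_(m, d)) (n : nat) : 'rV[k]_d :=
  if insub n is Some i then row i (row_base A) else 0.

Let nth_row_sub m (A : 'M[k]_(m, d)) n : (nth_row A n <= A)%MS.
Proof.
rewrite /nth_row; case: insubP => [i _ _|_]; last exact: sub0mx.
by rewrite -(eq_row_base A); exact: row_sub.
Qed.

Let sub_nth_row m m' (A : 'M[k]_(m, d)) (B : 'M_(m', d)) :
  (forall n, (n < \rank A)%N -> (nth_row A n <= B)%MS) -> (A <= B)%MS.
Proof.
move=> sub; rewrite -(eq_row_base A); apply/row_subP => i.
by have := sub i (ltn_ord i); rewrite /nth_row valK.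
Qed.

Let mult := multiplicity r (Phi M U).

Hypothesis T0 : (0 < #|T|)%N.

Lemma model_stratum_cover : exists o : 'I_r -> T * T,
  (forall i, point (o i)) /\ model_stratum C tg o U.
Proof.
have [g gbij] := exists_fibers (sum_multiplicity treeT Phi_rev Phi_div T0).
have [h gK hK] := gbij.
pose o i := tag (g i).
have po i : point (o i).
  apply: (@multiplicity_point _ r (Phi M U)); rewrite -lt0n.
  exact: leq_ltn_trans (leq0n _) (ltn_ord (tagged (g i))).
(* [Y e] and [Y (rev_arrow e)] have the same rank, so their basis vectors can be added in pairs. The
   mask of the midpoint keeps the summand from [Y e] on [side e] and the other one beyond [e]. *)
pose gen (p : T * T) n : 'rV[k]_d :=
  if p.1 == p.2 then nth_row (W p.1) n
  else if [pick e : arrow T | val e == p] is Some e then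
    nth_row (Y e) n + nth_row (Y (rev_arrow e)) n else 0.
pose w : 'M[k]_(r, d) := \matrix_i gen (o i) (tagged (g i)).
pose G v := masked tg o w v.
have G_row v p n : (n < mult p)%N ->
    (\row_j (gen p n 0 j *+ mask p v (tg j)) <= G v)%MS.
  move=> np; pose i := h (Tagged (fun p => 'I_(mult p)) (Ordinal np)).
  have gi : g i = Tagged (fun p => 'I_(mult p)) (Ordinal np) by rewrite hK.
  have <- : row i (G v) = \row_j (gen p n 0 j *+ mask p v (tg j)).
    by apply/rowP => j; rewrite !mxE /o gi /=.
  exact: row_sub.
have G_W v : (W v <= G v)%MS.
  apply: sub_nth_row => n; rewrite rank_W -multiplicity_vertex => np.
  have <- : \row_j (gen (v, v) n 0 j *+ mask (v, v) v (tg j)) = nth_row (W v) n.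
    by apply/rowP => j; rewrite !mxE mask_vertex // /gen eqxx.
  exact: G_row.
have rev_Y e : Y (rev_arrow e) *m side_proj (rev_arrow e) = 0.
  by have /submxP[a ->] := Y_K (rev_arrow e); rewrite -mulmxA K0 mulmx0.
have Y_rev e : Y e *m side_proj (rev_arrow e) = Y e.
  by have /submxP[a ->] := Y_K e; rewrite -mulmxA Kid.
have G_edge e v n : canonical_arrow e -> (n < \rank (Y e))%N ->
    ((nth_row (Y e) n + nth_row (Y (rev_arrow e)) n) *m
       (if v \in side e then side_proj (rev_arrow e) else side_proj e) <= G v)%MS.
  move=> ce; rewrite rank_Y.
  have me : mult (src e, tgt e) = (r - Phi M U e - Phi M U (rev_arrow e))%N.
    by rewrite /mult multiplicity_arrow ce.
  rewrite -me => np; set A := (X in (X <= _)%MS).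
  suff -> : A = \row_j (gen (src e, tgt e) n 0 j *+ mask (src e, tgt e) v (tg j)).
    exact: G_row.
  rewrite {}/A.
  apply/rowP => j; rewrite [RHS]mxE (mask_midpoint treeT (e := e)) ?eqxx //.
  have st : (src e == tgt e) = false.
    by apply: contraTF (arrow_adj e) => /eqP->; rewrite adj_irrefl.
  rewrite /gen /= st.
  case: pickP => [f /eqP fe|/(_ e)/eqP[]]; last exact: surjective_pairing.
  have -> : f = e by apply/val_inj; move: fe => /= ->; rewrite -surjective_pairing.
  case: ifP => ve; rewrite mul_mx_sel ?side_rev //.
  by rewrite eq_sym eqbF_neg negbK.
have G_Y e : (Y e <= G (src e))%MS.
  apply: sub_nth_row => n nY.
  have E1 : nth_row (Y e) n *m side_proj (rev_arrow e) = nth_row (Y e) n.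
    by have /submxP[a ->] := nth_row_sub (Y e) n; rewrite -mulmxA Y_rev.
  have E2 : nth_row (Y (rev_arrow e)) n *m side_proj (rev_arrow e) = 0.
    by have /submxP[a ->] := nth_row_sub (Y (rev_arrow e)) n; rewrite -mulmxA rev_Y mulmx0.
  have [ce|ce] := boolP (canonical_arrow e).
    by have := G_edge e (src e) n ce nY; rewrite src_side // mulmxDl E1 E2 addr0.
  have := G_edge (rev_arrow e) (src e) n; rewrite canonical_rev ce => /(_ isT).
  rewrite rank_Y rev_arrowK subnAC -rank_Y => /(_ nY).
  by rewrite side_rev // src_side //= mulmxDl E1 E2 add0r.
have G_sub e : (G (src e) *m side_proj e <= G (tgt e))%MS.
  by rewrite /G masked_compat // submxMl.
have X_G v : (forall e, src e = v ->
    (X (tgt e) *m side_proj (rev_arrow e) <= G v)%MS) -> (X v <= G v)%MS.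
  move=> H; apply: submx_trans (X_W v) _; rewrite addsmx_sub G_W /=.
  apply/sumsmx_subP => e /eqP ev; apply: submx_trans (K_Y e) _.
  by rewrite addsmx_sub H // andbT -ev G_Y.
(* The part of the kernel of [f] not covered by [Y f] comes from [tgt f] through the reverse of [f],
   whose side is strictly smaller than that of [e]; hence the induction on the size of the side. *)
have XG_step n e : (#|side e| <= n)%N ->
    (X (src e) *m side_proj e <= G (tgt e))%MS.
  elim: n e => [|n IHn] e.
    by rewrite leqn0 cards_eq0 => /eqP e0; have := src_side treeT e; rewrite e0 inE.
  move=> en; apply: submx_trans (submxMr _ (X_W _)) _.
  rewrite addsmxMr addsmx_sub; apply/andP; split.
    exact: submx_trans (submxMr _ (G_W _)) (G_sub e).
  rewrite sumsmxMr; apply/sumsmx_subP => f /eqP fe.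
  have [->|ne] := eqVneq f e; first by rewrite K0 sub0mx.
  apply: submx_trans (G_sub e); apply: submxMr.
  apply: submx_trans (K_Y f) _; rewrite addsmx_sub -fe G_Y /=.
  apply: (IHn (rev_arrow f)); rewrite -ltnS; apply: leq_trans en; apply: proper_card.
  apply/properP; split; last first.
    by exists (src e); [exact: src_side | rewrite side_rev // -fe src_side].
  apply/fintype.subsetP => x; rewrite side_rev //; apply: contraLR => xe.
  apply/negP => xf; move: ne; rewrite (_ : f = e) ?eqxx //.
  apply: (@outside_uniq _ treeT (x, x)); rewrite ?inside_vertex //.
  by rewrite /point eqxx.
have sub v : (X v <= G v)%MS.
  apply: X_G => e <-; exact: (XG_step _ (rev_arrow e) (leqnn _)).
have rG v : \rank (G v) = r.
  by apply/eqP; rewrite eqn_leq rank_leq_row -{1}(rank_X v) mxrankS.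
exists o; split=> //; exists w => v; split; first by rewrite /row_free -/(G v) rG.
rewrite U_X; apply: rowspan_eq; apply/andP; split; first exact: sub.
by rewrite -(mxrank_leqif_sup (sub v)) rank_X -/(G v) rG.
Qed.

End Decomposition.

(** * Rank conditions as closed conditions *)

Section RankLocus.
Variables (k : fieldType) (r d : nat).

Lemma sum_ord_lt n m : (m <= n)%N -> (\sum_(i < n) (i < m)%N = m)%N.
Proof.
move=> mn; have E : (\sum_(i < m) 1 = \sum_(i < n | (i < m)%N) 1)%N := big_ord_widen n
  (fun=> 1%N) mn.
rewrite big_const_ord iter_addn_0 mul1n in E *; rewrite {2}E; rewrite [RHS]big_mkcond.
by apply: eq_bigr => i _; case: (i < m)%N.
Qed.

(** Minors of [X *m P] of size [m] are not Pluecker coordinates of [X]. Completing [m] columns of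
    [X *m P *m Q] by columns of [X *m Q] gives a determinant of size [r], which is a form in
    them. *)
Definition mixed_cols (P : 'M[k]_d) m (Q : 'M[k]_(d, r)) : 'M_(d, r) :=
  \matrix_(i, j) if (j < m)%N then (P *m Q) i j else Q i j.

Lemma rank_le_minors (X : 'M[k]_(r, d)) (P : 'M[k]_d) m : row_free X -> (m < r)%N ->
  (\rank (X *m P) <= m)%N <-> forall Q, \det (X *m mixed_cols P m.+1 Q) = 0.
Proof.
move=> Xf mr; split=> [rk Q|det0].
  apply/eqP/negPn/negP; rewrite -unitfE -[_ \is a _]/(_ \in unitmx) => XQ.
  have : (\rank (X *m mixed_cols P m.+1 Q *m sel_mx (fun j : 'I_r => j < m.+1)%N) <= m)%N.
    rewrite (_ : _ *m _ = X *m P *m Q *m sel_mx (fun j : 'I_r => j < m.+1)%N).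
      by rewrite -!mulmxA mulmxA (leq_trans (mxrankM_maxl _ _)).
    apply/matrixP => i j; rewrite !mul_mx_sel; have [jm|jm] := boolP (j < m.+1)%N.
      rewrite !mulr1n -mulmxA !mxE; apply: eq_bigr => l _.
      by congr (_ * _); rewrite mxE jm.
    by rewrite !mulr0n.
  by rewrite eqmxMfull ?row_full_unit // rank_sel_mx sum_ord_lt // ltnn.
rewrite leqNgt; apply/negP => rk; set A := X *m P in rk.
have /row_freeP[Xr XXr] := Xf; pose L := col_ebase A.
(* [Q] is chosen so that [X *m mixed_cols P m.+1 Q] is the invertible matrix [L]: [Q1] produces its
   first [m.+1] columns from [A], and the right inverse [Xr] of [X] the remaining ones. *)
pose Q1 : 'M[k]_(d, r) := invmx (row_ebase A) *m pid_mx m.+1.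
have AQ1 : A *m Q1 = L *m pid_mx m.+1.
  rewrite -{1}(mulmx_ebase A) /Q1 mulmxA mulmxK ?row_ebase_unit // -mulmxA.
  rewrite mul_pid_mx; congr (_ *m pid_mx _).
  by rewrite (minn_idPr _) ?(minn_idPr _) // (leq_trans rk) ?rank_leq_col.
pose Q : 'M[k]_(d, r) := \matrix_(i, j) if (j < m.+1)%N then Q1 i j else (Xr *m L) i j.
have := det0 Q; suff -> : X *m mixed_cols P m.+1 Q = L.
  by apply/eqP; rewrite -unitfE -[_ \is a _]/(_ \in unitmx) col_ebase_unit.
apply/matrixP => i j; rewrite mxE; have [jm|jm] := boolP (j < m.+1)%N.
  rewrite (_ : \sum_l _ = (A *m Q1) i j).
    rewrite AQ1 mxE (bigD1 j) //= big1 => [|l lj]; last first.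
      by rewrite !mxE (_ : (l == j :> nat) = false) ?mulr0 //; apply: negbTE lj.
    by rewrite addr0 !mxE eqxx jm mulr1.
  rewrite -mulmxA [RHS]mxE; apply: eq_bigr => l _; congr (_ * _).
  rewrite !mxE jm; apply: eq_bigr => l' _; congr (_ * _).
  by rewrite mxE jm mxE.
rewrite (_ : \sum_l _ = (X *m (Xr *m L)) i j); first by rewrite mulmxA XXr mul1mx.
rewrite [RHS]mxE; apply: eq_bigr => l _; congr (_ * _).
by rewrite mxE (negPf jm) mxE (negPf jm).
Qed.

End RankLocus.

Section UnionOfClosed.
Variables (k : closedFieldType) (T : graph) (M : rep k T) (r : nat).
Implicit Types Z A : set (subtuple M).

Lemma zclosed0 : zclosed M r set0.
Proof.
exists [set 1]; split=> [p ->|]; first exact: (multidegree_homogeneous (@multidegree1 k T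
  M r)).
apply/seteqP; split=> // U [_ /(_ 1 erefl)/eqP]; by rewrite meval1 oner_eq0.
Qed.

Lemma zclosedU Z1 Z2 : zclosed M r Z1 -> zclosed M r Z2 -> zclosed M r (Z1 `|` Z2).
Proof.
case=> S1 [h1 ->] [S2 [h2 ->]].
exists [set p | exists p1 p2, [/\ S1 p1, S2 p2 & p = p1 * p2]]; split.
  move=> _ [p1 [p2 [/h1[deg1 d1] /h2[deg2 d2] ->]]].
  by apply: multidegree_homogeneous; exact: multidegreeM d1 d2.
apply/seteqP; split=> U.
  case=> -[GU pU]; split=> // _ [p1 [p2 [Sp1 Sp2 ->]]]; rewrite mevalM.
    by rewrite (pU _ Sp1) mul0r.
  by rewrite (pU _ Sp2) mulr0.
case=> GU pU; have [[p1 S1p1 p1U]|H] := pselect (exists2 p1, S1 p1 & plucker_eval p1 U <>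
  0).
  right; split=> // p2 S2p2; have /eqP := pU (p1 * p2) (ex_intro _ p1 (ex_intro _ p2
    (And3 S1p1 S2p2 erefl))).
  by rewrite mevalM mulf_eq0 => /orP[]/eqP.
left; split=> // p1 S1p1; apply: contrapT => p1U; apply: H; by exists p1.
Qed.

Lemma irreducible_bigU A (I : Type) (s : seq I) (Z : I -> set (subtuple M)) :
  irreducible M r A -> (forall i, zclosed M r (Z i)) ->
  (forall U, A U -> exists2 i, List.In i s & Z i U) -> exists2 i, List.In i s & A `<=` Z i.
Proof.
case=> -[U0 AU0] irr cZ; elim: s => [|i s IHs] cov; first by case: (cov U0 AU0).
have cs (l : seq I) : zclosed M r [set U | exists2 j, List.In j l & Z j U].
  elim: l => [|j l IHl].
    rewrite (_ : mkset _ = set0); first exact: zclosed0.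
    by apply/seteqP; split=> // U [].
  rewrite (_ : mkset _ = Z j `|` [set U | exists2 j, List.In j l & Z j U]);
    first exact: zclosedU.
  apply/seteqP; split=> U; first by case=> j' [<-|]; [left|right; exists j'].
  by case=> [|[j' ? ?]]; [exists j => //; left | exists j' => //; right].
have [|sub|sub] := irr _ _ (cZ i) (cs s).
- by move=> U /cov[j [<-|]]; [left|right; exists j].
- by exists i => //; left.
- have [|j] := IHs; first by move=> U /sub.
  by exists j => //; right.
Qed.
End UnionOfClosed.

(** * Closures of strata of projectives *)

Section Closures.
Variables (k : closedFieldType) (T : graph) (M : rep k T) (r d : nat).
Hypotheses (treeT : is_tree T) (T0 : (0 < #|T|)%N).
Variables (C : coordinates M d) (tg : 'I_d -> T).
Local Notation side_proj := (side_proj k tg).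
Hypothesis compat : forall e x,
  to_row C (tgt e) (rmap M e x) = to_row C (src e) x *m side_proj e.
Implicit Types (v : T) (e f : arrow T) (U : subtuple M) (o : 'I_r -> T * T).
Local Notation model_stratum := (model_stratum C tg).

Lemma zclosed_Phi_le (D : arrow T -> nat) :
  zclosed M r [set U | Gr M r U /\ forall e, (Phi M U e <= D e)%N].
Proof.
exists [set p | exists e (Q : 'M[k]_(d, r)), (D e < r)%N /\
  p = det_form C (src e) (mixed_cols (side_proj e) (D e).+1 Q)].
split=> [_ [e [Q [_ ->]]]|].
  exact: (multidegree_homogeneous (@det_form_degree k T M r d C _ _)).
have key U e : Gr M r U -> (D e < r)%N -> (Phi M U e <= D e)%N <->
    forall Q : 'M[k]_(d, r), plucker_eval (det_form C (src e) (mixed_cols (side_proj e)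
      (D e).+1 Q)) U = 0.
  move=> GU De; rewrite (Phi_rank compat GU) rank_le_minors //; last first.
    by apply: rows_of_free; case: GU.
  have h (Q : 'M[k]_(d, r)) : multihomogeneous (det_form C (src e) (mixed_cols (side_proj
    e) (D e).+1 Q)).
    exists (fun u => src e == u); exact: det_form_degree.
  have sp : spans C (rows_of r C U) U by apply: spans_rows_of; case: GU.
  split=> H Q; last by have /(plucker_eval_minors (h Q) sp) := H Q; rewrite det_form_eval.
  by apply/(plucker_eval_minors (h Q) sp); rewrite det_form_eval.
apply/seteqP; split=> U [GU H]; split=> //.
  by move=> _ [e [Q [De ->]]]; apply: (key U e GU De).1.
move=> e; have [De|De] := ltnP (D e) r; last first.
  by apply: leq_trans De; have := Phi_rev treeT compat GU e; lia.
by apply/(key U e GU De) => Q; apply: H; exists e, Q.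
Qed.

Lemma inside_count_vertex_rev o e : (forall i, (o i).1 = (o i).2) ->
  (inside_count o e + inside_count o (rev_arrow e) = r)%N.
Proof.
move=> ov; have po i : point (o i) by rewrite /point ov eqxx.
rewrite -[RHS](inside_count_rev treeT e po) !big1 ?addn0 // => i _.
  by apply/eqP; rewrite eqb0; apply/eqP => oi; have := ov i; rewrite oi => /= ts;
    have := arrow_adj e; rewrite ts adj_irrefl.
by apply/eqP; rewrite eqb0; apply/eqP => oi; have := ov i; rewrite oi => /= ts;
    have := arrow_adj e; rewrite ts adj_irrefl.
Qed.

Lemma vertex_fibers o o' : (forall i, (o i).1 = (o i).2) ->
  (forall i, (o' i).1 = (o' i).2) -> inside_count o =1 inside_count o' ->
  exists s : {perm 'I_r}, forall i, o i = o' (s i).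
Proof.
move=> ov ov' E; apply: fibers_perm => -[a b].
have [<-|ab] := eqVneq a b.
  have po i : point (o i) by rewrite /point ov eqxx.
  have po' i : point (o' i) by rewrite /point ov' eqxx.
  apply: (@addnI (\sum_(e | src e == a) (r - inside_count o e))%N).
  rewrite (inside_count_balance treeT a po) -[LHS](inside_count_balance treeT a po').
  by congr (_ + _)%N; apply: eq_bigr => e _; rewrite E.
rewrite !big1 // => i _; apply/eqP; rewrite eqb0; apply: contraNneq ab => oi.
  by have := ov' i; rewrite oi => /= ->.
by have := ov i; rewrite oi => /= ->.
Qed.

(** Induction on the number of midpoints among generators of [U]; each is moved to an end of its
    edge without exceeding the counts of [o]. When none is left, the counts along an arrow and its
    reverse add up to [r] for both families, so the inequalities are equalities. *)
Lemma model_stratum_closure_le o U : (forall i, (o i).1 = (o i).2) ->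
  Gr M r U -> (forall e, Phi M U e <= inside_count o e)%N ->
  zclosure M r (model_stratum o) U.
Proof.
move=> ov GU le; have [o' [po' o'U]] := model_stratum_cover treeT compat GU T0.
move En : (\sum_i ((o' i).1 != (o' i).2))%N => n.
elim: n o' U GU le po' o'U En => [|n IHn] o' U GU le po' o'U En.
  have ov' i : (o' i).1 = (o' i).2.
    by apply/eqP; move/eqP: En; rewrite sum_nat_eq0 => /forallP/(_ i); rewrite eqb0 negbK.
  have leN e : (inside_count o' e <= inside_count o e)%N.
    by rewrite -(model_stratum_Phi treeT compat e o'U).
  have [|s so] := @vertex_fibers o o' ov ov'.
    move=> e; have := leN e; have := leN (rev_arrow e).
    have := inside_count_vertex_rev e ov; have := inside_count_vertex_rev e ov'; lia.
  apply: sub_zclosure; rewrite (_ : o = o' \o s); last by apply/funext.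
  exact: model_stratum_perm.
have [i0 i0n] : exists i0, (o' i0).1 != (o' i0).2.
  apply/existsP; apply: contraPT En => /existsPn H.
  by rewrite big1 // => i _; apply/eqP; rewrite eqb0; exact: H.
have [e0 oe0] : exists e0 : arrow T, o' i0 = (src e0, tgt e0).
  have := po' i0; rewrite /point (negPf i0n) /= => ai.
  by exists (exist _ (o' i0) ai); exact: surjective_pairing.
have mids : (inside_count o' e0 + inside_count o' (rev_arrow e0) < r)%N.
  rewrite -[X in (_ < X)%N](inside_count_rev treeT e0 po') -addn1 leq_add2l.
  by rewrite (bigD1 i0) //= oe0 eqxx.
(* The midpoint makes the two counts along its edge add up to less than [r], whereas those of [o]
   add up to [r]: one orientation has room for one more generator. *)
have [e [oe lt]] : exists e, (o' i0 == (src e, tgt e)) || (o' i0 == (tgt e, src e)) /\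
    (inside_count o' e < inside_count o e)%N.
  have := inside_count_vertex_rev e0 ov; have [lt|ge] := ltnP (inside_count o' e0)
    (inside_count o e0).
    by exists e0; rewrite oe0 eqxx.
  by move=> E; exists (rev_arrow e0); rewrite oe0 src_rev tgt_rev eqxx orbT; split=> //;
    lia.
pose o1 i := if i == i0 then (src e, src e) else o' i.
have po1 i : point (o1 i) by rewrite /o1; case: ifP => _ //; rewrite /point eqxx.
(* Only the count along [e] grows, by one: for an arrow other than [e], if [src e] is inside it then
   so is [tgt e], hence the midpoint was already counted. *)
have le1 f : (inside_count o1 f <= inside_count o f)%N.
  have [->|fe] := eqVneq f e.
    apply: leq_trans lt; rewrite /inside_count (bigD1 i0) //= [X in (_ <= X.+1)%N](bigD1
      i0) //=.
    rewrite (eq_bigr (fun i => nat_of_bool (inside (o' i) e))).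
      by rewrite -add1n leq_add ?leq_b1 ?leq_addl.
    by move=> i /negPf ii0; rewrite /o1 ii0.
  apply: leq_trans (le f); rewrite (model_stratum_Phi treeT compat f o'U).
  apply: leq_sum => i _; rewrite /o1; case: eqP => // ->.
  rewrite inside_vertex; have [sf|//] := boolP (src e \in side f).
  have tf : tgt e \in side f.
    by apply: contraNT fe => tf; apply/eqP/esym; apply: cross_arrow.
  by case/orP: oe => /eqP ->; rewrite /inside sf tf.
have := model_stratum_degeneration treeT compat oe o'U.
apply: zclosure_min; first by apply: zclosed_zclosure; exact: model_stratum_Gr.
move=> W W1; apply: (IHn o1) => //.
- exact: model_stratum_Gr W1.
- by move=> f; rewrite (model_stratum_Phi treeT compat f W1).
- move: En; rewrite (bigD1 i0) //= i0n add1n => -[<-].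
  rewrite (bigD1 i0) //= /o1 eqxx /= eqxx add0n; apply: eq_bigr => i /negPf ii0.
  by rewrite ii0.
Qed.

End Closures.

(** The maps of [Psum] and [subrep] are built by [linfun] from bare functions, so they agree with
    these only once linearity is proved. *)
Lemma linfun_id (k : fieldType) (aT rT : vectType k) (f : aT -> rT) :
  linear f -> linfun f =1 f.
Proof.
move=> lf x; pose g : {linear aT -> rT} :=
  HB.pack_for {linear aT -> rT} f (GRing.isLinear.Build k aT rT *:%R f lf).
exact: (lfunE g).
Qed.

(** * Sums of the representations [Prep] and their strata *)

Section PsumFacts.
Variables (k : fieldType) (T : graph) (m : T -> nat).

Lemma rmap_Psum (e : arrow T) (x : Psum k m (src e)) (p : {v : T & 'I_(m v)}) :
  (rmap (Psum k m) e x) p = if tag p \in side e then x p else 0.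
Proof.
rewrite /= linfun_id; last first.
  by move=> a y z; apply/ffunP => q; rewrite !ffunE linearP.
by rewrite ffunE /=; case: ifP => _; rewrite lfunE.
Qed.

Lemma dim_Psum v : \dim {:Psum k m v} = (\sum_u m u)%N.
Proof. by rewrite dimvf -card_sigma_ord; exact: muln1. Qed.

Definition Psum_delta (p : {v : T & 'I_(m v)}) : {ffun {v : T & 'I_(m v)} -> k^o} :=
  [ffun q => (q == p)%:R].

Lemma Psum_sum_delta (x : {ffun {v : T & 'I_(m v)} -> k^o}) :
  x = \sum_p x p *: Psum_delta p.
Proof.
apply/ffunP => q; rewrite sum_ffunE (bigD1 q) //= big1 ?addr0 => [|p /negPf pq].
  by rewrite !ffunE eqxx; exact/esym/mulr1.
by rewrite !ffunE eq_sym pq; exact: mulr0.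
Qed.

Lemma rmap_Psum_delta e p :
  rmap (Psum k m) e (Psum_delta p) = if tag p \in side e then Psum_delta p else 0.
Proof.
apply/ffunP => q; rewrite rmap_Psum ffunE; have [->|qp] := eqVneq q p.
  by case: ifP => _; rewrite ffunE ?eqxx.
by rewrite if_same; case: ifP => _; rewrite ffunE ?(negPf qp).
Qed.

End PsumFacts.

Lemma lfun_bij_inv (k : fieldType) (aT rT : vectType k) (f : 'Hom(aT, rT)) :
  bijective f -> cancel f (f^-1)%VF /\ cancel (f^-1)%VF f.
Proof.
move=> fb; have fi := bij_inj fb; have fK : cancel f (f^-1)%VF.
  by apply: lker0_lfunK; apply/lker0P.
by split=> // y; case: fb => g _ gK; rewrite -(gK y) fK.
Qed.

Lemma dim_iso (k : fieldType) (aT rT : vectType k) (f : 'Hom(aT, rT)) :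
  bijective f -> \dim {:aT} = \dim {:rT}.
Proof.
move=> fb; have [fK Kf] := lfun_bij_inv fb.
rewrite -(@limg_dim_eq _ _ _ f fullv); last first.
  by apply/eqP; rewrite capfv; apply/lker0P; exact: bij_inj.
congr (\dim _); apply/vspaceP => y; rewrite memvf -(Kf y).
by rewrite memv_img ?memvf.
Qed.

Section RepIso.
Variables (k : fieldType) (T : graph).
Implicit Types M N P : rep k T.

Lemma rep_iso_sym M N : rep_iso M N -> rep_iso N M.
Proof.
case=> phi [pb pc]; exists (fun v => (phi v)^-1%VF); split=> [v|e x].
  by have [fK Kf] := lfun_bij_inv (pb v); exists (phi v).
have [fK Kf] := lfun_bij_inv (pb (src e)); have [gK Kg] := lfun_bij_inv (pb (tgt e)).
by rewrite -{1}(Kf x) -pc gK.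
Qed.

Lemma rep_iso_trans M N P : rep_iso M N -> rep_iso N P -> rep_iso M P.
Proof.
case=> f [fb fc] [g [gb gc]]; exists (fun v => (g v \o f v)%VF); split=> [v|e x].
  apply: (eq_bij (bij_comp (gb v) (fb v))) => x; by rewrite lfunE.
by rewrite !lfunE /= fc gc.
Qed.

Lemma stratum_iso M r N P : rep_iso N P -> stratum M r N = stratum M r P.
Proof.
move=> NP; apply/seteqP; split=> U [GU UN]; split=> //.
  exact: rep_iso_trans UN NP.
exact: rep_iso_trans UN (rep_iso_sym NP).
Qed.

Lemma rmap_subrep M U e (x : subrep M U (src e)) : subrepresentation M U ->
  vsval (rmap (subrep M U) e x) = rmap M e (vsval x).
Proof.
move=> sU; rewrite /= linfun_id; last by move=> a y z; rewrite !linearP.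
by rewrite vsprojK //; have /subvP := sU e; apply; apply: memv_img; exact: subvsP.
Qed.

Lemma stratum_Psum_sum M r m U (v : T) : stratum M r (Psum k m) U -> (\sum_u m u)%N = r.
Proof.
case=> -[_ Ur] [phi [pb _]]; rewrite -(Ur v) -(dim_Psum k m v) -(dim_iso (pb v)).
by rewrite dimvf.
Qed.

Lemma projective_coordinates M (m : T -> nat) d : rep_iso M (Psum k m) ->
  (\sum_v m v)%N = d -> exists (C : coordinates M d) (tg : 'I_d -> T),
  (forall e x, to_row C (tgt e) (rmap M e x) = to_row C (src e) x *m side_proj k tg e) /\
  (forall v, (\sum_j (tg j == v))%N = m v).
Proof.
case=> phi [pb pc] md; have [g gb] := exists_fibers md.
pose h v := linfun (fun y : Psum k m v => \row_j (y : {ffun _ -> k^o}) (g j)) : 'Hom(Psum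
  k m v, 'rV[k]_d).
have hE v y j : h v y 0 j = (y : {ffun _ -> k^o}) (g j).
  rewrite /h linfun_id ?mxE // => a x z; apply/rowP => l; by rewrite !mxE !ffunE.
pose to v := (h v \o phi v)%VF.
have tb v : bijective (to v).
  have hb : bijective (h v).
    have [g' gK Kg] := gb.
    exists (fun u : 'rV[k]_d => ([ffun p => u 0 (g' p)] : {ffun {v : T & 'I_(m v)} ->
      k^o})).
      by move=> y; apply/ffunP => p; rewrite ffunE hE Kg.
    by move=> u; apply/rowP => j; rewrite hE ffunE gK.
  apply: (eq_bij (bij_comp hb (pb v))) => x; by rewrite lfunE.
have toK v := (lfun_bij_inv (tb v)).1; have Kto v := (lfun_bij_inv (tb v)).2.
exists (Coordinates toK Kto), (fun j => tag (g j)); split; last exact: fibers_card.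
move=> e x; apply/rowP => j; rewrite mul_mx_sel /= !lfunE /= !hE pc rmap_Psum.
by case: ifP => _; rewrite ?mulr1n ?mulr0n.
Qed.

End RepIso.

Section StratumPsum.
Variables (k : closedFieldType) (T : graph) (M : rep k T) (r d : nat).
Hypothesis treeT : is_tree T.
Variables (C : coordinates M d) (tg : 'I_d -> T).
Hypothesis compat : forall e x,
  to_row C (tgt e) (rmap M e x) = to_row C (src e) x *m side_proj k tg e.
Variables (m : T -> nat) (g : 'I_r -> {v : T & 'I_(m v)}).
Hypothesis gb : bijective g.
Let o i := (tag (g i), tag (g i)).

(** [Prep u] is generated by its vector at [u]: along a geodesic leaving [u], the hypothesis
    computes the row at each vertex from the preceding one. *)
Lemma intertwiner_masked (X : T -> 'M[k]_(r, d)) :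
  (forall e, X (src e) *m side_proj k tg e =
     sel_mx (fun i => inside (o i) e) *m X (tgt e)) ->
  forall v, X v = masked tg o (\matrix_i row i (X (tag (g i)))) v.
Proof.
move=> XE v; apply/matrixP => i j; rewrite !mxE; set u := tag (g i).
have conn : connected T by case: treeT.
move En : (dist u v) => n; elim: n v En => [|n IHn] v En.
  have <- : u = v by apply/eqP; rewrite -dist_eq0 // En.
  by rewrite mask_vertex.
have uv : u != v by rewrite -dist_eq0 // En.
have [z zv dz] := dist_closer conn uv; pose e : arrow T := exist _ (z, v) zv.
have ue : u \in side e by rewrite mem_side //= /src /tgt /= dz.
have := congr1 (fun A : 'M_(r, d) => A i j) (XE e).
rewrite mul_mx_sel mul_sel_mx inside_vertex ue mulr1n => <-.
rewrite (IHn (src e)); last by move: dz; rewrite En => -[].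
rewrite -mulrnA mulnb (mask_inside treeT) inside_vertex ue; by [].
Qed.

(** An isomorphism with [Psum] carries the standard vectors to bases of the [U v] on which the maps
    act by selection of rows, that is to an intertwiner. Conversely, coordinates along independent
    masked rows form an isomorphism. *)
Lemma stratum_Psum : stratum M r (Psum k m) = model_stratum C tg o.
Proof.
apply/seteqP; split=> U.
  case=> GU [phi [pb pc]]; have [sU Ur] := GU.
  pose inv v := ((phi v)^-1)%VF; have iK v := (lfun_bij_inv (pb v)).1.
  have Ki v := (lfun_bij_inv (pb v)).2.
  pose X v : 'M[k]_(r, d) := \matrix_i to_row C v (vsval (inv v (Psum_delta k (g i)))).
  have XU v : U v = rowspan C v (X v).
    apply/vspaceP => x; rewrite mem_rowspan; apply/idP/idP => [xU|/submxP[a xa]].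
      have -> : x = vsval (inv v (phi v (vsproj (U v) x))) by rewrite iK vsprojK.
      rewrite [phi v _]Psum_sum_delta !linear_sum /=; apply: summx_sub => p _.
      rewrite !linearZ /= scalemx_sub //; case: gb => g' _ gK.
      by rewrite -(gK p); have := row_sub (g' p) (X v); rewrite rowK.
    have -> : x = \sum_i a 0 i *: vsval (inv v (Psum_delta k (g i))).
      apply: (can_inj (to_rowK C (v := v))); rewrite xa mulmx_sum_row linear_sum.
      by apply: eq_bigr => i _; rewrite rowK linearZ.
    by apply: memv_suml => i _; apply: memvZ; exact: subvsP.
  have XE e : X (src e) *m side_proj k tg e =
     sel_mx (fun i => inside (o i) e) *m X (tgt e).
    apply/row_matrixP => i; rewrite row_mul rowK -compat.
    rewrite -(rmap_subrep _ sU).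
    have -> : rmap (subrep M U) e (inv (src e) (Psum_delta k (g i))) =
       inv (tgt e) (if tag (g i) \in side e then Psum_delta k (g i) else 0).
      have := pc e (inv (src e) (Psum_delta k (g i))).
      by rewrite Ki rmap_Psum_delta => /(congr1 (inv (tgt e))); rewrite iK.
    apply/rowP => j; rewrite [RHS]mxE mul_sel_mx inside_vertex mxE.
    by case: ifP => _; rewrite // !linear0 mxE.
  exists (\matrix_i row i (X (tag (g i)))) => v.
  rewrite -(intertwiner_masked XE); split; last exact: XU.
  by rewrite /row_free -(dim_rowspan C v) -XU Ur.
move=> oU; have GU := model_stratum_Gr treeT compat oU; split=> //.
have [sU Ur] := GU; case: oU => w wU.
pose X := masked tg o w; have [g' gK Kg] := gb.
pose f v (y : subrep M U v) : Psum k m v :=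
  [ffun p => (to_row C v (vsval y) *m pinvmx (X v)) 0 (g' p)] : {ffun {v : T & 'I_(m v)}
    -> k^o}.
have fl v : linear (f v).
  move=> a y z; apply/ffunP => p; rewrite !ffunE.
  have -> : vsval (a *: y + z) = a *: vsval y + vsval z by [].
  by rewrite (linearP (to_row C v)) mulmxDl -scalemxAl [LHS]mxE; congr (_ + _); rewrite mxE.
have fE v y p : ((linfun (f v) : 'Hom(_, _)) y : {ffun {v : T & 'I_(m v)} -> k^o}) p =
    (to_row C v (vsval y) *m pinvmx (X v)) 0 (g' p).
  by rewrite linfun_id ?ffunE //; exact: fl.
have sub v (y : subrep M U v) : (to_row C v (vsval y) <= X v)%MS.
  by have [_ UX] := wU v; rewrite -(mem_rowspan C) -UX subvsP.
have pK v (a : 'rV[k]_r) : a *m X v *m pinvmx (X v) = a.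
  by have [Xf _] := wU v; apply: (row_free_inj Xf); rewrite mulmxKpV ?submxMl.
have memU v (a : 'rV[k]_r) : of_row C v (a *m X v) \in U v.
  by have [_ ->] := wU v; rewrite mem_rowspan of_rowK submxMl.
exists (fun v => linfun (f v)); split=> [v|e y].
  exists (fun x : {ffun {v : T & 'I_(m v)} -> k^o} =>
    vsproj (U v) (of_row C v ((\row_i x (g i)) *m X v))).
    move=> y; apply/val_inj; rewrite /= vsprojK ?memU //.
    apply: (can_inj (to_rowK C (v := v))); rewrite of_rowK -[RHS](mulmxKpV (sub v y)).
    congr (_ *m _); apply/rowP => i; rewrite mxE fE gK //.
  move=> x; apply/ffunP => p; rewrite fE vsprojK ?memU //.
  by rewrite of_rowK pK mxE Kg.
apply/ffunP => p; rewrite rmap_Psum !fE (rmap_subrep _ sU) compat.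
have /submxP[a ya] := sub (src e) y; rewrite ya pK -(mulmxA a (X (src e))) /X
  masked_compat // mulmxA pK.
rewrite mul_mx_sel inside_vertex Kg.
by case: ifP => _; rewrite ?mulr1n ?mulr0n.
Qed.

End StratumPsum.

(** * Chains of irreducible closed sets *)

Section BoundedDegree.
Variables (F : fieldType) (N : nat).
Implicit Types p q : {mpoly F[N]}.

Definition bounded_degree D p : Prop := forall m, m \in msupp p -> (mdeg m <= D)%N.

Lemma bounded_degree_exists p : exists D, bounded_degree D p.
Proof.
exists (\max_(m <- msupp p) mdeg m)%N => m mp.
by rewrite (big_rem m mp) leq_maxl.
Qed.

Lemma bounded_degree_mono D D' p :
  (D <= D')%N -> bounded_degree D p -> bounded_degree D' p.
Proof. by move=> DD dp m /dp le; exact: leq_trans DD. Qed.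

Lemma bounded_degree1 : bounded_degree 0 1.
Proof. by move=> m; rewrite msupp1 inE => /eqP->; rewrite mdeg0. Qed.

Lemma bounded_degreeM D D' p q :
  bounded_degree D p -> bounded_degree D' q -> bounded_degree (D + D') (p * q).
Proof.
move=> dp dq m /msuppM_le/allpairsP[[m1 m2] /= [/dp d1 /dq d2 ->]].
by rewrite mdegD leq_add.
Qed.

Lemma bounded_degreeX D p n : bounded_degree D p -> bounded_degree (n * D) (p ^+ n).
Proof.
move=> dp; elim: n => [|n IHn]; first by rewrite expr0; exact: bounded_degree1.
by rewrite exprS mulSn; exact: bounded_degreeM.
Qed.

(** The bound counts the box of monomials with every exponent at most [D]; it is larger than
    necessary but has the right order of growth. *)
Lemma independent_card (B : finType) (q : B -> {mpoly F[N]}) D :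
  (forall b, bounded_degree D (q b)) ->
  (forall c : B -> F, \sum_b c b *: q b = 0 -> forall b, c b = 0) ->
  (#|B| <= D.+1 ^ N)%N.
Proof.
move=> dq indep.
pose mon (a : {ffun 'I_N -> 'I_D.+1}) : 'X_{1.. N} := [multinom nat_of_ord (a i) | i < N].
pose Q := \matrix_(i < #|B|, j < #|{ffun 'I_N -> 'I_D.+1}|)
  (q (enum_val i))@_(mon (enum_val j)).
suff /eqP Qf : row_free Q.
  by have := rank_leq_col Q; rewrite Qf card_ffun !card_ord.
apply: inj_row_free => u uQ; apply/rowP => i; rewrite mxE.
suff /(_ (enum_val i)) : forall b, u 0 (enum_rank b) = 0 by rewrite enum_valK.
apply: indep; apply/mpolyP => m; rewrite mcoeff0 raddf_sum /=.
have [mD|mD] := leqP (mdeg m) D; last first.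
  apply: big1 => b _; rewrite mcoeffZ memN_msupp_eq0 ?mulr0 //.
  by apply/negP => /(dq b); rewrite leqNgt mD.
have le j : (m j < D.+1)%N.
  by rewrite ltnS; apply: leq_trans mD; rewrite mdegE (bigD1 j) //= leq_addr.
pose a : {ffun 'I_N -> 'I_D.+1} := [ffun j => Ordinal (le j)].
have -> : m = mon a by apply/mnmP => j; rewrite mnmE ffunE.
have := congr1 (fun A : 'rV_ _ => A 0 (enum_rank a)) uQ; rewrite !mxE => E.
rewrite -[RHS]E (reindex (fun l : 'I_#|B| => enum_val l)) /=; last first.
  by exists enum_rank => x _; rewrite ?enum_valK ?enum_rankK.
by apply: eq_bigr => l _; rewrite mcoeffZ !mxE enum_valK enum_rankK.
Qed.

End BoundedDegree.

Lemma exp_growth m N K : (forall t, t.+1 ^ m <= (t * K).+1 ^ N)%N -> (m <= N)%N.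
Proof.
move=> le; rewrite leqNgt; apply/negP => Nm.
(* For this [t], [(t K + 1)^N] is at most [(K + 1)^N (t + 1)^N], hence less than
   [(t + 1)^(N + 1)]. *)
have [t tE] : exists t, t = (K.+1 ^ N)%N by exists (K.+1 ^ N)%N.
have := le t; apply/negP; rewrite -ltnNge.
apply: (@leq_ltn_trans (K.+1 ^ N * t.+1 ^ N)%N).
  rewrite -expnMn; case: (N) => // N'; rewrite leq_exp2r //; lia.
apply: (@leq_trans (t.+1 ^ N.+1)%N); last by rewrite leq_pexp2l.
by rewrite expnS ltn_mul2r expn_gt0 /= -tE ltnSn.
Qed.

Section ChainBound.
Variables (k : closedFieldType) (T : graph) (M : rep k T) (r d : nat).
Variable C : coordinates M d.
Variables (N : nat) (X : T -> 'M[{mpoly k[N]}]_(r, d)).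
Local Notation pls := {mpoly k[#|{: pindex M r}|]}.
Implicit Types (v : T) (U : subtuple M) (p q : pls).

Definition family_at (z : 'I_N -> k) v : 'M[k]_(r, d) := map_mx (meval z) (X v).

Definition family_minors : #|{: pindex M r}|.-tuple {mpoly k[N]} :=
  [tuple (let j : pindex M r := enum_val i in
     \det (colsub (tagged j) (X (tag j) *m map_mx (@mpolyC N k) (coord_mx C (tag j)))))
  | i < #|{: pindex M r}|].

Definition pullback p : {mpoly k[N]} := p \mPo family_minors.

Lemma pullback_eval p z : (pullback p).@[z] = minor_eval C p (family_at z).
Proof.
rewrite comp_mpoly_meval /minor_eval; apply: meval_eq => i.
rewrite tnth_mktuple /minors -[LHS]/(meval z _) -det_map_mx; congr (\det _).
apply/matrixP => a b; rewrite !mxE rmorph_sum; apply: eq_bigr => l _.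
by rewrite rmorphM !mxE /= mevalC.
Qed.

Section Chain.
Variables (m : nat) (Z : nat -> set (subtuple M)).
Hypotheses (Zc : forall i, (i <= m)%N -> zclosed M r (Z i))
  (Zi : forall i, (i <= m)%N -> irreducible M r (Z i))
  (Zlt : forall i, (i < m)%N -> Z i `<` Z i.+1).

Lemma plucker_eval_sum (I : Type) (s : seq I) (c : I -> k) (q : I -> pls) U :
  plucker_eval (\sum_(i <- s) c i *: q i) U = \sum_(i <- s) c i * plucker_eval (q i) U.
Proof. by rewrite /plucker_eval raddf_sum; apply: eq_bigr => i _; rewrite /= mevalZ. Qed.

Lemma plucker_evalX p n U : plucker_eval (p ^+ n) U = plucker_eval p U ^+ n.
Proof. exact: rmorphXn. Qed.

(** The companion [u] is a product of powers of Pluecker coordinates nonzero at a point of [Z i].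
    Having the multidegree of [h], it makes all the products [h ^+ l * u ^+ (t - l)] of one
    multidegree. *)
Lemma separating_forms i : (i < m)%N -> exists (h u : pls) deg,
  [/\ multidegree deg h, multidegree deg u,
      forall U, Z i U -> plucker_eval h U = 0,
      exists2 U, Z i.+1 U & plucker_eval h U != 0 &
      exists2 U, Z i U & plucker_eval u U != 0].
Proof.
move=> im; have [sub nsub] := Zlt im; have [U0 ZU0] := (Zi (ltnW im)).1.
have [S [Sh ZS]] := Zc (ltnW im); have cZ := Zc im.
have [U1 [Z1 nZ1]] : exists U, Z i.+1 U /\ ~ Z i U.
  apply: contrapT => H; apply: nsub => U ZU; apply: contrapT => nU; apply: H; by exists U.
have [h Sph hU1] : exists2 h, S h & plucker_eval h U1 <> 0.
  apply: contrapT => H; apply: nZ1; rewrite ZS; split; first exact: zclosed_sub_Gr cZ _ Z1.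
  by move=> p Sp; apply: contrapT => pU; apply: H; exists p.
have [deg dh] := Sh h Sph.
have G0 : Gr M r U0 by apply: (zclosed_sub_Gr (Zc (ltnW im))).
have /choice[f fP] v : exists j : pindex M r, tag j = v /\ plucker U0 j != 0.
  have sp : spans C (rows_of r C U0) U0 by apply: spans_rows_of; case: G0.
  have [B Bu FE] := frameE v sp; have [free _] := sp v.
  apply: contrapT => H; have /row_freeP[Q XQ] := free.
  have : \det (frame r U0 v *m (coord_back C v *m Q)) = 0.
    rewrite det_mulmx_sum; apply: big1 => g _.
    have [->|ne] := eqVneq (\det (colsub g (frame r U0 v))) 0; first by rewrite mulr0.
    by case: H; exists (Tagged (fun v => {ffun 'I_r -> 'I_(\dim {:M v})}) g).
  apply/eqP; rewrite FE -(mulmxA _ (coord_mx C v)) (mulmxA (coord_mx C v)) coord_mxK mul1mx.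
  by rewrite -mulmxA XQ mulmx1 -unitfE -[_ \is a _]/(_ \in unitmx).
exists h, (\prod_v 'X_(enum_rank (f v)) ^+ deg v), deg; split=> //.
- by apply: multidegree_prod_var => v; case: (fP v).
- by move=> U; rewrite ZS => -[_]; exact.
- by exists U1 => //; apply/eqP.
- exists U0 => //; rewrite plucker_eval_prod_var; apply/prodf_neq0 => v _.
  by rewrite expf_neq0 //; case: (fP v).
Qed.

(* The monomials of bounded degree in [m] separating forms are independent on the
   largest member of the chain: the lowest power of the last form can be factored
   out, and the cofactor restricted to the previous member. *)
Lemma independent_forms i : (i <= m)%N -> exists K, forall t,
  exists (B : finType) (p : B -> pls) (deg : T -> nat),
  [/\ #|B| = (t.+1 ^ i)%N, forall b, multidegree deg (p b),
      forall b, bounded_degree (t * K) (pullback (p b)) &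
      forall c : B -> k,
        (forall U, Z i U -> \sum_b c b * plucker_eval (p b) U = 0) -> forall b, c b = 0].
Proof.
elim: i => [|i IHi] im.
  exists 0%N => t; exists unit, (fun=> 1), (fun=> 0%N); split.
  - by rewrite card_unit.
  - by move=> _; exact: (@multidegree1 k T M r).
  - by move=> _; rewrite muln0 /pullback rmorph1; exact: bounded_degree1.
  move=> c H [] ; have [U ZU] := (Zi im).1; have := H U ZU.
  by rewrite (bigD1 tt) //= big1 => [|[] //]; rewrite addr0 /plucker_eval rmorph1 mulr1.
have [K HK] := IHi (ltnW im).
have [h [u [dg [dh du h0 [U1 Z1 hU1] [U0 Z0 uU0]]]]] := separating_forms im.
have [D1 bD1] := bounded_degree_exists (pullback h).
have [D2 bD2] := bounded_degree_exists (pullback u).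
(* The pullback of [h ^+ l * u ^+ (t - l)] has degree at most [t (D1 + D2)], added to the bound
   [t K] of the previous level. *)
exists (K + (D1 + D2))%N => t; have [B [p [deg [cB dp bp indep]]]] := HK t.
pose P (x : B * 'I_t.+1) : pls := h ^+ x.2 * u ^+ (t - x.2) * p x.1.
have degP l s b : multidegree (fun v => (l + s) * dg v + deg v)%N (h ^+ l * u ^+ s * p b).
  move=> mm mP v; rewrite mulnDl.
  exact: (multidegreeM (multidegreeM (@multidegreeX _ _ _ _ _ _ l dh) (@multidegreeX _ _
    _ _ _ _ s du)) (dp b)) mP v.
exists (B * 'I_t.+1)%type, P, (fun v => t * dg v + deg v)%N; split.
- by rewrite card_prod cB card_ord expnSr.
- move=> [b l]; have lt : (l <= t)%N by rewrite -ltnS.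
  by have := degP l (t - l)%N b; rewrite subnKC.
- move=> [b l]; rewrite /P /pullback !rmorphM !rmorphXn /=.
  apply: (@bounded_degree_mono _ _ (l * D1 + (t - l) * D2 + t * K)%N).
    by rewrite !mulnDr [leqLHS]addnC leq_add2l leq_add // leq_mul2r ?leq_subr ?orbT //
      -ltnS ltn_ord orbT.
  by do 2?apply: bounded_degreeM; rewrite ?bp //; exact: bounded_degreeX.
move=> c cZ; suff H l : forall b, c (b, l) = 0 by move=> [b l]; exact: H.
have GZ1 := zclosed_sub_Gr (Zc im); have GZ := zclosed_sub_Gr (Zc (ltnW im)).
have [ltl] := ubnP (nat_of_ord l); elim: ltl l => // ltl IHl l; rewrite ltnS => lle.
have {}IHl (l' : 'I_t.+1) b : (l' < l)%N -> c (b, l') = 0.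
  by move=> l'l; apply: IHl; exact: leq_trans lle.
(* The relation divided by [h ^+ l], where [l] is the lowest exponent not yet treated;
   irreducibility of [Z i.+1] allows the division. *)
pose Q : pls := \sum_(x : B * 'I_t.+1 | (l <= x.2)%N)
  c x *: (h ^+ (x.2 - l) * u ^+ (t - x.2) * p x.1).
have dQ : multidegree (fun v => (t - l) * dg v + deg v)%N Q.
  rewrite /Q big_mkcond; apply: multidegree_sum => -[b x] /=; case: ifP => lx; last first.
    exact: multidegree0.
  apply: multidegreeZ; have := degP (x - l)%N (t - x)%N b.
  by have -> : (x - l + (t - x) = t - l)%N by have := ltn_ord x; lia.
have hQ U : Z i.+1 U -> plucker_eval (h ^+ l * Q) U = 0.
  move=> ZU; rewrite -[RHS](cZ U ZU) plucker_evalM /Q big_mkcond plucker_evalX.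
  rewrite (eq_bigr (fun x : B * 'I_t.+1 => (if (l <= x.2)%N then c x else 0) *:
    (h ^+ (x.2 - l) * u ^+ (t - x.2) * p x.1))); last first.
    by move=> x _; case: ifP => // _; rewrite scale0r.
  rewrite plucker_eval_sum mulr_sumr; apply: eq_bigr => -[b x] _ /=.
  case: leqP => lx; last by rewrite IHl // !mul0r mulr0.
  rewrite mulrCA !plucker_evalM !plucker_evalX; congr (_ * _).
  by rewrite !mulrA -exprD subnKC.
have dhl := multidegree_homogeneous (@multidegreeX _ _ _ _ _ _ l dh).
have [H|QZ] := irreducible_mul GZ1 (Zi im) dhl (multidegree_homogeneous dQ) hQ.
  by have := H U1 Z1; rewrite plucker_evalX => /eqP; rewrite expf_eq0 (negPf hU1) andbF.
pose q : pls := \sum_b c (b, l) *: p b.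
have dq : multidegree deg q by apply: multidegree_sum => b; apply: multidegreeZ.
(* On [Z i] the form [h] vanishes, so only the terms of exponent [l] survive; irreducibility of
   [Z i] then removes the power of [u]. *)
have uq U : Z i U -> plucker_eval (u ^+ (t - l) * q) U = 0.
  move=> ZU; rewrite -[RHS](QZ U ((Zlt im).1 U ZU)) /Q big_mkcond.
  rewrite (eq_bigr (fun x : B * 'I_t.+1 => (if (l <= x.2)%N then c x else 0) *:
    (h ^+ (x.2 - l) * u ^+ (t - x.2) * p x.1))); last first.
    by move=> x _; case: ifP => // _; rewrite scale0r.
  rewrite plucker_eval_sum plucker_evalM /q plucker_eval_sum plucker_evalX mulr_sumr.
  transitivity (\sum_b \sum_(x < t.+1) (if (l <= x)%N then c (b, x) else 0) *
    plucker_eval (h ^+ (x - l) * u ^+ (t - x) * p b) U); last first.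
    by rewrite pair_bigA; apply: eq_bigr => -[b x].
  apply: eq_bigr => b _; rewrite (bigD1 l) //= leqnn subnn expr0 mul1r.
  rewrite plucker_evalM plucker_evalX mulrCA big1 ?addr0 // => x xl.
  case: leqP => lx; last by rewrite mul0r.
  have {}lx : (0 < x - l)%N by rewrite subn_gt0 ltn_neqAle lx andbT eq_sym.
  by rewrite !plucker_evalM plucker_evalX h0 // expr0n gtn_eqF // !mul0r mulr0.
have dul := multidegree_homogeneous (@multidegreeX _ _ _ _ _ _ (t - l) du).
have [H|qZ] := irreducible_mul GZ (Zi (ltnW im)) dul (multidegree_homogeneous dq) uq.
  by have := H U0 Z0; rewrite plucker_evalX => /eqP; rewrite expf_eq0 (negPf uU0) andbF.
by apply: indep => U /qZ; rewrite /q plucker_eval_sum.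
Qed.

End Chain.

(** A linear relation among the pullbacks is a form vanishing on [A], hence on its closure and on
    the top of the chain, where the forms are independent. *)
Lemma chain_bound (A : set (subtuple M)) m Z : A `<=` Gr M r ->
  (forall U, A U -> exists z, spans C (family_at z) U) ->
  irreducible_chain M r (zclosure M r A) m Z -> (m <= N)%N.
Proof.
move=> AG Apar [chain Zlt].
have Zc i : (i <= m)%N -> zclosed M r (Z i) by move=> /chain[].
have Zi i : (i <= m)%N -> irreducible M r (Z i) by move=> /chain[].
have [K HK] := independent_forms Zc Zi Zlt (leqnn m).
apply: (@exp_growth _ _ K) => t; have [B [p [deg [<- dp bp indep]]]] := HK t.
apply: (independent_card bp) => c c0; apply: indep => U ZU.
have [_ _ /(_ U ZU)/(zclosureP _ AG)[_]] := chain m (leqnn m).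
rewrite -(plucker_eval_sum _ c p); apply.
  by apply: (@multidegree_homogeneous _ _ _ _ deg); apply: multidegree_sum => b;
    exact: multidegreeZ.
move=> W /Apar[z zW]; apply/(plucker_eval_minors _ zW).
  by apply: (@multidegree_homogeneous _ _ _ _ deg); apply: multidegree_sum => b;
    exact: multidegreeZ.
rewrite -pullback_eval; suff -> : pullback (\sum_b c b *: p b) = 0 by rewrite meval0.
by rewrite -c0 /pullback raddf_sum; apply: eq_bigr => b _; exact: comp_mpolyZ.
Qed.

End ChainBound.

(** * A slice of the stratum *)

Lemma row_free_complement (F : fieldType) r n (A : 'M[F]_(r, r + n)) : row_free A ->
  exists (B : 'M_(n, r + n)) (P : 'M_(r + n, r)) (Q : 'M_(r + n, n)),
  [/\ A *m P = 1%:M, A *m Q = 0, B *m P = 0, B *m Q = 1%:M & P *m A + Q *m B = 1%:M].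
Proof.
move=> /eqP rA; have Ru := row_ebase_unit A; have Lu := col_ebase_unit A.
have EA : A = col_ebase A *m usubmx (row_ebase A).
  rewrite -{1}(mulmx_ebase A) rA pid_mx_row -mulmxA; congr (_ *m _).
  by rewrite -{1}(vsubmxK (row_ebase A)) mul_row_col mul1mx mul0mx addr0.
pose B := dsubmx (row_ebase A); pose D := col_mx A B.
have Du : D \in unitmx.
  have -> : D = block_mx (col_ebase A) 0 0 1%:M *m row_ebase A.
    rewrite -{1}(vsubmxK (row_ebase A)) mul_block_col /D {1}EA /B.
    by rewrite !mul0mx addr0 add0r mul1mx.
  by rewrite unitmx_mul Ru andbT unitmxE det_ublock det1 mulr1 -unitmxE.
exists B, (lsubmx (invmx D)), (rsubmx (invmx D)).
have := mulmxV Du; rewrite -{1}(hsubmxK (invmx D)) mul_col_row scalar_mx_block.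
move/eq_block_mx => [E1 E2 E3 E4]; split=> //.
by rewrite -mul_row_col hsubmxK -[col_mx _ _]/D mulVmx // scalar_mx_block.
Qed.

Section Slice.
Variables (k : closedFieldType) (T : graph) (M : rep k T) (r n : nat).
Hypothesis treeT : is_tree T.
Variables (C : coordinates M (r + n)) (tg : 'I_(r + n) -> T).
Hypothesis compat : forall e x,
  to_row C (tgt e) (rmap M e x) = to_row C (src e) x *m side_proj k tg e.
Variable u : 'I_r -> T.
Let o i := (u i, u i).
Variable w0 : 'M[k]_(r, r + n).
Hypothesis w0_free : forall v, row_free (masked tg o w0 v).
Implicit Types (v : T) (U : subtuple M) (z : 'M[k]_(r, n)).

Lemma masked_row (w : 'M[k]_(r, r + n)) i v : v = u i -> row i (masked tg o w v) = row i w.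
Proof. by move=> ->; apply/rowP => j; rewrite !mxE mask_vertex. Qed.

Variables (B : T -> 'M[k]_(n, r + n)) (P : T -> 'M[k]_(r + n, r))
  (Q : T -> 'M[k]_(r + n, n)).
Hypotheses (XP : forall v, masked tg o w0 v *m P v = 1%:M)
  (XQ : forall v, masked tg o w0 v *m Q v = 0)
  (BP : forall v, B v *m P v = 0) (BQ : forall v, B v *m Q v = 1%:M)
  (PQ : forall v, P v *m masked tg o w0 v + Q v *m B v = 1%:M).

(** Row [i] lives at [u i] and is moved only along the complement [B (u i)] of the space spanned
    there by [w0], as in an affine chart of a Grassmannian. *)
Definition slice_dir z : 'M[k]_(r, r + n) := \matrix_i (row i z *m B (u i)).

(** [I] is the number of coordinates allowed to be nonzero, in the order of [mxvec]; at [I = r * n]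
    there is no restriction, and growing [I] gives the chain. *)
Definition slice (I : nat) : set (subtuple M) :=
  [set U | exists2 z : 'M[k]_(r, n), (forall i c, (I <= mxvec_index i c)%N -> z i c = 0) &
    spans C (masked tg o (w0 + slice_dir z)) U].

Lemma slice_sub I : slice I `<=` model_stratum C tg o.
Proof. by move=> U [z _ zU]; exists (w0 + slice_dir z). Qed.

Lemma slice_Gr I : slice I `<=` Gr M r.
Proof. by move=> U /slice_sub; exact: (model_stratum_Gr treeT compat). Qed.

Lemma slice_dirE z i j : slice_dir z i j = (z *m B (u i)) i j.
Proof. by rewrite mxE -row_mul mxE. Qed.

Lemma slice_dirD z s z' : slice_dir (z + s *: z') = slice_dir z + s *: slice_dir z'.
Proof.
apply/matrixP => i j; rewrite [RHS]mxE [X in _ = _ + X]mxE !slice_dirE.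
by rewrite mulmxDl -scalemxAl [LHS]mxE; congr (_ + _); rewrite mxE.
Qed.

Lemma slice_dirZ s z : slice_dir (s *: z) = s *: slice_dir z.
Proof.
by apply/matrixP => i j; rewrite [RHS]mxE !slice_dirE -scalemxAl [LHS]mxE.
Qed.

Lemma slice_mono I J : (I <= J)%N -> slice I `<=` slice J.
Proof.
move=> IJ U [z z0 zU]; exists z => // i c le; apply: z0; exact: leq_trans le.
Qed.

Lemma slice0 I : slice I (fun v => rowspan C v (masked tg o w0 v)).
Proof.
exists 0 => [i c _|v]; first by rewrite mxE.
suff -> : slice_dir 0 = 0 by rewrite addr0.
by apply/row_matrixP => i; rewrite rowK !row0 mul0mx.
Qed.

Lemma slice_irreducible I : irreducible M r (slice I).
Proof.
apply: (@curve_irreducible _ _ _ _ _ C); first exact: slice_Gr.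
  by exists (fun v => rowspan C v (masked tg o w0 v)); exact: slice0.
move=> U U' [z z0 zU] [z' z0' zU'].
pose X := pencil (masked tg o (w0 + slice_dir z)) (masked tg o (slice_dir (z' - z))).
have XE s v : at_param X s v = masked tg o (w0 + slice_dir (z + s *: (z' - z))) v.
  by rewrite pencil_at slice_dirD addrA maskedD.
have X0 v : at_param X 0 v = masked tg o (w0 + slice_dir z) v by rewrite XE scale0r addr0.
have X1 v : at_param X 1 v = masked tg o (w0 + slice_dir z') v.
  by rewrite XE scale1r addrC [z + _]addrC subrK addrC.
exists X; split.
- have [|g g0 gs] := @rows_free_generic _ _ _ _ X 0; first by move=> v; rewrite X0;
  case: (zU v).
  exists g; first exact: poly_neq0_horner g0.
  move=> s /gs free; exists (fun v => rowspan C v (at_param X s v)) => //.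
  exists (z + s *: (z' - z)) => [i c le|v]; last by rewrite -XE.
  by rewrite !mxE z0 // z0' // subr0 mulr0 addr0.
- by exists 0 => v; rewrite X0.
- by exists 1 => v; rewrite X1.
Qed.

(* Chosen so that each slice coordinate is a ratio of two forms in the minors. *)
Definition replaced_col i c : 'M[k]_(r + n, r) :=
  \matrix_(a, b) if b == i then Q (u i) a c else P (u i) a b.

(** At [u i] only row [i] is explicit, the other rows being transported from elsewhere. In
    [X *m P (u i)] it is a unit vector, so both determinants expand along it into the same
    cofactor. *)
Lemma slice_coordinate z i c :
  \det (masked tg o (w0 + slice_dir z) (u i) *m replaced_col i c) =
  z i c * \det (masked tg o (w0 + slice_dir z) (u i) *m P (u i)).
Proof.
set X := masked tg o _ _.
have Xrow : row i X = row i (masked tg o w0 (u i)) + row i z *m B (u i).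
  by rewrite !masked_row // linearD /= rowK.
have rowP : row i (X *m P (u i)) = row i 1%:M.
  by rewrite row_mul Xrow mulmxDl -mulmxA BP mulmx0 addr0 -row_mul XP.
have rowQ : row i (X *m Q (u i)) = row i z.
  by rewrite row_mul Xrow mulmxDl -mulmxA BQ mulmx1 -row_mul XQ row0 add0r.
have colE a b : (X *m replaced_col i c) a b =
    if b == i then (X *m Q (u i)) a c else (X *m P (u i)) a b.
  rewrite mxE; case: ifP => bi; rewrite [RHS]mxE; apply: eq_bigr => l _;
    by rewrite [replaced_col _ _ _ _]mxE bi.
have rowPE b : (X *m P (u i)) i b = (i == b)%:R.
  by have := congr1 (fun A : 'rV_r => A 0 b) rowP; rewrite !mxE.
rewrite (expand_det_row _ i) (bigD1 i) //= big1 ?addr0; last first.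
  by move=> b bi; rewrite colE (negPf bi) rowPE eq_sym (negPf bi) mul0r.
rewrite [X in _ = _ * X](expand_det_row _ i) [X in _ = _ * X](bigD1 i) //= big1 ?addr0;
  last first.
  by move=> b bi; rewrite rowPE eq_sym (negPf bi) mul0r.
rewrite colE eqxx rowPE eqxx mul1r.
have -> : (X *m Q (u i)) i c = z i c.
  by have := congr1 (fun A : 'rV_n => A 0 c) rowQ; rewrite !mxE.
congr (_ * _); rewrite /cofactor; congr (_ * \det _).
have cof (A : 'M[k]_r) a b : row' i (col' i A) a b = A (lift i a) (lift i b).
  by rewrite !mxE.
by apply/matrixP => a b; rewrite !cof colE eq_sym (negPf (neq_lift i b)).
Qed.

Lemma slice_strict I : (I < r * n)%N ->
  zclosure M r (slice I) `<` zclosure M r (slice I.+1).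
Proof.
move=> Irn; split; first by apply: zclosure_mono; exact: slice_mono.
move El : (Ordinal Irn) => l sub; case/mxvec_indexP: l El => i c El.
have Iic : (mxvec_index i c : nat) = I by rewrite -El.
pose q := det_form C (u i) (replaced_col i c).
have qh : multihomogeneous q by exists (fun v => u i == v); exact: det_form_degree.
have q0 W : slice I W -> plucker_eval q W = 0.
  case=> z z0 zW; apply/(plucker_eval_minors qh zW).
  by rewrite det_form_eval slice_coordinate (z0 i c) ?mul0r // Iic.
pose X := pencil (masked tg o w0) (masked tg o (slice_dir (delta_mx i c))).
have XE s v : at_param X s v = masked tg o (w0 + slice_dir (s *: delta_mx i c)) v.
  by rewrite pencil_at -maskedD slice_dirZ.
have X0 v : at_param X 0 v = masked tg o w0 v by rewrite pencil_at scale0r addr0.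
have [|g g0 gs] := @rows_free_generic _ _ _ _ X 0; first by move=> v; rewrite X0.
pose f := \det (X (u i) *m map_mx polyC (P (u i))).
have fE s : f.[s] = \det (at_param X s (u i) *m P (u i)).
  rewrite -[LHS]/(horner_eval s _) -det_map_mx map_mxM; congr (\det (_ *m _)).
  by apply/matrixP => a b; rewrite !mxE /= /horner_eval hornerC.
have f0 : f != 0 by apply: (@poly_neq0_horner _ _ 0); rewrite fE X0 XP det1 oner_eq0.
have /closed_nonrootP[s] : 'X * (f * g) != 0.
  by rewrite !mulf_neq0 ?polyX_eq0 //; exact: poly_neq0_horner g0.
rewrite rootE !hornerM hornerX !mulf_eq0 !negb_or => /and3P[s0 fs /gs free].
pose W v := rowspan C v (at_param X s v).
have WX : spans C (masked tg o (w0 + slice_dir (s *: delta_mx i c))) W.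
  by move=> v; rewrite -XE.
have /sub/(zclosureP _ (@slice_Gr I))[_ /(_ q qh q0)] : zclosure M r (slice I.+1) W.
  apply: sub_zclosure; exists (s *: delta_mx i c) => // a b le; rewrite !mxE.
  case: eqP => [ai|_]; last by rewrite mulr0.
  case: eqP => [bc|_]; last by rewrite mulr0.
  by move: le; rewrite ai bc Iic ltnn.
move/(plucker_eval_minors qh WX)/eqP; rewrite det_form_eval slice_coordinate.
rewrite mulf_eq0 -XE -fE (negPf fs) orbF !mxE !eqxx mulr1.
by rewrite (negPf s0).
Qed.

Lemma path_image U (X : T -> 'M[k]_(r, r + n)) m (x : 'M[k]_(m, r + n)) a v :
  Gr M r U -> spans C X U -> (x <= X a)%MS ->
  (x *m sel_mx (fun j => mask (a, a) v (tg j)) <= X v)%MS.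
Proof.
move=> [sU _] XU xa; have conn : connected T by case: treeT.
have step e : (X (src e) *m side_proj k tg e <= X (tgt e))%MS.
  have := sU e; have [_ ->] := XU (src e); have [_ ->] := XU (tgt e).
  by rewrite (rowspan_image compat) rowspan_sub.
move Em : (dist a v) => l; elim: l v Em => [|l IHl] v Em.
  have <- : a = v by apply/eqP; rewrite -dist_eq0 // Em.
  rewrite (_ : sel_mx _ = 1%:M) ?mulmx1 //; apply/matrixP => i j; rewrite !mxE.
  by case: eqP => [->|//]; rewrite mask_vertex.
have av : a != v by rewrite -dist_eq0 // Em.
have [z zv dz] := dist_closer conn av; pose e : arrow T := exist _ (z, v) zv.
have ae : a \in side e by rewrite mem_side //= /src /tgt /= dz.
have -> : sel_mx (fun j => mask (a, a) v (tg j)) =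
    sel_mx (fun j => mask (a, a) z (tg j)) *m side_proj k tg e.
  rewrite sel_mxM; apply/matrixP => i j; rewrite !mxE /=.
  by have := mask_inside treeT (a, a) e (tg i); rewrite inside_vertex ae /= => <-.
rewrite mulmxA; apply: submx_trans (step e); apply: submxMr; apply: IHl.
by move: dz; rewrite Em => -[].
Qed.

(* Near [w0] every point of the stratum has a basis normalized by the [P v]:
   multiply by the adjugate of the matrix of coordinates along [P v]. *)
Lemma slice_dense : model_stratum C tg o `<=` zclosure M r (slice (r * n)).
Proof.
move=> U' oU'; have [w' wU'] := oU'.
pose X := pencil (masked tg o w0) (masked tg o (w' - w0)).
have XE s v : at_param X s v = masked tg o (w0 + s *: (w' - w0)) v.
  by rewrite pencil_at -maskedD.
have X0 v : at_param X 0 v = masked tg o w0 v by rewrite pencil_at scale0r addr0.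
pose G v := X v *m map_mx polyC (P v).
have GE s v : map_mx (horner_eval s) (G v) = at_param X s v *m P v.
  rewrite map_mxM; congr (_ *m _).
  by apply/matrixP => a b; rewrite !mxE /= /horner_eval hornerC.
have G0 v : map_mx (horner_eval 0) (G v) = 1%:M by rewrite GE X0 XP.
(* The adjugate stands for the inverse in order to keep polynomial entries. Masking its rows afresh
   may destroy independence, but not at 0, hence not generically. *)
pose Y v : 'M[{poly k}]_(r, r + n) := \matrix_(i, j)
  ((\adj (G (u i)) *m X (u i)) i j *+ mask (o i) v (tg j)).
pose y s : 'M[k]_(r, r + n) := \matrix_(i, j)
  (\adj (at_param X s (u i) *m P (u i)) *m at_param X s (u i)) i j.
have YE s v : at_param Y s v = masked tg o (y s) v.
  apply/matrixP => i j; rewrite [LHS]mxE [in LHS]mxE [RHS]mxE [in RHS]mxE raddfMn /=.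
  congr (_ *+ _); rewrite -GE -map_mx_adj -map_mxM [RHS]mxE; by [].
have Y0 v : at_param Y 0 v = masked tg o w0 v.
  rewrite YE; apply/matrixP => i j; rewrite [LHS]mxE [in LHS]mxE [RHS]mxE.
  rewrite X0 XP adj1 mul1mx mxE mask_vertex //.
have [|f f0 fs] := @rows_free_generic _ _ _ _ X 0; first by move=> v; rewrite X0.
have [|g g0 gs] := @rows_free_generic _ _ _ _ Y 0; first by move=> v; rewrite Y0.
pose h := \prod_v \det (G v).
have h0 : h != 0.
  apply/prodf_neq0 => v _; apply: (@poly_neq0_horner _ _ 0).
  by rewrite -[_.[_]]/(horner_eval 0 _) -det_map_mx G0 det1 oner_eq0.
apply: (@curve_zclosure _ _ _ _ _ C _ X 1); first exact: slice_Gr.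
- exact: model_stratum_Gr oU'.
- exists (f * (g * h)); first by rewrite !mulf_neq0 //;
  [exact: poly_neq0_horner f0|exact: poly_neq0_horner g0].
  move=> s; rewrite !hornerM !mulf_eq0 !negb_or => /and3P[/fs Xf /gs Yf].
  rewrite horner_prod => /prodf_neq0 dG.
  have {}dG v : \det (at_param X s v *m P v) != 0.
    by have := dG v isT; rewrite -GE det_map_mx.
  pose W v := rowspan C v (at_param X s v).
  have XW : spans C (at_param X s) W by [].
  have oW : model_stratum C tg o W by exists (w0 + s *: (w' - w0)) => v; rewrite -XE.
  have GW := model_stratum_Gr treeT compat oW.
  exists W => //.
  pose dt i := \det (at_param X s (u i) *m P (u i)).
  pose y1 : 'M[k]_(r, r + n) := \matrix_i ((dt i)^-1 *: row i (y s)).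
  have rowy i : row i (y s) =
      row i (\adj (at_param X s (u i) *m P (u i)) *m at_param X s (u i)).
    by apply/rowP => j; rewrite !mxE.
  have y1P i : row i y1 *m P (u i) = row i (masked tg o w0 (u i)) *m P (u i).
    rewrite rowK rowy -scalemxAl -row_mul -mulmxA mul_adj_mx -/(dt i).
    rewrite -row_mul XP; apply/rowP => j; rewrite !mxE.
    by rewrite mulrnAr mulVf // dG.
  (* [y1] and [w0] have the same components along [P (u i)], so their rows differ by a combination
     of the rows of [B (u i)], whose coefficients are read by [Q (u i)]. *)
  pose z : 'M[k]_(r, n) := \matrix_i ((row i y1 - row i w0) *m Q (u i)).
  have zE : w0 + slice_dir z = y1.
    apply/row_matrixP => i; rewrite linearD /= rowK rowK.
    have w0E : row i w0 = row i (masked tg o w0 (u i)) by rewrite masked_row.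
    rewrite -mulmxA -[row i y1 in RHS](subrK (row i w0)) [RHS]addrC; congr (_ + _).
    have key : (row i y1 - row i w0) *m P (u i) = 0 by rewrite mulmxBl y1P w0E subrr.
    by rewrite -[RHS]mulmx1 -(PQ (u i)) mulmxDr [X in _ = X + _]mulmxA key mul0mx add0r.
  have y1E v : masked tg o y1 v = diag_mx (\row_i (dt i)^-1) *m masked tg o (y s) v.
    by apply/matrixP => i j; rewrite mul_diag_mx !mxE mulrnAr.
  have du : diag_mx (\row_i (dt i)^-1) \in unitmx.
    rewrite unitmxE det_diag unitfE; apply/prodf_neq0 => i _.
    by rewrite mxE invr_eq0 dG.
  have y1f v : row_free (masked tg o y1 v).
    by rewrite y1E /row_free mxrankMfree // ?mxrank_unit // -YE.
  exists z => [i c|v]; first by rewrite leqNgt ltn_ord.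
  rewrite zE; split; first exact: y1f.
  (* Each row belongs to the subrepresentation at its own vertex and is transported inside it;
     equality of the spans follows from equal ranks. *)
  have sub : (masked tg o y1 v <= at_param X s v)%MS.
    apply/row_subP => i.
    have -> : row i (masked tg o y1 v) =
        row i y1 *m sel_mx (fun j => mask (u i, u i) v (tg j)).
      by apply/rowP => j; rewrite mul_mx_sel !mxE.
    apply: (path_image v GW XW); rewrite rowK rowy scalemx_sub // row_mul.
    exact: submxMl.
  apply: rowspan_eq; rewrite andbC sub /= -(mxrank_leqif_sup sub).
  by rewrite (eqP (y1f v)) (eqP (Xf v)).
- by move=> v; rewrite XE scale1r addrC subrK.
Qed.

Lemma slice_dimension : has_dimension M r (zclosure M r (model_stratum C tg o)) (r * n).
Proof.
have SG := model_stratum_Gr treeT compat (o := o).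
split.
  exists (fun I => zclosure M r (slice I)); split=> [I _|I]; last exact: slice_strict.
  split; first by apply: zclosed_zclosure; exact: slice_Gr.
    by apply: irreducible_zclosure; [exact: slice_Gr | exact: slice_irreducible].
  by apply: zclosure_mono; exact: slice_sub.
move=> m Z [chain Zlt].
pose zX : 'M[{mpoly k[r * n]}]_(r, n) := \matrix_(i, c) 'X_(mxvec_index i c).
pose X v : 'M[{mpoly k[r * n]}]_(r, r + n) := \matrix_(i, j)
  (((w0 i j)%:MP + (zX *m map_mx (@mpolyC _ k) (B (u i))) i j) *+ mask (o i) v (tg j)).
apply: (@chain_bound _ _ _ _ _ C _ X (slice (r * n)) m Z); first exact: slice_Gr.
  move=> U [z _ zU]; exists (fun l => mxvec z 0 l) => v.
  suff -> : family_at X (fun l => mxvec z 0 l) v = masked tg o (w0 + slice_dir z) v by [].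
  apply/matrixP => i j; rewrite [LHS]mxE [in LHS]mxE [RHS]mxE raddfMn /=; congr (_ *+ _).
  rewrite mevalD mevalC [RHS]mxE slice_dirE !mxE; congr (_ + _).
  rewrite raddf_sum /=; apply: eq_bigr => l _.
  by rewrite mevalM !mxE mevalXU mxvecE mevalC.
split=> // I Im; have [cZ iZ sZ] := chain I Im; split=> //.
apply: subset_trans sZ _; apply: zclosure_min slice_dense.
by apply: zclosed_zclosure; exact: slice_Gr.
Qed.

End Slice.

Lemma model_stratum_dimension (k : closedFieldType) (T : graph) (M : rep k T) r n
    (treeT : is_tree T) (C : coordinates M (r + n)) (tg : 'I_(r + n) -> T)
    (compat : forall e x,
      to_row C (tgt e) (rmap M e x) = to_row C (src e) x *m side_proj k tg e)
    (u : 'I_r -> T) :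
  model_stratum C tg (fun i => (u i, u i)) !=set0 ->
  has_dimension M r (zclosure M r (model_stratum C tg (fun i => (u i, u i)))) (r * n).
Proof.
case=> U [w0 wU]; have w0_free v := (wU v).1.
have /choice[B] v := row_free_complement (w0_free v).
move=> /choice[P] /choice[Q] H.
by apply: (@slice_dimension _ _ _ _ _ treeT C tg compat u w0 w0_free B P Q);
  move=> v; case: (H v).
Qed.

(** * The theorem for projective representations of trees *)

Section ProjectiveGrassmannian.
Variables (k : closedFieldType) (T : graph) (M : rep k T) (r n : nat).
Hypotheses (treeT : is_tree T) (T0 : (0 < #|T|)%N).
Variables (C : coordinates M (r + n)) (tg : 'I_(r + n) -> T) (dd : T -> nat).
Hypothesis compat : forall e x,
  to_row C (tgt e) (rmap M e x) = to_row C (src e) x *m side_proj k tg e.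
Hypothesis tg_dd : forall v, (\sum_j (tg j == v))%N = dd v.
Implicit Types (e : arrow T) (v : T) (U : subtuple M) (rr : T -> nat) (u : 'I_r -> T).
Local Notation stratum_at u := (model_stratum C tg (fun i => (u i, u i))).
Local Notation Sc N := (zclosure M r (stratum M r N)).

Let some_vertex : exists v : T, True.
Proof. by have /card_gt0P[v _] := T0; exists v. Qed.

Lemma side_count e : (\sum_j (tg j \in side e))%N = (\sum_(v in side e) dd v)%N.
Proof.
rewrite -(@inside_count_vertices T (r + n) (fun j => (tg j, tg j)) dd) //.
  by apply: eq_bigr => j _; rewrite inside_vertex.
by move=> v; rewrite -tg_dd; apply: eq_bigr => j _; rewrite xpair_eqE andbb.
Qed.

Lemma model_stratum_count (o o' : 'I_r -> T * T) :
  (forall i, (o i).1 = (o i).2) -> (forall i, (o' i).1 = (o' i).2) ->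
  inside_count o =1 inside_count o' -> model_stratum C tg o = model_stratum C tg o'.
Proof.
move=> ov ov' E; apply/seteqP; split.
  have [s so] := vertex_fibers treeT ov' ov (fun e => esym (E e)).
  rewrite (_ : o' = o \o s); first exact: model_stratum_perm.
  by apply/funext => i; rewrite so.
have [s so] := vertex_fibers treeT ov ov' E.
rewrite (_ : o = o' \o s); first exact: model_stratum_perm.
by apply/funext => i; rewrite so.
Qed.

Lemma stratum_vertices rr : (\sum_v rr v)%N = r -> exists u,
  stratum M r (Psum k rr) = stratum_at u /\
  forall e, inside_count (fun i => (u i, u i)) e = (\sum_(v in side e) rr v)%N.
Proof.
move=> rrr; have [g gb] := exists_fibers rrr; exists (fun i => tag (g i)).
split; first exact: stratum_Psum.
apply: inside_count_vertices => // v; rewrite -(fibers_card gb).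
by apply: eq_bigr => i _; rewrite xpair_eqE andbb.
Qed.

Lemma stratum_of_vertices u : exists rr, (\sum_v rr v)%N = r /\
  stratum M r (Psum k rr) = stratum_at u.
Proof.
pose rr v := (\sum_i (u i == v))%N; exists rr.
have rrr : (\sum_v rr v)%N = r.
  rewrite exchange_big -[RHS]card_ord -sum1_card; apply: eq_bigr => i _.
  by rewrite (bigD1 (u i)) //= eqxx big1 // => v /negPf; rewrite eq_sym => ->.
split=> //; have [u' [-> uu']] := stratum_vertices rrr.
apply: model_stratum_count => // e; rewrite uu' (@inside_count_vertices _ _ _ rr) // => v.
by apply: eq_bigr => i _; rewrite xpair_eqE andbb.
Qed.

Lemma side_sum_rev rr e : (\sum_v rr v = r ->
  \sum_(v in side e) rr v + \sum_(v in side (rev_arrow e)) rr v = r)%N.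
Proof.
move=> <-; rewrite [RHS](bigID (fun v => v \in side e)) /=; congr (_ + _)%N.
by apply: eq_bigl => v; rewrite side_rev.
Qed.

Lemma Phi_imageP (D : arrow T -> nat) : (Phi M @` Gr M r) D <->
  (forall e, [/\ 0 <= (D e)%:Z, (D e)%:Z <= r%:Z - (D (rev_arrow e))%:Z
    & r%:Z - (D (rev_arrow e))%:Z <= (\sum_(v in side e) dd v)%N%:Z]) /\
  (forall v : T, 0 <= r%:Z - \sum_(e : arrow T | src e == v) (r%:Z - (D e)%:Z)).
Proof.
have sumZ v : (forall e, (D e <= r)%N) ->
    \sum_(e : arrow T | src e == v) (r%:Z - (D e)%:Z) =
    (\sum_(e : arrow T | src e == v) (r - D e))%N%:Z.
  move=> Dr; rewrite (big_morph Posz PoszD (erefl 0%Z)); apply: eq_bigr => e _.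
  by have := Dr e; lia.
split=> [[U GU DU]|[De Dv]]; first subst D.
  have rev e := Phi_rev treeT compat GU e.
  split=> [e|v].
    have := Phi_kernel treeT compat GU e; rewrite side_count; have := rev e.
    by split; lia.
  rewrite sumZ; last by move=> e; have := rev e; lia.
  by rewrite subr_ge0 lez_nat; exact: (Phi_div treeT compat GU).
have Drev e : (D e + D (rev_arrow e) <= r)%N by have [] := De e; lia.
have Ddiv v : (\sum_(e | src e == v) (r - D e) <= r)%N.
  have := Dv v; rewrite sumZ; last by move=> e; have := Drev e; lia.
  by rewrite subr_ge0 lez_nat.
have [g gb] := exists_fibers (sum_multiplicity treeT Drev Ddiv T0).
pose o i := tag (g i).
have po i : point (o i).
  apply: (@multiplicity_point _ r D); rewrite -lt0n.
  exact: leq_ltn_trans (leq0n _) (ltn_ord (tagged (g i))).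
have oD : forall e, inside_count o e = D e.
  by apply: (inside_count_multiplicity treeT Drev Ddiv po) => p; exact: fibers_card.
have [U oU] : model_stratum C tg o !=set0.
  apply: model_stratum_neq0 => // [|e]; first exact: leq_addr.
  by rewrite side_count oD; have [_ _] := De e; lia.
exists U; first exact: model_stratum_Gr oU.
by apply/funext => e; rewrite (model_stratum_Phi treeT compat e oU) oD.
Qed.

Lemma stratum_Psum_nonempty rr : stratum M r (Psum k rr) !=set0 <->
  (\sum_v rr v)%N = r /\
  (forall e, (\sum_(v in side e) rr v <= \sum_(v in side e) dd v)%N).
Proof.
split=> [[U sU]|[rrr le]].
  have [v _] := some_vertex; have rrr := stratum_Psum_sum v sU; split=> // e.
  have [u [E cu]] := stratum_vertices rrr; rewrite E in sU.
  have GU := model_stratum_Gr treeT compat sU.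
  have := Phi_kernel treeT compat GU e; rewrite (model_stratum_Phi treeT compat _ sU) cu.
  by rewrite side_count; have := side_sum_rev e rrr; lia.
have [u [-> cu]] := stratum_vertices rrr.
apply: model_stratum_neq0 => // [i||e]; [by rewrite /point eqxx | exact: leq_addr |].
by rewrite cu side_count; have := side_sum_rev e rrr; have := le e; lia.
Qed.

Lemma stratum_Psum_Phi rr U : stratum M r (Psum k rr) U ->
  forall e, Phi M U e = (\sum_(v in side e) rr v)%N.
Proof.
move=> sU e; have [v _] := some_vertex; have rrr := stratum_Psum_sum v sU.
have [u [E cu]] := stratum_vertices rrr; rewrite E in sU.
by rewrite (model_stratum_Phi treeT compat _ sU) cu.
Qed.

(** The balance of generators at [v] recovers [rr v] from the side sums along the arrows out of
    [v]. *)
Lemma side_sums_eq rr rr' : (\sum_v rr v)%N = r -> (\sum_v rr' v)%N = r ->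
  (forall e, (\sum_(v in side e) rr v)%N = (\sum_(v in side e) rr' v)%N) -> rr =1 rr'.
Proof.
have fib s : (\sum_v s v)%N = r -> forall v,
    s v = (r - \sum_(e | src e == v) (r - \sum_(x in side e) s x))%N.
  move=> ss v; have [g gb] := exists_fibers ss.
  pose o i := (tag (g i), tag (g i)).
  have po i : point (o i) by rewrite /point eqxx.
  have fo x : (\sum_i (o i == (x, x)) = s x)%N.
    by rewrite -(fibers_card gb); apply: eq_bigr => i _; rewrite xpair_eqE andbb.
  have No e : inside_count o e = (\sum_(x in side e) s x)%N by apply: inside_count_vertices.
  have := inside_count_balance treeT v po; rewrite fo.
  by under eq_bigr do rewrite No; lia.
move=> rrr rrr' E v; rewrite (fib rr rrr) (fib rr' rrr').
by congr (_ - _)%N; apply: eq_bigr => e _; rewrite E.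
Qed.

Lemma Psum_iso_inj rr rr' : stratum M r (Psum k rr) !=set0 ->
  rep_iso (Psum k rr) (Psum k rr') -> rr =1 rr'.
Proof.
move=> [U sU] iso; have [v _] := some_vertex.
have sU' : stratum M r (Psum k rr') U by rewrite -(stratum_iso _ _ iso).
apply: side_sums_eq => [||e]; first exact: (stratum_Psum_sum v sU).
  exact: (stratum_Psum_sum v sU').
by rewrite -(stratum_Psum_Phi sU) (stratum_Psum_Phi sU').
Qed.

Lemma Sc_Psum rr : stratum M r (Psum k rr) !=set0 -> Sc (Psum k rr) =
  [set U | Gr M r U /\ forall e, (Phi M U e <= \sum_(v in side e) rr v)%N].
Proof.
move=> /stratum_Psum_nonempty[rrr _]; have [u [-> cu]] := stratum_vertices rrr.
apply/seteqP; split.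
  apply: zclosure_min; first exact: zclosed_Phi_le.
  move=> U sU; split=> [|e]; first exact: model_stratum_Gr sU.
  by rewrite (model_stratum_Phi treeT compat _ sU) cu.
move=> U [GU le]; apply: model_stratum_closure_le => // e; by rewrite cu.
Qed.

Lemma stratum_Gr N : stratum M r N `<=` Gr M r. Proof. by move=> U []. Qed.

Lemma projective_stratum N : projective N -> stratum M r N !=set0 ->
  exists rr, [/\ rep_iso N (Psum k rr), stratum M r N = stratum M r (Psum k rr) &
    (\sum_v rr v)%N = r].
Proof.
case=> rr iso N0; exists rr; split=> //; first exact: stratum_iso.
by rewrite (stratum_iso _ _ iso) in N0; case/stratum_Psum_nonempty: N0.
Qed.

Lemma Sc_irreducible N : projective N -> stratum M r N !=set0 ->
  irreducible M r (Sc N).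
Proof.
move=> pN N0; have [rr [iso E rrr]] := projective_stratum pN N0.
apply: irreducible_zclosure; first exact: stratum_Gr.
have [u [Eu _]] := stratum_vertices rrr; rewrite E Eu in N0 *.
exact: model_stratum_irreducible.
Qed.

(** Inclusion bounds the side sums of [N] by those of [N'] along every arrow; along an arrow and its
    reverse both add up to [r], which forces equality. *)
Lemma Sc_sub_iso N N' : projective N -> stratum M r N !=set0 ->
  projective N' -> stratum M r N' !=set0 -> Sc N `<=` Sc N' -> rep_iso N N'.
Proof.
move=> pN N0 pN' N0'; have [rr [iso E rrr]] := projective_stratum pN N0.
have [rr' [iso' E' rrr']] := projective_stratum pN' N0'.
rewrite E E' => sub; rewrite E' in N0'; case: N0 => U; rewrite E => sU.
have := sub U (sub_zclosure sU); rewrite Sc_Psum // => -[_ le].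
have eq_rr : rr = rr'.
  apply/funext; apply: side_sums_eq => // e.
  have := side_sum_rev e rrr; have := side_sum_rev e rrr'.
  have := le e; have := le (rev_arrow e); rewrite !(stratum_Psum_Phi sU); lia.
by apply: rep_iso_trans iso _; rewrite eq_rr; exact: rep_iso_sym.
Qed.

(** Replacing every midpoint by one of its ends can only increase the counts of inside generators,
    so the closure criterion applies and the capacity condition for nonemptiness persists. *)
Lemma Gr_cover U : Gr M r U -> exists u, stratum_at u !=set0 /\
  zclosure M r (stratum_at u) U.
Proof.
move=> GU; have [o [po oU]] := model_stratum_cover treeT compat GU T0.
pose u i := (o i).1; exists u.
have le e : (inside_count o e <= inside_count (fun i => (u i, u i)) e)%N.
  apply: leq_sum => i _; rewrite inside_vertex /inside /u.
  by do 2!case: (_ \in _).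
split; last first.
  apply: model_stratum_closure_le => // e.
  by rewrite (model_stratum_Phi treeT compat _ oU).
apply: model_stratum_neq0 => // [i||e]; [by rewrite /point eqxx | exact: leq_addr |].
have := Phi_kernel treeT compat GU e; rewrite (model_stratum_Phi treeT compat _ oU).
by have := le (rev_arrow e); lia.
Qed.

Lemma irreducible_in_Sc Z : zclosed M r Z -> irreducible M r Z ->
  exists N, [/\ projective N, stratum M r N !=set0 & Z `<=` Sc N].
Proof.
move=> cZ iZ.
(* A finite closed cover indexed by placements of the generators at vertices; empty strata are sent
   to [set0], so that the member found below is nonempty. *)
pose F (u : {ffun 'I_r -> T}) := if pselect (stratum_at u !=set0) is left _
  then zclosure M r (stratum_at u) else set0.
have cF (x : {ffun 'I_r -> T}) : zclosed M r (F x).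
  rewrite /F; case: pselect => _; last exact: zclosed0.
  by apply: zclosed_zclosure; exact: model_stratum_Gr.
have [|u _ sub] := irreducible_bigU (s := enum {ffun 'I_r -> T}) iZ cF.
  move=> U /(zclosed_sub_Gr cZ) GU; have [u [u0 uU]] := Gr_cover GU;
    pose u' := [ffun i => u i].
  have E : (u' : 'I_r -> T) = u by apply/funext => i; rewrite ffunE.
  exists u'; last by rewrite /F E; case: pselect.
  have : u' \in enum {ffun 'I_r -> T} by rewrite mem_enum.
  elim: (enum _) => //= x s IHs; rewrite inE => /orP[/eqP->|/IHs]; by [left|right].
have [rr [rrr E]] := stratum_of_vertices u.
have [U0 ZU0] := iZ.1; have := sub U0 ZU0; rewrite /F; case: pselect => // u0 _.
exists (Psum k rr); split; [|by rewrite E|].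
  by exists rr; exists (fun v => \1%VF); split=> [v|e x]; [exists id => y;
    rewrite lfunE | rewrite !lfunE].
by rewrite E; apply: subset_trans sub _; rewrite /F; case: pselect => // ? W.
Qed.

Lemma irreducible_componentP (Z : set (subtuple M)) : irreducible_component M r Z <->
  exists N, [/\ projective N, stratum M r N !=set0 & Z = Sc N].
Proof.
split=> [[cZ iZ maxZ]|[N [pN N0 ->]]].
  have [N [pN N0 sub]] := irreducible_in_Sc cZ iZ; exists N; split=> //.
  apply/esym; apply: maxZ => //; last exact: Sc_irreducible.
  by apply: zclosed_zclosure; exact: stratum_Gr.
split; [by apply: zclosed_zclosure; exact: stratum_Gr | exact: Sc_irreducible |].
move=> Z' cZ iZ sub; have [N' [pN' N0' sub']] := irreducible_in_Sc cZ iZ.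
have iso := Sc_sub_iso pN N0 pN' N0' (subset_trans sub sub').
by apply/seteqP; split=> //; rewrite (stratum_iso _ _ iso).
Qed.

Lemma Gr_pure_dimension : pure_dimension M r (r * n).
Proof.
move=> Z /irreducible_componentP[N [pN N0 ->]].
have [rr [iso E rrr]] := projective_stratum pN N0.
have [u [Eu _]] := stratum_vertices rrr; rewrite E Eu in N0 *.
exact: model_stratum_dimension.
Qed.

End ProjectiveGrassmannian.

(** * Lattices *)

Lemma fraction_num_den (R : idomainType) (q : {fraction R}) :
  exists x y : R, y != 0 /\ q * tofrac y = tofrac x.
Proof.
elim/quotW: q => x; exists (x : R * R).1, (x : R * R).2; split; first exact: denom_ratioP.
unlock FracField.tofrac; rewrite -[LHS]FracField.pi_mul; apply/eqmodP.
rewrite /= FracField.equivfE /FracField.mulf !numden_Ratio ?oner_neq0 ?mulf_neq0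
  ?oner_neq0 ?denom_ratioP //.
by rewrite !mulr1 mulrC.
Qed.

Section Lattices.
Variables (R : dvr) (V : vectType (fracfield R)).
Implicit Types (A B L : set V).

(** Divisibility by powers of [unif] is bounded because the ideal [J] of all [x] with some
    [x * unif ^+ n] a multiple of [a] is principal: if [n] serves for its generator and
    [unif ^+ n.+1] divided [a], then [unif] would be a unit. *)
Lemma dvr_unit_power (a : R) : a != 0 ->
  exists n b, b \is a GRing.unit /\ a = b * unif ^+ n.
Proof.
move=> a0; have [pid pi0 nonunit] := dvrP R.
pose J := [set x : R | exists n c, x * unif ^+ n = c * a].
have [|b Jb] := pid J.
  split; first by exists 0%N, 0; rewrite !mul0r.
    move=> x y [n [c xc]] [m [c' yc]]; exists (n + m)%N, (c * unif ^+ m + c' * unif ^+ n).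
    have -> : (x + y) * unif ^+ (n + m) =
        x * unif ^+ n * unif ^+ m + y * unif ^+ m * unif ^+ n by rewrite exprD; ring.
    by rewrite xc yc; ring.
  by move=> y x [n [c xc]]; exists n, (y * c); rewrite -!mulrA xc.
have [n [c bc]] : J b by rewrite Jb; exists 1; rewrite ?mul1r.
have nd : ~ exists x, a = x * unif ^+ n.+1.
  move=> [x ax]; have : J x by exists n.+1, 1; rewrite mul1r.
  rewrite Jb => -[y _ yx].
  have piu : unif * (y * c) = 1 :> R.
    apply: (mulIf a0); rewrite mul1r {2}ax -yx exprS.
    have -> : y * b * (unif * unif ^+ n) = y * (b * unif ^+ n) * unif by ring.
    by rewrite bc; ring.
  have /nonunit : exists y, unif = y * unif :> R by exists 1; rewrite mul1r.
  by case/negP; apply/unitrPr; exists (y * c).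
have [m] := ex_minnP (ex_intro (fun m => `[< ~ exists x, a = x * unif ^+ m >]) n.+1
  (asboolT nd)).
case: m => [/asboolP[]|m /asboolP nm min]; first by exists a; rewrite mulr1.
have [x ax] : exists x, a = x * unif ^+ m.
  by apply: contrapT => H; have := min m (asboolT H); rewrite ltnn.
exists m, x; split=> //; apply: contrapT => /negP/nonunit[y xy]; apply: nm.
by exists y; rewrite exprS mulrA -xy.
Qed.

Lemma unifK_neq0 : unifK R != 0.
Proof. by case: (dvrP R) => _ pi0 _; rewrite tofrac_eq0. Qed.

Lemma fraction_clear (q : fracfield R) : exists n a, unifK R ^+ n * q = tofrac (a : R).
Proof.
have [x [y [y0 qy]]] := fraction_num_den q.
have [n [b [bu yb]]] := dvr_unit_power y0; exists n, (x * b^-1).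
have b0 : tofrac b != 0 :> fracfield R.
  by rewrite tofrac_eq0; apply: contraTneq bu => ->; rewrite unitr0.
apply: (mulIf b0); rewrite -rmorphM /= mulrVK // -qy yb rmorphM rmorphXn /= -/(unifK R).
by ring.
Qed.

Lemma lattice_linear A a b x y : is_lattice A -> A x -> A y ->
  A (tofrac (a : R) *: x + tofrac (b : R) *: y).
Proof.
case=> e _ -> [c _ <-] [c' _ <-]; exists (fun i => a * c i + b * c' i) => //.
rewrite !scaler_sumr -big_split; apply: eq_bigr => i _ /=.
by rewrite rmorphD !rmorphM scalerDl !scalerA.
Qed.

Lemma lattice0 A : is_lattice A -> A 0.
Proof.
by case=> e _ ->; exists (fun=> 0) => //; apply: big1 => i _; rewrite rmorph0 scale0r.
Qed.

Lemma lattice_scale A a x : is_lattice A -> A x -> A (tofrac (a : R) *: x).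
Proof.
move=> LA Ax; have := @lattice_linear A a 0 x x LA Ax Ax.
by rewrite rmorph0 scale0r addr0.
Qed.

Lemma lattice_pi A n x : is_lattice A -> A x -> A (unifK R ^+ n *: x).
Proof. by move=> LA Ax; rewrite /unifK -rmorphXn; exact: lattice_scale. Qed.

Lemma lattice_sum A (I : Type) (s : seq I) (F : I -> V) : is_lattice A ->
  (forall i, A (F i)) -> A (\sum_(i <- s) F i).
Proof.
move=> LA AF; elim/big_ind: _ => // [|x y Ax Ay]; first exact: lattice0.
by have := @lattice_linear A 1 1 x y LA Ax Ay; rewrite rmorph1 !scale1r.
Qed.

Lemma lattice_absorbs A x : is_lattice A -> exists n, A (unifK R ^+ n *: x).
Proof.
move=> LA; have := LA; case=> e be AE.
have /choice[n nP] i : exists n, exists a, unifK R ^+ n * coord e i x = tofrac (a : R).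
  exact: fraction_clear.
have /choice[a aP] := nP.
exists (\max_i n i)%N; rewrite {1}(coord_basis be (memvf x)) scaler_sumr.
apply: lattice_sum => // i; rewrite scalerA.
have le : (n i <= \max_i n i)%N by exact: leq_bigmax.
rewrite -(subnK le) exprD -mulrA aP -scalerA; apply: lattice_pi => //.
apply: lattice_scale => //; rewrite AE; exists (fun j => (j == i)%:R) => //.
rewrite (bigD1 i) //= eqxx rmorph1 scale1r big1 ?addr0 // => j /negPf->.
by rewrite rmorph0 scale0r.
Qed.

Lemma lattice_commensurable A B : is_lattice A -> is_lattice B ->
  exists n, dilate (unifK R ^+ n) B `<=` A.
Proof.
move=> LA [e _ ->]; have /choice[n nP] (i : 'I_(\dim {:V})) := lattice_absorbs e`_i LA.
exists (\max_i n i)%N => _ [_ [a _ <-] <-]; rewrite scaler_sumr.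
apply: lattice_sum => // i; rewrite scalerA mulrC -scalerA; apply: lattice_scale => //.
have le : (n i <= \max_i n i)%N by exact: leq_bigmax.
by rewrite -(subnK le) exprD -scalerA; apply: lattice_pi.
Qed.

Lemma hclass_self A : hclass A A.
Proof.
exists 1; first exact: oner_neq0.
by apply/seteqP; split=> [_ [x Ax <-]|x Ax]; [rewrite scale1r | exists x; rewrite ?scale1r].
Qed.

Lemma hclass_eq A B L : hclass A L -> hclass B L -> hclass A = hclass B.
Proof.
suff sub A' B' : hclass A' L -> hclass B' L -> hclass A' `<=` hclass B'.
  by move=> AL BL; apply/seteqP; split; exact: sub.
move=> [a /= a0 aL] [b /= b0 bL] _ [c /= c0 <-]; exists (c / a * b).
  by rewrite /= !mulf_neq0 ?invr_eq0.
have dilateM x y (S : set V) : dilate (x * y) S = dilate x (dilate y S).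
  by rewrite /dilate image_comp; apply: eq_imagel => z _ /=; rewrite scalerA.
by rewrite dilateM bL -aL -dilateM divfK.
Qed.

Section Connectedness.
Variables (I : finType) (L : I -> set V).
Hypotheses (confL : is_configuration L) (convL : convex L).
Local Notation pi := (unifK R).

(** [N] makes the intersection [Ct 0] equal to a multiple of [L j], and [N'] makes [Ct (N + N')]
    equal to [L i]. In between, [pi Ct t.+1] lies in [Ct t], which lies in [Ct t.+1], so successive
    classes are equal or adjacent. *)
Lemma config_connected : connected (config_graph L).
Proof.
have [_ lat inj] := confL.
suff H (i j : config_graph L) : connect (@adj (config_graph L)) i j.
  move=> i j; have /connectP[p ip ->] := H i j.
  by exists (size p); apply/asboolP; exists p.
have [N NP] := lattice_commensurable (lat i) (lat j).
have [N' NP'] := lattice_commensurable (lat j) (lat i).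
pose D t := dilate (pi ^+ N / pi ^+ t) (L j).
have pi0 t : pi ^+ t != 0 by rewrite expf_neq0 // unifK_neq0.
pose Ct t := L i `&` D t.
have /choice[x xP] t : exists x : config_graph L, hclass (L x) (Ct t).
  apply: (convL (hclass_self (L i))); exists (pi ^+ N / pi ^+ t) => //=.
  by rewrite mulf_neq0 ?invr_eq0.
have xE t y : hclass (L y) (Ct t) -> x t = y.
  by move=> yt; apply: inj; exact: hclass_eq (xP t) yt.
have x0 : x 0%N = j.
  apply: xE; exists (pi ^+ N); first exact: pi0.
  rewrite /Ct /D divr1; apply/seteqP; split=> [y Dy|y []//]; split=> //.
  exact: NP.
have xN : x (N + N')%N = i.
  apply: xE; rewrite (_ : Ct _ = L i); first exact: hclass_self.
  apply/seteqP; split=> [y []//|y Ly]; split=> //.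
  exists (pi ^+ N' *: y); first by apply: NP'; exists y.
  by rewrite scalerA exprD invfM mulrA divff // mul1r mulVf // scale1r.
have coefE t : pi * (pi ^+ N / pi ^+ t.+1) = pi ^+ N / pi ^+ t.
  by rewrite exprS invfM mulrCA mulVKf // unifK_neq0.
have step t : connect (@adj (config_graph L)) (x t) (x t.+1).
  have [->|ne] := eqVneq (x t) (x t.+1); first exact: connect0.
  apply: connect1; rewrite adj_sym; apply/asboolP; split.
    by move=> /inj E; rewrite E eqxx in ne.
  exists (Ct t.+1), (Ct t); split; [exact: xP | exact: xP | |].
    move=> _ [y [Liy [z Lz zy]] <-]; split.
      by have := @lattice_pi _ 1 _ (lat i) Liy; rewrite expr1.
    by exists z => //; rewrite -zy scalerA coefE.
  move=> y [Liy [z Lz zy]]; split=> //; exists (pi *: z).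
    by have := @lattice_pi _ 1 _ (lat j) Lz; rewrite expr1.
  by rewrite -zy scalerA mulrC coefE.
suff chain t : connect (@adj (config_graph L)) (x 0%N) (x t).
  have sym : connect_sym (@adj (config_graph L)) by apply: sym_connect_sym; exact: adj_sym.
  by rewrite sym -x0 -xN.
elim: t => [|t IHt]; first exact: connect0.
exact: connect_trans IHt (step t).
Qed.

End Connectedness.
End Lattices.

Lemma config_is_tree (R : dvr) (k : fieldType) (V : vectType (fracfield R))
    (I : finType) (L : I -> set V) (Lbar : I -> vectType k)
    (f : forall i j, 'Hom(Lbar i, Lbar j)) (dd : config_graph L -> nat) :
  is_configuration L -> locally_linearly_independent L f ->
  rep_iso (config_rep L f) (Psum k dd) -> (0 < \sum_v dd v)%N -> is_tree (config_graph L).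
Proof.
move=> confL [convL indep] [phi [pb pc]] dd0; set T := config_graph L.
have conn : connected T by exact: config_connected.
have [v0 p0] : exists v0 : T, (0 < dd v0)%N.
  apply: contrapT => H; move: dd0; rewrite big1 // => v _.
  by apply/eqP; rewrite -leqn0 leqNgt; apply/negP => dv; apply: H; exists v.
pose p : {v : T & 'I_(dd v)} := Tagged (fun v => 'I_(dd v)) (Ordinal p0).
(* A copy of [Prep v0] has a nonzero vector at [u] which is the image of a vector at each neighbour
   not farther from [v0]; two such neighbours would contradict the independence of the images. *)
have key (a b u : T) : adj a u -> adj b u ->
      (dist v0 a <= dist v0 u)%N -> (dist v0 b <= dist v0 u)%N -> a = b.
  move=> au bu da db; apply/eqP/negPn/negP => ab.
  have [fK Kf] := lfun_bij_inv (pb u); pose x := ((phi u)^-1)%VF (Psum_delta k p).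
  have ximg (c : T) : adj c u -> (dist v0 c <= dist v0 u)%N -> x \in limg (f c u).
    move=> cu dc; pose e : arrow T := exist _ (c, u) cu.
    have ve : v0 \in side e by apply: side_of_le.
    have [gK Kg] := lfun_bij_inv (pb c).
    have -> : x = f c u (((phi c)^-1)%VF (Psum_delta k p)).
      apply: (can_inj fK); rewrite Kf.
      by have := pc e (((phi c)^-1)%VF (Psum_delta k p)); rewrite Kg rmap_Psum_delta ve.
    by rewrite memv_img ?memvf.
  have x0 : x != 0.
    apply/eqP => /(congr1 (phi u)); rewrite linear0 Kf => /ffunP/(_ p).
    by rewrite !ffunE eqxx => /eqP; rewrite oner_eq0.
  move/directv_sumP: (indep u) => /(_ a au) E.
  have : x \in (limg (f a u) :&: \sum_(j | config_adj L j u && (j != a)) limg (f j u))%VS.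
    rewrite memv_cap ximg //= -[x]addr0.
    rewrite (bigD1 b) /=; last by rewrite eq_sym ab andbT.
    by apply: memv_add (mem0v _); exact: ximg.
  by rewrite E memv0 (negPf x0).
(* If [s] and [t] are adjacent at equal distance, then [t] and the neighbour of [s] closer to [v0]
   are two neighbours of the kind excluded by [key]. *)
have ev : even_from v0.
  move=> s t st dst; have [sv|sv] := eqVneq v0 s.
    have /eqP : dist v0 t = 0%N by rewrite -dst -sv distxx.
    by rewrite dist_eq0 // => /eqP tv; move: st; rewrite -sv -tv adj_irrefl.
  have [z zs dz] := dist_closer conn sv.
  have : z = t by apply: (key z t s zs) => //; [rewrite adj_sym | rewrite dz | rewrite dst].
  by move=> zt; move: dst; rewrite dz zt; lia.
have up : unique_parents v0 by move=> u a b au bu /ltnW da /ltnW db; exact: key da db.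
by split=> // x; [exact: even_from_all ev | exact: unique_parents_all ev up].
Qed.

Theorem theorem3p8
  (R : dvr) (k : closedFieldType) (res : {rmorphism R -> k})
  (hres : is_residue_map res)
  (d : nat) (V : vectType (fracfield R)) (hV : \dim {:V} = d)
  (I : finType) (L : I -> set V) (hL : is_configuration L)
  (Lbar : I -> vectType k) (red : forall i, V -> Lbar i)
  (hred : forall i, is_reduction res (L i) (red i))
  (f : forall i j, 'Hom(Lbar i, Lbar j)) (hf : induced_maps L red f)
  (hG : locally_linearly_independent L f)
  (r : nat) (hr : (0 < r < d)%N)
  (dd : config_graph L -> nat)
  (hdd : rep_iso (config_rep L f) (Psum k dd))
  (hsum : (\sum_v dd v)%N = d) :
  let T := config_graph L in
  let M := config_rep L f in
  let Sc := fun N : rep k T => zclosure M r (stratum M r N) in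
  (forall D : arrow T -> nat,
    (Phi M @` Gr M r) D <->
    (forall e : arrow T,
       [/\ 0 <= (D e)%:Z, (D e)%:Z <= r%:Z - (D (rev_arrow e))%:Z
         & r%:Z - (D (rev_arrow e))%:Z <= (\sum_(v in side e) dd v)%N%:Z]) /\
    (forall v : T,
       0 <= r%:Z - \sum_(e : arrow T | src e == v) (r%:Z - (D e)%:Z))) /\
  ((forall C : set (subtuple M), irreducible_component M r C <->
      exists N, [/\ projective N, stratum M r N !=set0 & C = Sc N]) /\
   (forall N N', projective N -> stratum M r N !=set0 ->
      projective N' -> stratum M r N' !=set0 ->
      Sc N = Sc N' -> rep_iso N N')) /\
  ((forall rr : T -> nat, stratum M r (Psum k rr) !=set0 <->
      (\sum_v rr v)%N = r /\
      (forall e : arrow T,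
         (\sum_(v in side e) rr v <= \sum_(v in side e) dd v)%N)) /\
   (forall rr rr' : T -> nat, stratum M r (Psum k rr) !=set0 ->
      rep_iso (Psum k rr) (Psum k rr') -> rr =1 rr') /\
   (forall (rr : T -> nat) U, stratum M r (Psum k rr) U ->
      forall e, Phi M U e = (\sum_(v in side e) rr v)%N)) /\
  (forall rr : T -> nat, stratum M r (Psum k rr) !=set0 ->
     Sc (Psum k rr) =
     [set U | Gr M r U /\
        forall e, (Phi M U e <= \sum_(v in side e) rr v)%N]) /\
  pure_dimension M r (r * (d - r)).
Proof.
have /andP[r0 rd] := hr; have treeT : is_tree (config_graph L).
  by apply: config_is_tree hL hG hdd _; rewrite hsum; exact: leq_ltn_trans rd.
have T0 : (0 < #|config_graph L|)%N by case: hL.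
have [n dn] : exists n, d = (r + n)%N by exists (d - r)%N; rewrite subnKC // ltnW.
rewrite dn addKn; rewrite dn in hsum.
have [C [tg [compat tgd]]] := projective_coordinates hdd hsum.
split; first by move=> D; exact: (Phi_imageP treeT T0 compat tgd).
split.
  split; first by move=> Z; exact: (irreducible_componentP treeT T0 compat tgd).
  move=> N N' pN N0 pN' N0' E.
  by apply: (Sc_sub_iso treeT T0 compat tgd) => //; rewrite E.
split.
  split; first by move=> rr; exact: (stratum_Psum_nonempty treeT T0 compat tgd).
  split; first by move=> rr rr'; exact: (Psum_iso_inj treeT T0 compat).
  by move=> rr U; exact: (stratum_Psum_Phi treeT T0 compat).
split; first by move=> rr; exact: (Sc_Psum treeT T0 compat tgd).
exact: (Gr_pure_dimension treeT T0 compat tgd).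
Qed.
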